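(* There exists an absolute constant $c_0>0$, independent of $(m,n,d)$, such that for all positive integers $m,n,d$ with $m\wedge n\ge\log d$ and $m\vee n\ge d$, $$\inf_{\widehat\pi}\ \sup_{\pi^\star\in S_d,\ \Sigma\succ0:\ \|\Sigma\|_{\mathrm{op}}\le1}\ \mathbb{E}\,\big\|\Sigma^{\widehat\pi}-\Sigma^{\pi^\star}\big\|_{\mathrm F}^2\ \ge\ c_0\left(\frac{d\log d}{m\wedge n}+\sqrt{\frac{d^3\log d}{mn}}\right),$$ where the infimum is over all estimators $\widehat\pi=\widehat\pi(X^m,Y^n)$ with values in $S_d$, and the expectation is over $X^m\sim\mathcal N(0,\Sigma)^{\otimes m}$ and $Y^n\sim\mathcal N(0,\Sigma^{\pi^\star})^{\otimes n}$ drawn independently.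
   Context: $S_d$ is the set of permutations of $\{1,\dots,d\}$. For $A\in\mathbb{R}^{d\times d}$ and $\pi\in S_d$, $(A^\pi)_{i,j}=A_{\pi(i),\pi(j)}$. $\|\cdot\|_{\mathrm F}$ and $\|\cdot\|_{\mathrm{op}}$ are the Frobenius and operator norms; $a\wedge b=\min(a,b)$, $a\vee b=\max(a,b)$. $X^m=(X_1,\dots,X_m)$ and $Y^n=(Y_1,\dots,Y_n)$ are the two observed samples of vectors in $\mathbb{R}^d$; neither $\Sigma$ nor $\pi^\star$ is known to the estimator. *)

(* Defs.v *)
From HB Require Import structures.
From mathcomp Require Import all_boot all_order all_algebra all_fingroup.
From mathcomp Require Import all_classical all_reals all_analysis.

Set Implicit Arguments.
Unset Strict Implicit.
Unset Printing Implicit Defensive.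

Import Order.TTheory GRing.Theory Num.Theory.
Import numFieldNormedType.Exports.

Local Open Scope classical_set_scope.
Local Open Scope ring_scope.

Section matrices.
Context {R : realType}.

Definition conj_perm d (A : 'M[R]_d) (s : 'S_d) : 'M[R]_d :=
  \matrix_(i, j) A (s i) (s j).

Definition frobenius_norm m n (A : 'M[R]_(m, n)) : R :=
  Num.sqrt (\sum_i \sum_j A i j ^+ 2).

Definition euclidean_norm d (x : 'cV[R]_d) : R :=
  Num.sqrt (\sum_i x i 0 ^+ 2).

(* The library's norm on ['M[R]_(m, n)] is the entrywise maximum, so the
   operator norm induced by the Euclidean norm is defined here; the supremum is
   over a nonempty bounded set. *)
Definition operator_norm m n (A : 'M[R]_(m, n)) : R :=
  sup [set euclidean_norm (A *m x) | x in [set x | euclidean_norm x <= 1]].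

Definition positive_definite d (A : 'M[R]_d) : Prop :=
  A^T = A /\ forall x : 'cV[R]_d, x != 0 -> 0 < (x^T *m A *m x) 0 0.

End matrices.

Section tuple_power.
Context d (T : measurableType d) (R : realType) (mu : set T -> \bar R).

(* The [n]-fold product measure on the product sigma-algebra of [n.-tuple T];
   [mu] is meant to be a sigma-finite measure. *)
Fixpoint tuple_power (n : nat) : set (n.-tuple T) -> \bar R :=
  if n is k.+1 then
    pushforward (mu \x @tuple_power k)%E
      (fun p : T * k.-tuple T => [tuple of p.1 :: p.2])
  else \d_[tuple].

End tuple_power.
Arguments tuple_power {d T R} mu n.

Section gaussian.
Context {R : realType} {d : nat}.

(* Vectors of R^d are [d.-tuple (measurableTypeR R)], which carries the Borel
   sigma-algebra. *)
Definition gaussian_pdf (S : 'M[R]_d) (x : d.-tuple (measurableTypeR R)) : R :=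
  let v : 'cV[R]_d := \col_i tnth x i in
  (Num.sqrt ((2 * pi) ^+ d * \det S))^-1 *
  expR (- ((v^T *m invmx S *m v) 0 0) / 2).

(* The law N(0, S), for [S] positive definite. *)
Definition gaussian_prob (S : 'M[R]_d) : set (d.-tuple (measurableTypeR R)) -> \bar R :=
  fun A => (\int[tuple_power lebesgue_measure d]_(x in A)
              (gaussian_pdf S x)%:E)%E.

End gaussian.

Section minimax.
Context (R : realType) (m n d : nat).

Definition samples : Type :=
  (m.-tuple (d.-tuple (measurableTypeR R)) *
   n.-tuple (d.-tuple (measurableTypeR R)))%type.

(* Measurability with respect to the discrete sigma-algebra on ['S_d]. *)
Definition estimator (pihat : samples -> 'S_d) : Prop :=
  forall s : 'S_d, measurable (pihat @^-1` [set s]).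

Definition sample_law (S : 'M[R]_d) (s : 'S_d) : set samples -> \bar R :=
  (tuple_power (gaussian_prob S) m \x
   tuple_power (gaussian_prob (conj_perm S s)) n)%E.

Definition risk (pihat : samples -> 'S_d) (S : 'M[R]_d) (s : 'S_d) : \bar R :=
  (\int[sample_law S s]_z
     (frobenius_norm (conj_perm S (pihat z) - conj_perm S s) ^+ 2)%:E)%E.

Definition parameters : set ('S_d * 'M[R]_d) :=
  [set p | positive_definite p.2 /\ operator_norm p.2 <= 1].

Definition minimax_risk : \bar R :=
  ereal_inf [set ereal_sup [set risk pihat p.2 p.1 | p in parameters]
            | pihat in estimator].

End minimax.

(* Main.v *)
Require Import Defs.
From HB Require Import structures.
From mathcomp Require Import all_boot all_order all_algebra all_fingroup.
From mathcomp Require Import all_classical all_reals all_analysis.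
From mathcomp Require Import measurable_realfun ring lra zify.
Set Implicit Arguments.
Unset Strict Implicit.
Unset Printing Implicit Defensive.
Import Order.TTheory GRing.Theory Num.Theory.
Import numFieldNormedType.Exports.
Local Open Scope classical_set_scope.
Local Open Scope ring_scope.

(** The lower bound is proved on explicit families of covariance matrices.

    In large dimension, the coordinates are cut into two blocks of sizes [p] and
    [q] that differ by at most one, and the covariance is that of a vector whose
    first block is white noise and whose second block is a matrix [W] of random
    signs, of amplitude [tau], applied to the first block, plus white noise. The
    unknown permutation acts on the first block. So the larger sample only
    informs about [W], and the smaller sample follows the regression on the
    permuted coordinates. The loss of an estimate that is wrong on half of the
    first block is of order [tau ^+ 2 * p * q] for almost all sign matrices
    ([sign_loss_ge]): no permutation that moves half of the first block nearly
    preserves the correlations ([card_not_rigid]), and the matrices [W] have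
    operator norm of order [tau * sqrt q] ([card_not_op_bounded]), which also keeps
    the operator norm of the covariance below one.

    It remains to find the largest [tau] for which most of the permutation cannot
    be recovered. By a Fano inequality ([fano_success_bound]), this holds when
    the divergence between the law of the data, with [W] averaged, and the same
    law with the smaller sample replaced by white noise is a small multiple of
    [d * ln d]. The divergence is expanded along the smaller sample
    ([kl_chain_rule]); for the next observation given the past, it involves
    the posterior mean of the signs and a term of second order
    ([divergence_rows_density_le]). The posterior mean of a scaled sign is at most
    [tau]; it is also controlled by the squared Hellinger distance between the
    laws of the data before and after the flip of this sign
    ([odd_mean_sqr_le]), which is at most of order [N * tau ^+ 2] for [N] the
    larger sample size. These two estimates
    ([information_bound]) allow [tau ^+ 2] of order [ln d / (d * k)] and
    [sqrt (ln d / (d * k * N))], with [k] the smaller sample size, and produce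
    the two terms of the rate ([signal_information]).

    For bounded dimension, both terms of the rate are of order [k^-1], and it
    suffices to compare two covariances in which one variance is raised by
    [k^-1/2], at one of two coordinates ([small_dimension_bound]). In dimension
    one the rate vanishes. *)

(** * Finite powers of a measure, and measures given by densities *)

Section tuple_power_measure.
Context d (T : measurableType d) (R : realType).
Local Open Scope ereal_scope.

Let cons_pair k (p : T * k.-tuple T) : k.+1.-tuple T := [tuple of p.1 :: p.2].

Lemma measurable_cons_pair k : measurable_fun setT (@cons_pair k).
Proof. exact: measurable_cons. Qed.

Section sigma_finite.
Variable mu : {sigma_finite_measure set T -> \bar R}.

(** Since the powers are defined by recursion, being a sigma-finite measure is
    proved by the same recursion, with the measure structures packed on the way. *)
Lemma tuple_power_packed n :
  exists M : {sigma_finite_measure set (n.-tuple T) -> \bar R},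
    (M : set _ -> \bar R) = @tuple_power _ T R mu n.
Proof.
elim: n => [|n [M IH]]; first by exists \d_([tuple] : 0.-tuple T).
pose P : {measure set (T * n.-tuple T)%type -> \bar R} := mu \x M.
pose Q0 : set (n.+1.-tuple T) -> \bar R := fun A => P (@cons_pair n @^-1` A).
have mm A : measurable A -> measurable (@cons_pair n @^-1` A).
  by move=> mA; rewrite -[X in measurable X]setTI; exact: measurable_cons_pair.
have m0 : Q0 set0 = 0 by rewrite /Q0 preimage_set0 measure0.
have mge0 A : 0 <= Q0 A by rewrite /Q0.
have msa : semi_sigma_additive Q0.
  move=> F mF tF mUF; rewrite /Q0 preimage_bigcup.
  apply: measure_semi_sigma_additive => //.
  - by move=> i; exact: mm.
  - apply/trivIsetP => i j _ _ ij; rewrite -preimage_setI.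
    by move/trivIsetP : tF => /(_ i j) ->//; rewrite preimage_set0.
  - by rewrite -preimage_bigcup; exact: mm.
pose i1 := isMeasure.Build _ _ _ Q0 m0 mge0 msa.
pose Q : {measure set (n.+1.-tuple T) -> \bar R} := HB.pack Q0 i1.
have sf : sigma_finite setT Q.
  have /sigma_finiteP[F [TF ndF Foo]] := sigma_finiteT mu.
  have /sigma_finiteP[G [TG ndG Goo]] := sigma_finiteT M.
  pose u (t : n.+1.-tuple T) : T * n.-tuple T := (thead t, [tuple of behead t]).
  have mu' : measurable_fun setT u.
    apply/measurable_fun_pair => /=; first exact: measurable_tnth.
    exact: measurable_behead.
  have uK p : u (cons_pair p) = p.
    by case: p => a b; congr pair; apply/val_inj.
  (* [u] inverts [cons_pair], so boxes of finite measure pull back *)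
  exists (fun k => u @^-1` (F k `*` G k)).
    rewrite -preimage_bigcup (_ : \bigcup_k _ = setT) ?preimage_setT//.
    rewrite -subTset => -[x y] _.
    have : setT x by []. rewrite TF => -[i _ Fx].
    have : setT y by []. rewrite TG => -[j _ Gy].
    exists (maxn i j) => //; split.
    - by move: x Fx; exact/subsetPset/ndF/leq_maxl.
    - by move: y Gy; exact/subsetPset/ndG/leq_maxr.
  move=> k; have [mF Fk] := Foo k; have [mG Gk] := Goo k; split.
    by rewrite -[X in measurable X]setTI; apply: mu' => //; exact: measurableX.
  rewrite /Q /= /Q0.
  suff -> : @cons_pair n @^-1` (u @^-1` (F k `*` G k)) = F k `*` G k.
    have PE : P (F k `*` G k) = mu (F k) * M (G k) := product_measure1E mu M mF mG.
    rewrite PE.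
    by rewrite lte_mul_pinfty// ge0_fin_numE.
  rewrite -[LHS]/(fun p => (F k `*` G k) (u (cons_pair p))).
  by apply/funext => p; rewrite uK.
pose i2 := Measure_isSigmaFinite.Build _ _ _ Q sf.
pose S : {sigma_finite_measure set (n.+1.-tuple T) -> \bar R} :=
  HB.pack Q0 i1 i2.
by exists S; rewrite /= -IH.
Qed.

Lemma tuple_power0_measure n : @tuple_power _ T R mu n set0 = 0.
Proof. by have [M <-] := tuple_power_packed n; exact: measure0. Qed.

Lemma tuple_power_ge0 n A : 0 <= @tuple_power _ T R mu n A.
Proof. by have [M <-] := tuple_power_packed n; exact: measure_ge0. Qed.

Lemma tuple_power_sigma_additive n :
  semi_sigma_additive (@tuple_power _ T R mu n).
Proof.
by have [M <-] := tuple_power_packed n; exact: measure_semi_sigma_additive.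
Qed.

HB.instance Definition _ n := isMeasure.Build _ _ _ (@tuple_power _ T R mu n)
  (@tuple_power0_measure n) (@tuple_power_ge0 n) (@tuple_power_sigma_additive n).

Lemma tuple_power_sigma_finite n : sigma_finite setT (@tuple_power _ T R mu n).
Proof. by have [M <-] := tuple_power_packed n; exact: sigma_finiteT. Qed.

HB.instance Definition _ n := Measure_isSigmaFinite.Build _ _ _
  (@tuple_power _ T R mu n) (@tuple_power_sigma_finite n).

Lemma integral_tuple_power0 (F : 0%N.-tuple T -> \bar R) :
  measurable_fun [set: 0%N.-tuple T] F -> \int[@tuple_power _ T R mu 0]_x F x = F [tuple].
Proof. by move=> mF; rewrite /= integral_dirac// diracT mul1e. Qed.

Lemma integral_tuple_powerS n (F : n.+1.-tuple T -> \bar R) :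
  measurable_fun setT F -> (forall x, 0 <= F x) ->
  \int[@tuple_power _ T R mu n.+1]_x F x =
  \int[mu]_a \int[@tuple_power _ T R mu n]_t F [tuple of a :: t].
Proof.
move=> mF F0; rewrite [tuple_power _ _]/=.
rewrite (@ge0_integral_pushforward _ _ _ _ _ _ (@measurable_cons_pair n))//.
rewrite preimage_setT fubini_tonelli1//=.
by apply: measurableT_comp => //; exact: measurable_cons_pair.
Qed.

End sigma_finite.

Lemma tuple_power_setT (mu : probability T R) n :
  @tuple_power _ T R mu n setT = 1.
Proof.
elim: n => [|n IH]; first by rewrite /= diracT.
rewrite -[LHS]mul1e -[LHS](@integral_cst _ _ _ (@tuple_power _ T R mu n.+1))//.
rewrite integral_tuple_powerS//=.
transitivity (\int[mu]_a (cst 1 a)).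
  by apply: eq_integral => a _; rewrite integral_cst// mul1e; exact: IH.
by rewrite integral_cst//= mul1e probability_setT.
Qed.

HB.instance Definition _ (mu : probability T R) n :=
  @Measure_isProbability.Build _ _ R (@tuple_power _ T R mu n) (tuple_power_setT mu n).

End tuple_power_measure.

Section density.
Context d (T : measurableType d) (R : realType).
Variables (mu : {measure set T -> \bar R}) (f : T -> R).
Hypotheses (mf : measurable_fun setT f) (f0 : forall x, 0 <= f x).
Local Open Scope ereal_scope.

Let dens : set T -> \bar R := fun A => \int[mu]_(x in A) (f x)%:E.

Let mfE A : measurable_fun A (EFin \o f).
Proof. by apply/measurable_EFinP; exact: measurable_funTS. Qed.

Lemma density_packaged : \int[mu]_x (f x)%:E = 1 ->
  exists P : probability T R, (P : set T -> \bar R) = dens.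
Proof.
move=> f1.
have m0 : dens set0 = 0 by rewrite /dens integral_set0.
have mge0 A : 0 <= dens A.
  by apply: integral_ge0 => x _; rewrite lee_fin.
have msa : semi_sigma_additive dens.
  move=> F mF tF mUF; rewrite /dens.
  rewrite ge0_integral_bigcup//=; last by move=> x _; rewrite lee_fin.
  apply: is_cvg_ereal_nneg_natsum_cond => n _ _.
  by apply: integral_ge0 => x _; rewrite lee_fin.
pose i1 := isMeasure.Build _ _ _ dens m0 mge0 msa.
pose Q : {measure set T -> \bar R} := HB.pack dens i1.
pose i2 := @Measure_isProbability.Build _ _ R Q f1.
pose P : probability T R := HB.pack dens i1 i2.
by exists P.
Qed.

Import HBNNSimple.

Lemma integral_density (P : {measure set T -> \bar R}) (F : T -> \bar R) :
  (forall A, measurable A -> P A = dens A) ->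
  measurable_fun setT F -> (forall x, 0 <= F x) ->
  \int[P]_x F x = \int[mu]_x (F x * (f x)%:E).
Proof.
move=> PE mF F0.
pose F_ := nnsfun_approx measurableT mF.
have FE (n : nat) : \int[P]_x (F_ n x)%:E = \int[mu]_x ((F_ n x)%:E * (f x)%:E).
  rewrite integralT_nnsfun.
  under [RHS]eq_integral.
    move=> x _; rewrite fimfunE -fsumEFin// ge0_mule_fsuml; last first.
      by move=> r; rewrite EFinM nnfun_muleindic_ge0.
    over.
  rewrite [RHS]ge0_integral_fsum//; last 2 first.
  - move=> r; apply: emeasurable_funM => //.
    by apply/measurable_EFinP; exact: measurableT_comp.
  - move=> r x _; rewrite EFinM mule_ge0//; last by rewrite lee_fin.
    by rewrite nnfun_muleindic_ge0.
  rewrite sintegralE; apply: eq_fsbigr => r _.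
  rewrite PE// /dens integral_mkcond.
  have [r0|r0] := leP 0%R r; last first.
    rewrite preimage_nnfun0// -integral_mkcond integral_set0 mule0 integral0_eq//.
    by move=> x _; rewrite indicE in_set0 mulr0 mul0e.
  rewrite -ge0_integralZl//; last first.
  - by move=> x _; apply: erestrict_ge0 => y _; rewrite lee_fin.
  - by rewrite -measurable_restrictT.
  apply: eq_integral => x _; rewrite patchE indicE.
  by case: (x \in _); rewrite ?mulr1 ?mulr0 ?mule0 ?mul0e.
transitivity (lim (\int[P]_x (F_ n x)%:E @[n --> \oo])).
  rewrite -monotone_convergence//=.
  - apply: eq_integral => ? /[!inE] xD; apply/esym/cvg_lim => //=.
    exact: cvg_nnsfun_approx.
  - by move=> n; exact/measurable_EFinP/measurable_funTS.
  - by move=> n ? _; rewrite lee_fin.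
  - by move=> ? _ ? ? mn; rewrite lee_fin; exact/lefP/nd_nnsfun_approx.
rewrite [RHS](_ : _ = lim (\int[mu]_x ((F_ n x)%:E * (f x)%:E) @[n --> \oo])).
  by apply: congr_lim; apply/funext => n /=.
rewrite -monotone_convergence//=.
- apply: eq_integral => x _; apply/esym/cvg_lim => //.
  by apply: cvgeZr => //; exact: cvg_nnsfun_approx.
- move=> n; apply: emeasurable_funM => //.
  exact/measurable_EFinP/measurable_funTS.
- by move=> n x _; rewrite mule_ge0 ?lee_fin.
- move=> x _ a b ab; apply: lee_wpmul2r; first by rewrite lee_fin.
  by rewrite lee_fin; exact/lefP/nd_nnsfun_approx.
Qed.

End density.

Section tuple_integrals.
Context d (T : measurableType d) (R : realType).
Local Open Scope ereal_scope.

Lemma measurable_tuple_prod n (h : 'I_n -> T -> R) :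
  (forall i, measurable_fun setT (h i)) ->
  measurable_fun [set: n.-tuple T] (fun x => (\prod_i h i (tnth x i))%R).
Proof.
move=> mh; apply: measurable_prod => i _.
by apply: measurableT_comp => //; exact: measurable_tnth.
Qed.

Lemma measurable_cat m n d' (T' : measurableType d')
    (f : T' -> m.-tuple T) (g : T' -> n.-tuple T) :
  measurable_fun setT f -> measurable_fun setT g ->
  measurable_fun setT (fun x => [tuple of f x ++ g x]).
Proof.
move=> mf mg; apply/measurable_fun_tnthP => i.
rewrite -[i]fintype.splitK; case: (fintype.split i) => j /=.
- rewrite (_ : _ \o _ = (fun x => tnth (f x) j)).
    by apply: (measurableT_comp (measurable_tnth j)).
  by apply/funext => x /=; rewrite tnth_lshift.
- rewrite (_ : _ \o _ = (fun x => tnth (g x) j)).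
    by apply: (measurableT_comp (measurable_tnth j)).
  by apply/funext => x /=; rewrite tnth_rshift.
Qed.

Variable mu : {sigma_finite_measure set T -> \bar R}.

Lemma integral_tuple_power_prod n (h : 'I_n -> T -> R) (c : 'I_n -> R) :
  (forall i, measurable_fun setT (h i)) ->
  (forall i x, (0 <= h i x)%R) ->
  (forall i, \int[mu]_x (h i x)%:E = (c i)%:E) ->
  \int[tuple_power mu n]_x (\prod_i h i (tnth x i))%:E = (\prod_i c i)%:E.
Proof.
elim: n h c => [|n IH] h c mh h0 hc.
  rewrite integral_tuple_power0 ?big_ord0//.
  by apply/measurable_EFinP; apply: (measurable_tuple_prod (h := h)) => i; exact: mh.
rewrite integral_tuple_powerS//; last 2 first.
  - by apply/measurable_EFinP; apply: (measurable_tuple_prod (h := h)) => i; exact: mh.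
  - by move=> x; rewrite lee_fin prodr_ge0.
have E a : \int[tuple_power mu n]_t
    (\prod_i h i (tnth [tuple of a :: t] i))%:E =
    (\prod_(i < n) c (lift ord0 i))%:E * (h ord0 a)%:E.
  rewrite -(IH (fun i => h (lift ord0 i)))// muleC -ge0_integralZl//; last 3 first.
  - by apply/measurable_EFinP; apply: (measurable_tuple_prod (h := fun i => h (lift ord0 i))) => i; exact: mh.
  - by move=> x _; rewrite lee_fin prodr_ge0.
  - by rewrite lee_fin.
  apply: eq_integral => t _; rewrite big_ord_recl EFinM; congr (_ * _%:E).
  by apply: eq_bigr => i _; rewrite tnthS.
under eq_integral do rewrite E.
rewrite ge0_integralZl//; last 3 first.
- exact/measurable_EFinP.
- by move=> x _; rewrite lee_fin.
- rewrite lee_fin prodr_ge0// => i _.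
  by rewrite -lee_fin -hc integral_ge0// => x _; rewrite lee_fin.
by rewrite hc -EFinM big_ord_recl mulrC.
Qed.

Lemma integral_tuple_power_cat m n (F : (m + n).-tuple T -> \bar R) :
  measurable_fun setT F -> (forall x, 0 <= F x) ->
  \int[tuple_power mu (m + n)]_x F x =
  \int[tuple_power mu m]_u \int[tuple_power mu n]_v F [tuple of u ++ v].
Proof.
elim: m F => [|m IH] F mF F0.
  rewrite integral_tuple_power0; last first.
    apply: (measurable_fun_fubini_tonelli_F
      (fun x : 0%N.-tuple T * n.-tuple T => F [tuple of x.1 ++ x.2])).
    - by apply: measurableT_comp => //; exact: measurable_cat.
    - by move=> x; exact: F0.
  by apply: eq_integral => x _; congr F; exact/val_inj.
rewrite (@integral_tuple_powerS _ _ _ mu (m + n) F)//.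
rewrite integral_tuple_powerS; last 2 first.
- apply: (measurable_fun_fubini_tonelli_F
      (fun x : m.+1.-tuple T * n.-tuple T => F [tuple of x.1 ++ x.2])).
  + by apply: measurableT_comp => //; exact: measurable_cat.
  + by move=> x; exact: F0.
- by move=> x; exact: integral_ge0.
apply: eq_integral => a _.
rewrite (IH (fun t => F [tuple of a :: t]))//.
- apply: eq_integral => u _; apply: eq_integral => v _.
  by congr F; exact/val_inj.
- by apply: measurableT_comp => //; exact: measurable_cons.
Qed.

Lemma integral_tuple_power_density n (f : T -> R) (P : probability T R)
    (F : n.-tuple T -> \bar R) :
  measurable_fun setT f -> (forall x, (0 <= f x)%R) ->
  (forall A, measurable A -> P A = \int[mu]_(x in A) (f x)%:E) ->
  measurable_fun setT F -> (forall x, 0 <= F x) ->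
  \int[tuple_power P n]_x F x =
  \int[tuple_power mu n]_x (F x * (\prod_i f (tnth x i))%:E).
Proof.
move=> mf f0 PE; elim: n F => [|n IH] F mF F0.
  by rewrite !integral_tuple_power0 ?big_ord0 ?mule1//; apply: emeasurable_funM => //;
    by apply/measurable_EFinP; apply: (measurable_tuple_prod (h := fun=> f)) => i; exact: mf.
rewrite !integral_tuple_powerS//; last 2 first.
- by apply: emeasurable_funM => //; by apply/measurable_EFinP; apply: (measurable_tuple_prod (h := fun=> f)) => i; exact: mf.
- by move=> x; rewrite mule_ge0// lee_fin prodr_ge0.
have mFa a : measurable_fun setT (fun t : n.-tuple T => F [tuple of a :: t]).
  by apply: measurableT_comp => //; exact: measurable_cons.
rewrite (integral_density mf f0 PE); last 2 first.
- apply: (measurable_fun_fubini_tonelli_F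
      (fun x : T * n.-tuple T => F [tuple of x.1 :: x.2])).
  + by apply: measurableT_comp => //; exact: measurable_cons.
  + by move=> x; exact: F0.
- by move=> x; exact: integral_ge0.
apply: eq_integral => a _; rewrite IH// -ge0_integralZr//; last 3 first.
- by apply: emeasurable_funM => //; by apply/measurable_EFinP; apply: (measurable_tuple_prod (h := fun=> f)) => i; exact: mf.
- by move=> x _; rewrite mule_ge0// lee_fin prodr_ge0.
- by rewrite lee_fin.
apply: eq_integral => t _; rewrite big_ord_recl -muleA; congr (_ * _).
rewrite -EFinM mulrC; congr (_ * _)%:E.
by apply: eq_bigr => i _; rewrite tnthS.
Qed.

End tuple_integrals.

(** * Exponential moments of a one-dimensional Gaussian law *)

Section gaussian_line.
Variable R : realType.
Local Open Scope ereal_scope.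

Definition gauss1 : probability (measurableTypeR R) R := normal_prob 0 (2^-1)%R.

Lemma normal_peak_half (s : R) : (0 < s)%R ->
  (normal_peak 2^-1 = 2 * s * normal_peak s)%R.
Proof.
move=> s0.
have pi0 : (0 < (pi : R) *+ 2)%R by rewrite pmulrn_lgt0// pi_gt0.
have E u : (0 < u -> normal_peak u = u^-1 * (Num.sqrt (pi *+ 2))^-1 :> R)%R.
  move=> u0; rewrite /normal_peak -mulrnAr sqrtrM ?sqr_ge0//.
  by rewrite sqrtr_sqr gtr0_norm// invfM.
rewrite !E ?invr_gt0// invrK mulrA; congr (_ * _)%R.
by rewrite -mulrA divff ?mulr1// gt_eqF.
Qed.

Lemma integral_gauss1 (F : R -> R) : measurable_fun setT F ->
  (forall x, (0 <= F x)%R) ->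
  \int[gauss1]_x (F x)%:E =
  \int[lebesgue_measure]_x (F x * (normal_peak 2^-1 * expR (- 2 * x ^+ 2)))%:E.
Proof.
move=> mF F0; rewrite (@integral_density _ _ _ lebesgue_measure (normal_pdf 0 2^-1))//.
- apply: eq_integral => x _; rewrite -EFinM; congr (_ * _)%:E.
  rewrite normal_pdfE// /normal_fun subr0; congr (_ * expR _)%R; by field.
- exact: measurable_normal_pdf.
- by move=> x; exact: normal_pdf_ge0.
- exact/measurable_EFinP.
Qed.

Lemma gauss1_exp (s : R) :
  \int[gauss1]_x (expR (s * x))%:E = (expR (s ^+ 2 / 8))%:E.
Proof.
rewrite integral_gauss1; last 2 first.
- by apply: measurableT_comp => //; exact: mulrl_measurable.
- by move=> x; rewrite expR_ge0.
transitivity (\int[lebesgue_measure]_x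
    ((expR (s ^+ 2 / 8))%:E * (normal_pdf (s / 4) 2^-1 x)%:E)).
  apply: eq_integral => x _; rewrite -EFinM normal_pdfE// /normal_fun; congr (_%:E).
  rewrite mulrCA -expRD [RHS]mulrCA -expRD; congr (_ * expR _)%R; by field.
rewrite ge0_integralZl//.
- by rewrite integral_normal_pdf mule1.
- by apply/measurable_EFinP; exact: measurable_normal_pdf.
- by move=> x _; rewrite lee_fin normal_pdf_ge0.
Qed.

Lemma gauss1_expsq (c : R) : (c < 2)%R ->
  \int[gauss1]_x (expR (c * x ^+ 2))%:E = ((Num.sqrt (1 - c / 2))^-1)%:E.
Proof.
move=> c2; rewrite integral_gauss1; last 2 first.
- apply: measurableT_comp => //; apply: measurable_funM => //.
- by move=> x; rewrite expR_ge0.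
pose s : R := ((Num.sqrt (4 - 2 * c))^-1)%R.
have c4 : (0 < 4 - 2 * c)%R by lra.
have s0 : (0 < s)%R by rewrite invr_gt0 sqrtr_gt0.
have s2 : (s ^+ 2 = (4 - 2 * c)^-1)%R by rewrite exprVn sqr_sqrtr ?ltW.
transitivity (\int[lebesgue_measure]_x ((2 * s)%:E * (normal_pdf 0 s x)%:E)).
  apply: eq_integral => x _; rewrite -EFinM normal_pdfE ?gt_eqF// /normal_fun; congr (_%:E).
  rewrite (normal_peak_half s0) mulrCA -expRD [RHS]mulrA; congr (_ * expR _)%R.
  rewrite s2 subr0; by field; lra.
rewrite ge0_integralZl//.
- rewrite integral_normal_pdf mule1; congr (_%:E); rewrite /s.
  have -> : (4 - 2 * c = 2 ^+ 2 * (1 - c / 2) :> R)%R by field.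
  by rewrite sqrtrM ?sqr_ge0// sqrtr_sqr gtr0_norm// invfM mulrA divff ?mul1r.
- by apply/measurable_EFinP; exact: measurable_normal_pdf.
- by move=> x _; rewrite lee_fin normal_pdf_ge0.
- by rewrite lee_fin mulr_ge0 ?ltW.
Qed.

End gaussian_line.

(** * Integrals of real functions and the Kullback divergence *)

Section real_valued_integrals.
Context d (T : measurableType d) (R : realType).
Variable mu : {measure set T -> \bar R}.
Local Open Scope ereal_scope.
Implicit Types f g : T -> R.

Lemma measurable_fun_expR f :
  measurable_fun setT f -> measurable_fun setT (fun x => expR (f x)).
Proof. by move=> mf; apply: measurableT_comp => //; exact: measurable_expR. Qed.

Lemma measurable_fun_ln f :
  measurable_fun setT f -> measurable_fun setT (fun x => ln (f x)).
Proof. by move=> mf; apply: measurableT_comp => //; exact: measurable_ln. Qed.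

Lemma measurable_fun_invr f : (forall x, (0 < f x)%R) ->
  measurable_fun setT f -> measurable_fun setT (fun x => ((f x)^-1)%R).
Proof.
move=> f0 mf; rewrite (_ : (fun _ => _) = (fun x => expR (- ln (f x)))%R).
  by apply: measurable_fun_expR; apply: measurable_funN; exact: measurable_fun_ln.
by apply/funext => x; rewrite expRN lnK// posrE.
Qed.

Lemma measurable_fun_sqrt f : (forall x, (0 < f x)%R) ->
  measurable_fun setT f -> measurable_fun setT (fun x => (Num.sqrt (f x))%R).
Proof.
move=> f0 mf; rewrite (_ : (fun _ => _) = (fun x => expR (2^-1 * ln (f x)))%R).
  by apply: measurable_fun_expR; apply: measurable_funM => //; exact: measurable_fun_ln.
apply/funext => x; rewrite -[in LHS](@lnK _ (f x)) ?posrE//.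
have -> : (expR (ln (f x)) = expR (2^-1 * ln (f x)) ^+ 2 :> R)%R.
  by rewrite -expRM_natl mulrA divff ?mul1r.
by rewrite sqrtr_sqr ger0_norm ?expR_ge0.
Qed.

Lemma integralD_real f g : measurable_fun setT f -> measurable_fun setT g ->
  (forall x, (0 <= f x)%R) -> (forall x, (0 <= g x)%R) ->
  \int[mu]_x (f x + g x)%:E = \int[mu]_x (f x)%:E + \int[mu]_x (g x)%:E.
Proof.
move=> mf mg f0 g0; under eq_integral do rewrite EFinD.
by rewrite ge0_integralD//; do ?[exact/measurable_EFinP|move=> x _; rewrite lee_fin].
Qed.

Lemma integralZ_real k f : measurable_fun setT f -> (forall x, (0 <= f x)%R) ->
  (0 <= k)%R -> \int[mu]_x (k * f x)%:E = k%:E * \int[mu]_x (f x)%:E.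
Proof.
move=> mf f0 k0; under eq_integral do rewrite EFinM.
by rewrite ge0_integralZl//; do ?[exact/measurable_EFinP|move=> x _; rewrite lee_fin].
Qed.

Lemma integral_sum_real (I : Type) (r : seq I) (P : pred I) (f : I -> T -> R) :
  (forall i, measurable_fun setT (f i)) -> (forall i x, (0 <= f i x)%R) ->
  \int[mu]_x (\sum_(i <- r | P i) f i x)%:E = \sum_(i <- r | P i) \int[mu]_x (f i x)%:E.
Proof.
move=> mf f0; rewrite -big_filter -ge0_integral_sum//.
- by apply: eq_integral => x _; rewrite sumEFin big_filter.
- by move=> i; exact/measurable_EFinP.
- by move=> i x _; rewrite lee_fin.
Qed.

Lemma le_integral_real f g : measurable_fun setT f -> measurable_fun setT g ->
  (forall x, (0 <= f x)%R) -> (forall x, (f x <= g x)%R) ->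
  \int[mu]_x (f x)%:E <= \int[mu]_x (g x)%:E.
Proof.
move=> mf mg f0 fg; apply: ge0_le_integral => //;
  do ?[exact/measurable_EFinP|by move=> x _; rewrite lee_fin].
Qed.

Lemma integral_ge0_real f : (forall x, (0 <= f x)%R) -> 0 <= \int[mu]_x (f x)%:E.
Proof. by move=> f0; apply: integral_ge0 => x _; rewrite lee_fin. Qed.

End real_valued_integrals.

Lemma integral_cst_prob d (T : measurableType d) (R : realType)
  (P : probability T R) (c : \bar R) : (\int[P]_x c = c)%E.
Proof. by rewrite integral_cst// [X in (_ * X)%E]probability_setT mule1. Qed.

Lemma adde_le_cancel_fin (R : realDomainType) (x y : \bar R) (r : R) :
  (x + r%:E <= y + r%:E -> x <= y)%E.
Proof. by rewrite leeD2rE. Qed.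

Lemma adde_cancel_fin (R : realDomainType) (x y : \bar R) (r : R) :
  (x + r%:E = y + r%:E -> x = y)%E.
Proof.
by case: x y => [x||] [y||]//= [] /addIr ->.
Qed.

(** The summand [- a + b] makes this nonnegative for every pair of positive
    numbers, so that its integrals never mix signs and need no integrability
    hypothesis. The definition is locked because unfolding it during unification
    is costly. *)
HB.lock Definition kl {R : realType} (a b : R) := a * ln (a / b) - a + b.

Section kullback.
Context {R : realType}.
Implicit Types a b c t s : R.

Lemma kl_diag a : 0 < a -> kl a a = 0.
Proof. by move=> a0; rewrite kl.unlock divff ?gt_eqF// ln1; ring. Qed.

Lemma ln_le_sub1 a : 0 < a -> ln a <= a - 1.
Proof.
move=> a0; have := @le_ln1Dx R (a - 1); rewrite addrCA subrr addr0; apply; lra.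
Qed.

Lemma kl_ge0 a b : 0 < a -> 0 < b -> 0 <= kl a b.
Proof.
move=> a0 b0; have := @ln_le_sub1 (b / a) (divr_gt0 b0 a0).
rewrite -[b / a]invf_div lnV ?posrE ?divr_gt0// invf_div => h.
have : a * - ln (a / b) <= a * (b / a - 1) by rewrite ler_pM2l.
rewrite mulrBr mulrCA divff ?gt_eqF// !mulr1 kl.unlock; lra.
Qed.

(** The divergence is bounded by the chi-squared distance: [ln a <= a - 1]. Both
    sides are shifted so that only nonnegative terms are integrated later. *)
Lemma kl_le_sqr a : 0 < a -> kl a 1 + 2 * a <= a ^+ 2 + 1.
Proof.
move=> a0; rewrite kl.unlock divr1; have := ln_le_sub1 a0.
rewrite -(ler_pM2l a0) => h; lra.
Qed.

(** Either [a] is at most [expR t * b], or [ln (a / b) > t] and the divergence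
    itself dominates [a * (t - 1)]. *)
Lemma le_expR_kl t a b : 1 < t -> 0 < a -> 0 < b ->
  a <= expR t * b + kl a b / (t - 1).
Proof.
move=> t1 a0 b0; have [ab|ab] := leP a (expR t * b).
  by rewrite (le_trans ab)// lerDl divr_ge0 ?kl_ge0//; lra.
rewrite (@le_trans _ _ (kl a b / (t - 1)))//; last first.
  by rewrite lerDr mulr_ge0 ?expR_ge0 ?ltW.
rewrite ler_pdivlMr ?subr_gt0// kl.unlock.
have h : t < ln (a / b).
  by rewrite -[t]expRK ltr_ln ?posrE ?expR_gt0 ?divr_gt0// ltr_pdivlMr.
have : a * t <= a * ln (a / b) by rewrite ler_pM2l ?ltW.
lra.
Qed.

(** Pointwise form of the chain rule. When [a] varies with an observation and has
    integral [c], the correction terms cancel after integration, and the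
    divergence of [a] from [b] splits at [c]. Nothing is subtracted, so the
    identity can be integrated term by term. *)
Lemma kl_chain a b c : 0 < a -> 0 < b -> 0 < c ->
  kl a b + c + b / c * a = kl a c + kl c b / c * a + a + b.
Proof.
move=> a0 b0 c0; have c1 : c != 0 by rewrite gt_eqF.
rewrite kl.unlock !ln_div ?posrE//; field.
by [].
Qed.

(** The same device for products: when [a] and [b] are densities of independent
    factors, the divergences add up. *)
Lemma klM a b : 0 < a -> 0 < b ->
  kl (a * b) 1 + a + b = b * kl a 1 + a * kl b 1 + a * b + 1.
Proof. by move=> a0 b0; rewrite kl.unlock !divr1 lnM ?posrE//; ring. Qed.

Lemma klZ s a b : 0 < s -> kl (s * a) (s * b) = s * kl a b.
Proof.
move=> s0; rewrite kl.unlock -mulf_div divff ?gt_eqF// mul1r; ring.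
Qed.

Lemma measurable_kl d (T : measurableType d) (f g : T -> R) :
  (forall x, 0 < f x) -> (forall x, 0 < g x) ->
  measurable_fun setT f -> measurable_fun setT g ->
  measurable_fun setT (fun x => kl (f x) (g x)).
Proof.
move=> f0 g0 mf mg; rewrite kl.unlock.
apply: measurable_funD => //; apply: measurable_funB => //.
apply: measurable_funM => //; apply: measurable_fun_ln; apply: measurable_funM => //.
exact: measurable_fun_invr.
Qed.

End kullback.

(** * Chain rule for mixtures, and the Fano inequality *)

Section mixture_chain_rule.
Context d (T : measurableType d) (R : realType) (gam : probability T R).
Variables (J : finType) (j0 : J) (f : J -> T -> R).
Hypotheses (f_gt0 : forall j x, 0 < f j x)
  (mf : forall j, measurable_fun setT (f j))
  (f1 : forall j, (\int[gam]_x (f j x)%:E = 1)%E).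

Definition lik k j (Y : k.-tuple T) : R := \prod_i f j (tnth Y i).
Arguments lik : clear implicits.

Lemma lik_gt0 k j Y : 0 < lik k j Y.
Proof. by rewrite prodr_gt0. Qed.

Lemma measurable_lik k j : measurable_fun setT (lik k j).
Proof. exact: (measurable_tuple_prod (h := fun=> f j)). Qed.

Lemma lik_cons k j y (Y : k.-tuple T) : lik k.+1 j [tuple of y :: Y] = f j y * lik k j Y.
Proof.
rewrite /lik big_ord_recl; congr (_ * _).
by apply: eq_bigr => i _; rewrite tnthS.
Qed.

Lemma integral_lik k j : (\int[tuple_power gam k]_Y (lik k j Y)%:E = 1)%E.
Proof.
rewrite (@integral_tuple_power_prod _ _ _ gam k (fun=> f j) (fun=> 1))//.
- by rewrite big1.
- by move=> _ x; exact: ltW.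
Qed.

Definition tot (w : J -> R) : R := \sum_j w j.

Lemma tot_gt0 w : (forall j, 0 < w j) -> 0 < tot w.
Proof.
move=> w0; rewrite /tot (bigD1 j0)//= ltr_wpDr// sumr_ge0// => i _.
exact: ltW.
Qed.

(** Information gained from one more observation when [w] is the current
    unnormalised posterior weight; the total mass is kept as a factor, which
    makes the integral against the past observations an expectation. *)
Definition divergence (w : J -> R) : \bar R :=
  (\int[gam]_y (kl (tot (fun j => w j * f j y)) (tot w))%:E)%E.

Lemma measurable_tot d' (T' : measurableType d') (g : J -> T' -> R) (w : J -> R) :
  (forall j, measurable_fun setT (g j)) ->
  measurable_fun setT (fun x => tot (fun j => w j * g j x)).
Proof. by move=> mg; apply: measurable_sum => j; apply: measurable_funM. Qed.

Lemma integral_tot d' (T' : measurableType d') (mu : {measure set T' -> \bar R})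
  (g : J -> T' -> R) (w : J -> R) :
  (forall j, measurable_fun setT (g j)) -> (forall j x, 0 <= g j x) ->
  (forall j, 0 <= w j) ->
  (forall j, (\int[mu]_x (g j x)%:E = 1)%E) ->
  (\int[mu]_x (tot (fun j => w j * g j x))%:E = (tot w)%:E)%E.
Proof.
move=> mg g0 w0 g1; rewrite integral_sum_real.
- rewrite /tot -sumEFin; apply: eq_bigr => j _.
  by rewrite integralZ_real// g1 mule1.
- by move=> j; apply: measurable_funM.
- by move=> j x; rewrite mulr_ge0.
Qed.

Lemma divergence_ge0 (w : J -> R) : (forall j, 0 < w j) ->
  (0%R <= divergence w)%E.
Proof.
move=> w0; apply: integral_ge0_real => y; apply: kl_ge0; last exact: tot_gt0.
by apply: tot_gt0 => j; rewrite mulr_gt0.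
Qed.

Lemma measurable_divergence_lik i (w : J -> R) : (forall j, 0 < w j) ->
  measurable_fun setT (fun Y : i.-tuple T => divergence (fun j => w j * lik i j Y)).
Proof.
move=> w0.
  apply: (measurable_fun_fubini_tonelli_G (fun z : T * i.-tuple T =>
    (kl (tot (fun j => w j * lik i j z.2 * f j z.1)) (tot (fun j => w j * lik i j z.2)))%:E)).
    apply/measurable_EFinP; apply: measurable_kl.
    - by move=> z; apply: tot_gt0 => j; rewrite !mulr_gt0// lik_gt0.
    - by move=> z; apply: tot_gt0 => j; rewrite !mulr_gt0// lik_gt0.
    - apply: measurable_sum => j; apply: measurable_funM.
        apply: measurable_funM => //.
        exact: (measurableT_comp (@measurable_lik i j) measurable_snd).
      exact: (measurableT_comp (mf j) measurable_fst).
    - apply: measurable_tot => j.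
      exact: (measurableT_comp (@measurable_lik i j) measurable_snd).
  move=> z; rewrite lee_fin kl_ge0//.
  - by apply: tot_gt0 => j; rewrite !mulr_gt0// lik_gt0.
  - by apply: tot_gt0 => j; rewrite !mulr_gt0// lik_gt0.
Qed.

(** The divergence of the law of [k] observations from the base law is the sum
    over time of the expected information in the next observation, given the
    posterior weights produced by the previous ones. *)
Lemma kl_chain_rule k (w : J -> R) : (forall j, 0 < w j) ->
  (\int[tuple_power gam k]_Y (kl (tot (fun j => w j * lik k j Y)) (tot w))%:E =
   \sum_(i < k) \int[tuple_power gam i]_Y divergence (fun j => w j * lik i j Y)%R)%E.
Proof.
elim: k w => [|k IH] w w0.
  rewrite big_ord0 integral0_eq// => Y _.
  rewrite (_ : tot _ = tot w) ?kl_diag ?tot_gt0//.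
  by apply: eq_bigr => j _; rewrite /lik big_ord0 mulr1.
have mkl i : measurable_fun setT (fun z : T * i.-tuple T =>
    kl (tot (fun j => w j * (f j z.1 * lik i j z.2))) (tot w)).
  apply: measurable_kl => //.
  - by move=> z; apply: tot_gt0 => j; rewrite !mulr_gt0// lik_gt0.
  - by move=> _; exact: tot_gt0.
  - apply: measurable_tot => j; apply: measurable_funM.
      exact: (measurableT_comp (mf j) measurable_fst).
    exact: (measurableT_comp (@measurable_lik i j) measurable_snd).
have kl0 i y (Y : i.-tuple T) :
    0 <= kl (tot (fun j => w j * (f j y * lik i j Y))) (tot w).
  by apply: kl_ge0; apply: tot_gt0 => // j; rewrite !mulr_gt0// lik_gt0.
rewrite integral_tuple_powerS; last 2 first.
- apply/measurable_EFinP; apply: measurable_kl => //.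
  + by move=> z; apply: tot_gt0 => j; rewrite !mulr_gt0// lik_gt0.
  + by move=> _; exact: tot_gt0.
  + by apply: measurable_tot => j; exact: measurable_lik.
- by move=> Y; rewrite lee_fin kl_ge0// tot_gt0// => j; rewrite mulr_gt0// lik_gt0.
pose c y := tot (fun j => w j * f j y).
have c_gt0 y : 0 < c y by apply: tot_gt0 => j; rewrite mulr_gt0.
have mc : measurable_fun setT c by exact: measurable_tot.
have step y : (\int[tuple_power gam k]_Y
      (kl (tot (fun j => w j * lik k.+1 j [tuple of y :: Y])) (tot w))%:E =
    (kl (c y) (tot w))%:E + \int[tuple_power gam k]_Y
      (kl (tot (fun j => (w j * f j y) * lik k j Y)) (c y))%:E)%E.
  pose a (Y : k.-tuple T) := tot (fun j => (w j * f j y) * lik k j Y).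
  have a_gt0 Y : 0 < a Y.
    by apply: tot_gt0 => j; rewrite !mulr_gt0// lik_gt0.
  have ma : measurable_fun setT a.
    by apply: measurable_tot => j; exact: measurable_lik.
  have ia : (\int[tuple_power gam k]_Y (a Y)%:E = (c y)%:E)%E.
    apply: integral_tot => j; [exact: measurable_lik| | |exact: integral_lik].
    + by move=> ?; exact/ltW/lik_gt0.
    + by rewrite mulr_ge0// ltW.
  have -> : (\int[tuple_power gam k]_Y
      (kl (tot (fun j => w j * lik k.+1 j [tuple of y :: Y])) (tot w))%:E =
      \int[tuple_power gam k]_Y (kl (a Y) (tot w))%:E)%E.
    apply: eq_integral => Y _; congr (kl _ _)%:E.
    by apply: eq_bigr => j _; rewrite lik_cons mulrA.
  have t0 := tot_gt0 w0.
  have mk1 : measurable_fun setT (fun Y => kl (a Y) (tot w)).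
    by apply: measurable_kl.
  have mk2 : measurable_fun setT (fun Y => kl (a Y) (c y)).
    by apply: measurable_kl.
  have k1 Y : 0 <= kl (a Y) (tot w) by exact: kl_ge0.
  have k2 Y : 0 <= kl (a Y) (c y) by exact: kl_ge0.
  have k3 : 0 <= kl (c y) (tot w) by exact: kl_ge0.
  have : (\int[tuple_power gam k]_Y
      (kl (a Y) (tot w) + c y + tot w / c y * a Y)%:E =
      \int[tuple_power gam k]_Y
      (kl (a Y) (c y) + kl (c y) (tot w) / c y * a Y + a Y + tot w)%:E)%E.
    by apply: eq_integral => Y _; rewrite kl_chain.
  have cy0 := ltW (c_gt0 y); have tw0 := ltW t0.
  have aa0 Y := ltW (a_gt0 Y).
  rewrite !integralD_real//; do ?[by move=> Y; rewrite ?addr_ge0 ?mulr_ge0 ?divr_ge0 ?invr_ge0//];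
    do ?[by do ?[apply: measurable_funD => //|apply: measurable_funM => //]].
  rewrite !integralZ_real// ?divr_ge0// ia !integral_cst_prob -!EFinM.
  rewrite !divfK ?gt_eqF// => E.
  (* the masses of [a], [b] and [c] are finite and cancel *)
  apply: (@adde_cancel_fin _ _ _ (c y)); apply: (@adde_cancel_fin _ _ _ (tot w)).
  by rewrite [in RHS](addeC (kl _ _)%:E).
under eq_integral do rewrite step.
have E2 : (\int[gam]_y \int[tuple_power gam k]_Y
      (kl (tot (fun j => (w j * f j y) * lik k j Y)) (c y))%:E =
    \sum_(i < k) \int[tuple_power gam i.+1]_Y divergence (fun j => w j * lik i.+1 j Y)%R)%E.
  transitivity (\int[gam]_y \sum_(i < k) \int[tuple_power gam i]_Y
      divergence (fun j => w j * lik i.+1 j [tuple of y :: Y])%R)%E.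
    apply: eq_integral => y _; rewrite IH; last by move=> j; rewrite mulr_gt0.
    apply: eq_bigr => i _; apply: eq_integral => Y _; congr divergence.
    by apply/funext => j; rewrite lik_cons mulrA.
  rewrite ge0_integral_sum//.
  - apply: eq_bigr => i _; rewrite [RHS]integral_tuple_powerS//; first exact: measurable_divergence_lik.
    by move=> Y; apply: divergence_ge0 => // j; rewrite mulr_gt0// lik_gt0.
  - move=> i; apply: (measurable_fun_fubini_tonelli_F (fun z : T * i.-tuple T =>
      divergence (fun j => w j * lik i.+1 j [tuple of z.1 :: z.2])%R)).
    + by apply: (measurableT_comp (@measurable_divergence_lik i.+1 w w0)); exact: measurable_cons.
    + by move=> z; apply: divergence_ge0 => // j; rewrite mulr_gt0// lik_gt0.
  - move=> i y _; apply: integral_ge0 => Y _.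
    by apply: divergence_ge0 => // j; rewrite mulr_gt0// lik_gt0.
rewrite ge0_integralD//.
- rewrite big_ord_recl E2; congr (_ + _)%E.
  rewrite integral_tuple_power0; last exact: measurable_divergence_lik.
  congr (\int[_]_y _)%E; apply/funext => y.
  congr (kl _ _)%:E; apply: eq_bigr => j _.
    by rewrite /lik big_ord0 mulr1.
  by rewrite /lik big_ord0 mulr1.
- by move=> y _; rewrite lee_fin kl_ge0// tot_gt0.
- apply/measurable_EFinP; apply: measurable_kl => //= _; exact: tot_gt0.
- by move=> y _; apply: integral_ge0_real => Y; rewrite kl_ge0// tot_gt0// => j; rewrite !mulr_gt0// lik_gt0.
- apply: (measurable_fun_fubini_tonelli_F (fun z : T * k.-tuple T =>
    (kl (tot (fun j => w j * f j z.1 * lik k j z.2)) (c z.1))%:E)).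
  + apply/measurable_EFinP; apply: measurable_kl.
    * by move=> z; apply: tot_gt0 => j; rewrite !mulr_gt0// lik_gt0.
    * by move=> z; exact: c_gt0.
    * apply: measurable_sum => j; apply: measurable_funM.
        apply: measurable_funM => //.
        exact: (measurableT_comp (mf j) measurable_fst).
      exact: (measurableT_comp (@measurable_lik k j) measurable_snd).
    * exact: (measurableT_comp mc measurable_fst).
  + by move=> z; rewrite lee_fin kl_ge0// tot_gt0// => j; rewrite !mulr_gt0// lik_gt0.
Qed.

End mixture_chain_rule.

(** A selection with measurable level sets is a finite sum of indicators. *)
Lemma measurable_fun_selection d (Z : measurableType d) (R : realType)
    (S : finType) (sel : Z -> S) (h : S -> R) :
  (forall s, measurable (sel @^-1` [set s])) ->
  measurable_fun setT (fun z => h (sel z)).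
Proof.
move=> msel; rewrite (_ : (fun z => h (sel z)) =
    (fun z => \sum_s h s * \1_(sel @^-1` [set s]) z)); last first.
  apply/funext => z; rewrite (bigD1 (sel z))//= indicE mem_set// mulr1 big1 ?addr0//.
  move=> s /eqP sz; rewrite indicE memNset ?mulr0//= => e; exact/sz.
by apply: measurable_sum => s; apply: measurable_funM => //; exact: measurable_indic.
Qed.

Section fano.
Context d (Z : measurableType d) (R : realType) (nu : {measure set Z -> \bar R}).

(** Change of measure from the reference density [b] to the densities [a p]: a
    success event that is rare on average over [p] stays rare on average when
    the Kullback divergences are small. *)
Lemma fano_success_bound (P S : finType) (a : P -> Z -> R) (b : Z -> R)
    (sel : Z -> S) (A : P -> pred S) (t B K kap : R) :
  1 < t -> (forall p z, 0 < a p z) -> (forall z, 0 < b z) ->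
  (forall p, measurable_fun setT (a p)) -> measurable_fun setT b ->
  (forall s, measurable (sel @^-1` [set s])) ->
  (\int[nu]_z (b z)%:E = B%:E)%E ->
  (forall p, \int[nu]_z (kl (a p z) (b z))%:E <= K%:E)%E ->
  (forall s, #|[pred p | A p s]|%:R <= kap) ->
  (\sum_p \int[nu]_z (a p z * (A p (sel z))%:R)%:E <=
    (expR t * kap * B + #|P|%:R * (K / (t - 1)))%:E)%E.
Proof.
move=> t1 a0 b0 ma mb msel iB iK hA.
pose e p z : R := (A p (sel z))%:R.
have me p : measurable_fun setT (e p).
  exact: (measurable_fun_selection (fun s => (A p s)%:R) msel).
have e0 p z : 0 <= e p z by rewrite ler0n.
have mk p : measurable_fun setT (fun z => kl (a p z) (b z)) by exact: measurable_kl.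
have k0 p z : 0 <= kl (a p z) (b z) by exact: kl_ge0.
have t0 : 0 <= (t - 1)^-1 by rewrite invr_ge0; lra.
have b0' z := ltW (b0 z).
have et0 := expR_ge0 t.
apply: (@le_trans _ _ (\sum_p (\int[nu]_z (expR t * (b z * e p z))%:E +
    ((t - 1)^-1 * K)%:E))%E).
  apply: lee_sum => p _.
  apply: (@le_trans _ _ (\int[nu]_z (expR t * (b z * e p z) +
      (t - 1)^-1 * kl (a p z) (b z))%:E)%E).
    apply: le_integral_real.
    - by apply: measurable_funM => //; exact: me.
    - by apply: measurable_funD; do ?[apply: measurable_funM => //].
    - by move=> z; rewrite mulr_ge0// ltW.
    - move=> z; have := le_expR_kl t1 (a0 p z) (b0 z); rewrite /e.
      case: (A p (sel z)); rewrite ?mulr1 ?mulr0 ?add0r.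
        by rewrite [_ / _]mulrC.
      by move=> _; rewrite mulr_ge0.
  rewrite integralD_real//.
  - rewrite leeD2l// integralZ_real// EFinM lee_wpmul2l//.
  - by do ?[apply: measurable_funM => //].
  - by do ?[apply: measurable_funM => //].
  - by move=> z; rewrite !mulr_ge0.
  - by move=> z; rewrite !mulr_ge0.
rewrite big_split/= -integral_sum_real; last 2 first.
- by move=> p; do ?[apply: measurable_funM => //].
- by move=> p z; rewrite !mulr_ge0.
rewrite sumEFin EFinD; apply: leeD; last first.
  by rewrite lee_fin sumr_const [K / _]mulrC mulr_natl.
apply: (@le_trans _ _ (\int[nu]_z (expR t * kap * b z)%:E)%E).
  apply: le_integral_real.
  - by apply: measurable_sum => p; do ?[apply: measurable_funM => //].
  - exact: measurable_funM.
  - by move=> z; apply: sumr_ge0 => p _; rewrite !mulr_ge0.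
  - move=> z; rewrite -!mulr_sumr -mulrA ler_wpM2l// mulrC ler_wpM2r//.
    rewrite (le_trans _ (hA (sel z)))// -sum1_card natr_sum/=.
    rewrite [leRHS]big_mkcond/=; apply: ler_sum => p _; rewrite inE /e.
    by case: (A p _).
rewrite integralZ_real//; first by rewrite iB -EFinM.
rewrite mulr_ge0// (le_trans _ (hA (sel point)))//.
Qed.

End fano.

(** * Gaussian linear forms *)

Section exp_inequalities.
Context {R : realType}.
Implicit Types x a b : R.

Lemma sqr_le_expR_cosh x : x ^+ 2 <= 4 * (expR x + expR (- x) - 2).
Proof.
wlog x0 : x / 0 <= x.
  move=> h; have [|/ltW x0] := leP 0 x; first exact: h.
  have := h (- x); rewrite sqrrN opprK oppr_ge0 => /(_ x0) h1; lra.
set y := expR (x / 2).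
have -> : expR x = y ^+ 2 by rewrite /y -expRM_natl mulrCA divff ?mulr1.
have -> : expR (- x) = (y^-1) ^+ 2.
  by rewrite /y -expRN -expRM_natl mulrN mulrCA divff ?mulr1.
have hy : 1 + x / 2 <= y by exact: expR_ge1Dx.
have y1 : 1 <= y by lra.
have yV : y^-1 <= 1 by rewrite invf_le1//; lra.
have e : y * y^-1 = 1 by rewrite divff// gt_eqF//; lra.
have h : x / 2 <= y - y^-1 by lra.
have : (x / 2) ^+ 2 <= (y - y^-1) ^+ 2 by rewrite ler_sqr ?nnegrE//; lra.
have -> : (y - y^-1) ^+ 2 = y ^+ 2 + y^-1 ^+ 2 - 2 * (y * y^-1) by ring.
rewrite e (_ : (x / 2) ^+ 2 = x ^+ 2 / 4); last by field.
by move: (x ^+ 2) (y ^+ 2) (y^-1 ^+ 2) => ? ? ? ?; lra.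
Qed.

Lemma expR_le_quadratic x : expR x <= 1 + x + x ^+ 2 * expR `|x|.
Proof.
have [x0|x0] := leP 0 x.
  rewrite ger0_norm//; have e0 := expR_ge0 x.
  have h : expR x - 1 <= x * expR x.
    have := @expR_ge1Dx R (- x); rewrite expRN => h.
    have : expR x * (1 - x) <= expR x * (expR x)^-1 by rewrite ler_wpM2l.
    rewrite divff ?gt_eqF ?expR_gt0// => ?; lra.
  have : x * (expR x - 1) <= x * (x * expR x) by rewrite ler_wpM2l.
  move=> ?; lra.
rewrite ltr0_norm//; have y0 : 0 < 1 - x by lra.
have h1 : 1 <= expR (- x) by rewrite -[leLHS]expR0 ler_expR; lra.
have h2 : x ^+ 2 <= x ^+ 2 * expR (- x) by rewrite ler_peMr// sqr_ge0.
suff : expR x <= 1 + x + x ^+ 2 by move=> ?; lra.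
have := @expR_ge1Dx R (- x); rewrite expRN => h.
have : expR x * (1 - x) <= expR x * (expR x)^-1 by rewrite ler_wpM2l ?expR_ge0.
rewrite divff ?gt_eqF ?expR_gt0// => h3.
rewrite -(ler_pM2r y0) (le_trans h3)//.
have : 0 <= x ^+ 2 * - x by rewrite mulr_ge0 ?sqr_ge0//; lra.
move=> ?; lra.
Qed.

(** The variance bound needs [a ^+ 4] against a Gaussian weight: with
    [y = a ^+ 2 / (2 * rho)], half of the exponent on the right pays for [y ^+ 2]
    and the other half for the exponential on the left, as [8 * rho <= 1]. *)
Lemma quartic_expR_le (rho a : R) : 0 < rho -> rho <= 8^-1 ->
  (4 * a ^+ 2) ^+ 2 * expR (4 * a ^+ 2) <= 128 * rho ^+ 2 * expR (a ^+ 2 / rho).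
Proof.
move=> r0 r8; set y := a ^+ 2 / (2 * rho).
have y0 : 0 <= y by rewrite divr_ge0 ?sqr_ge0//; lra.
have a2 : a ^+ 2 = 2 * rho * y by rewrite /y; field; lra.
have -> : a ^+ 2 / rho = y + y by rewrite /y; field; lra.
rewrite a2 expRD.
have h1 : y ^+ 2 <= 2 * expR y.
  have := expR_ge1Dxn 1 y0; rewrite (_ : 2`!%:R = 2)// => h; lra.
have h2 : expR (4 * (2 * rho * y)) <= expR y by rewrite ler_expR; nra.
have -> : (4 * (2 * rho * y)) ^+ 2 = 64 * rho ^+ 2 * y ^+ 2 by ring.
have -> : 128 * rho ^+ 2 * (expR y * expR y) = 64 * rho ^+ 2 * ((2 * expR y) * expR y).
  by ring.
rewrite -mulrA ler_wpM2l//; first by rewrite mulr_ge0 ?sqr_ge0.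
by rewrite ler_pM ?sqr_ge0 ?expR_ge0.
Qed.

(** Taylor expansion of the covariance kernel of two tilted Gaussian laws. The
    second-order term is symmetrised, so that it becomes a sum of one-variable
    terms whose Gaussian integrals are under control. *)
Lemma expR_4mul_le (rho a b : R) : 0 < rho -> rho <= 8^-1 ->
  expR (4 * a * b) <= 1 + 4 * a * b +
    (128 * rho ^+ 2 * expR (a ^+ 2 / rho) + 128 * rho ^+ 2 * expR (b ^+ 2 / rho)).
Proof.
move=> r0 r8; apply: (le_trans (expR_le_quadratic _)).
rewrite lerD2l.
have M (c d : R) : `|c| <= `|d| -> (4 * c * d) ^+ 2 * expR `|4 * c * d| <=
    (4 * d ^+ 2) ^+ 2 * expR (4 * d ^+ 2).
  move=> cd; have h : `|4 * c * d| <= 4 * d ^+ 2.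
    rewrite !normrM (ger0_norm (_ : 0 <= 4))// -mulrA ler_pM2l//.
    by rewrite -[d ^+ 2]real_normK ?num_real// expr2 ler_wpM2r.
  rewrite -[(4 * c * d) ^+ 2]real_normK ?num_real//.
  by rewrite ler_pM ?sqr_ge0 ?expR_ge0// ?ler_expR// ler_sqr ?nnegrE// (le_trans _ h).
have p0 (c : R) : 0 <= 128 * rho ^+ 2 * expR (c ^+ 2 / rho).
  by rewrite mulr_ge0 ?expR_ge0// mulr_ge0 ?sqr_ge0.
have [ab|/ltW ab] := leP `|a| `|b|.
  rewrite (le_trans (M _ _ ab))// (le_trans (quartic_expR_le _ r0 r8))//.
  by rewrite lerDr.
rewrite [4 * a * b]mulrAC (le_trans (M _ _ ab))//.
by rewrite (le_trans (quartic_expR_le _ r0 r8))// lerDl.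
Qed.

End exp_inequalities.

Section gaussian_linear_forms.
Context {R : realType}.
Variable p : nat.
Implicit Types (c : 'I_p -> R).

Definition lin c (u : p.-tuple (measurableTypeR R)) : R :=
  \sum_i c i * tnth u i.

Definition sqn c : R := \sum_i c i ^+ 2.

Lemma sqn_ge0 c : 0 <= sqn c.
Proof. by apply: sumr_ge0 => i _; exact: sqr_ge0. Qed.

Lemma measurable_lin c : measurable_fun setT (lin c).
Proof.
apply: measurable_sum => i; apply: measurable_funM => //.
exact: measurable_tnth.
Qed.

Lemma integral_expR_lin c :
  (\int[tuple_power (gauss1 R) p]_u (expR (lin c u))%:E = (expR (sqn c / 8))%:E)%E.
Proof.
rewrite /lin /sqn mulr_suml expR_sum.
rewrite -(@integral_tuple_power_prod _ _ _ (gauss1 R) p (fun i x => expR (c i * x)))//.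
- by apply: eq_integral => u _; rewrite expR_sum.
- by move=> i; apply: measurable_fun_expR; exact: mulrl_measurable.
- by move=> i; exact: gauss1_exp.
Qed.

(** The square is dominated by a hyperbolic cosine, whose integral is explicit;
    this loses only a constant. *)
Lemma integral_lin_sqr c : sqn c <= 1 ->
  (\int[tuple_power (gauss1 R) p]_u (lin c u ^+ 2)%:E <= (2 * sqn c)%:E)%E.
Proof.
move=> c1; have ml := measurable_lin c.
have linN u : lin (fun i => - c i) u = - lin c u.
  by rewrite /lin -sumrN; apply: eq_bigr => i _; rewrite mulNr.
have sqnN : sqn (fun i => - c i) = sqn c.
  by apply: eq_bigr => i _; rewrite sqrrN.
have I2 : (\int[tuple_power (gauss1 R) p]_u (expR (- lin c u))%:E = (expR (sqn c / 8))%:E)%E.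
  rewrite -sqnN -integral_expR_lin; apply: eq_integral => u _.
  by rewrite linN.
apply: (@adde_le_cancel_fin _ _ _ 8).
have -> : ((8 : R)%:E = \int[tuple_power (gauss1 R) p]_u (8 : R)%:E)%E.
  by rewrite integral_cst_prob.
rewrite -integralD_real//; last 2 first.
- exact: measurable_funX.
- by move=> u; exact: sqr_ge0.
apply: (@le_trans _ _ (\int[tuple_power (gauss1 R) p]_u
    (4 * expR (lin c u) + 4 * expR (- lin c u))%:E)%E).
  apply: le_integral_real.
  - by apply: measurable_funD => //; exact: measurable_funX.
  - by apply: measurable_funD; apply: measurable_funM => //;
      apply: measurable_fun_expR => //; exact: measurable_funN.
  - by move=> u; rewrite addr_ge0 ?sqr_ge0.
  - by move=> u; have := sqr_le_expR_cosh (lin c u); lra.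
have me1 : measurable_fun setT (fun u => expR (lin c u)).
  exact: measurable_fun_expR.
have me2 : measurable_fun setT (fun u => expR (- lin c u)).
  by apply: measurable_fun_expR; exact: measurable_funN.
rewrite integralD_real; do ?[by apply: measurable_funM|by move=> u; rewrite mulr_ge0 ?expR_ge0].
rewrite !integralZ_real//; do ?[by move=> u; exact: expR_ge0].
rewrite integral_expR_lin I2 integral_cst_prob -!EFinM -!EFinD lee_fin.
have s0 := sqn_ge0 c; set s := sqn c in s0 c1 *.
have : expR (s / 8) <= 1 + 2 * (s / 8).
  have := expR_le_quadratic (s / 8); rewrite ger0_norm; last by rewrite divr_ge0.
  have e2 : expR (s / 8) <= 2.
    have := @expR_ge1Dx R (- (s / 8)); rewrite expRN => h.
    have e0 := expR_gt0 (s / 8).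
    have : 2^-1 <= (expR (s / 8))^-1 by lra.
    by rewrite lef_pV2 ?posrE.
  have : (s / 8) ^+ 2 * expR (s / 8) <= (s / 8) ^+ 2 * 2 by rewrite ler_wpM2l ?sqr_ge0.
  nra.
by move=> h; lra.
Qed.

(** The exponential of a square is a Gaussian average of exponentials of linear
    forms; exchanging the two integrals leaves a one-dimensional integral. *)
Lemma integral_expR_lin_sqr c (rho : R) : 0 < rho -> sqn c <= rho ->
  (\int[tuple_power (gauss1 R) p]_u (expR (lin c u ^+ 2 / rho))%:E <= 2%:E)%E.
Proof.
move=> r0 cr; set k := Num.sqrt (8 / rho).
have k2 : k ^+ 2 / 8 = rho^-1.
  by rewrite sqr_sqrtr ?divr_ge0 ?ltW//; field; lra.
have mk : measurable_fun setT (fun z : p.-tuple (measurableTypeR R) * measurableTypeR R =>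
    expR (k * lin c z.1 * z.2)).
  apply: measurable_fun_expR; apply: measurable_funM => //.
  apply: measurable_funM => //.
  exact: (measurableT_comp (measurable_lin c) measurable_fst).
have -> : (\int[tuple_power (gauss1 R) p]_u (expR (lin c u ^+ 2 / rho))%:E =
    \int[tuple_power (gauss1 R) p]_u \int[gauss1 R]_g (expR (k * lin c u * g))%:E)%E.
  apply: eq_integral => u _; rewrite gauss1_exp; congr (expR _)%:E.
  by rewrite -k2 exprMn; field.
rewrite (fubini_tonelli (fun z : p.-tuple (measurableTypeR R) * measurableTypeR R =>
    (expR (k * lin c z.1 * z.2))%:E))/=; last 2 first.
- exact/measurable_EFinP.
- by move=> z; rewrite lee_fin expR_ge0.
under eq_integral => g _.
  under eq_integral => u _.
    have -> : k * lin c u * g = lin (fun i => k * g * c i) u.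
      by rewrite /lin mulr_sumr mulr_suml; apply: eq_bigr => i _; ring.
    over.
  rewrite integral_expR_lin.
  have -> : sqn (fun i => k * g * c i) / 8 = sqn c / rho * g ^+ 2.
    rewrite /sqn (eq_bigr (fun i => (k * g) ^+ 2 * c i ^+ 2)); last first.
      by move=> i _; rewrite exprMn.
    by rewrite -mulr_sumr -k2; field.
  over.
have x1 : sqn c / rho <= 1 by rewrite ler_pdivrMr// mul1r.
move: (sqn c / rho) x1 => x x1.
rewrite gauss1_expsq; last by lra.
rewrite lee_fin invf_ple ?posrE//; last first.
  by rewrite sqrtr_gt0; lra.
rewrite [leLHS](_ : _ = Num.sqrt ((2^-1) ^+ 2)); last by rewrite sqrtr_sqr gtr0_norm.
rewrite ler_sqrt; first by rewrite exprVn; lra.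
lra.
Qed.

End gaussian_linear_forms.

(** * Divergence of a mixture of regression rows *)

Section kl_product.
Context d (T : measurableType d) (R : realType) (mu : probability T R).

(** For densities the correction terms of [klM] have integral one and cancel. *)
Lemma kl_tensor n (h : 'I_n -> T -> R) :
  (forall i x, 0 < h i x) -> (forall i, measurable_fun setT (h i)) ->
  (forall i, (\int[mu]_x (h i x)%:E = 1)%E) ->
  (\int[tuple_power mu n]_v (kl (\prod_i h i (tnth v i)) 1)%:E =
   \sum_i \int[mu]_x (kl (h i x) 1)%:E)%E.
Proof.
have mkl1 d' (T' : measurableType d') (g : T' -> R) : (forall x, 0 < g x) ->
    measurable_fun setT g -> measurable_fun setT (fun x => kl (g x) 1).
  by move=> g0 mg; apply: measurable_kl.
elim: n h => [|n IH] h h0 mh h1.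
  rewrite big_ord0 integral0_eq// => v _.
  by rewrite big_ord0 kl_diag.
have mp : measurable_fun setT (fun v : n.+1.-tuple T => \prod_i h i (tnth v i)).
  exact: measurable_tuple_prod.
have p0 (v : n.+1.-tuple T) : 0 < \prod_i h i (tnth v i) by exact: prodr_gt0.
rewrite integral_tuple_powerS; last 2 first.
- by apply/measurable_EFinP; exact: mkl1.
- by move=> v; rewrite lee_fin kl_ge0.
pose g i := h (lift ord0 i).
pose P (t : n.-tuple T) := \prod_i g i (tnth t i).
have P0 t : 0 < P t by apply: prodr_gt0 => i _; exact: h0.
have mP : measurable_fun setT P.
  by apply: (measurable_tuple_prod (h := g)) => i; exact: mh.
have P1 : (\int[tuple_power mu n]_t (P t)%:E = 1)%E.
  rewrite (@integral_tuple_power_prod _ _ _ mu n g (fun=> 1)) ?big1// => i *;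
    first [exact: mh|exact: h1|exact/ltW/h0].
have E a : (\int[tuple_power mu n]_t
     (kl (\prod_i h i (tnth [tuple of a :: t] i)) 1)%:E =
     (kl (h ord0 a) 1)%:E + (h ord0 a)%:E *
       \int[tuple_power mu n]_t (kl (P t) 1)%:E)%E.
  have ha := h0 ord0 a; set b := h ord0 a in ha *.
  have b0 := ltW ha; have kb : 0 <= kl b 1 by exact: kl_ge0.
  have mk := mkl1 _ _ _ P0 mP.
  have k0 t : 0 <= kl (P t) 1 by exact: kl_ge0.
  have P0' t := ltW (P0 t).
  have kbP t : 0 <= kl (b * P t) 1 by apply: kl_ge0 => //; exact: mulr_gt0.
  have mbP : measurable_fun setT (fun t => kl (b * P t) 1).
    by apply: mkl1 => [t|]; [exact: mulr_gt0|exact: measurable_funM].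
  transitivity (\int[tuple_power mu n]_t (kl (b * P t) 1)%:E)%E.
    apply: eq_integral => t _; rewrite big_ord_recl; congr (kl (_ * _) 1)%:E.
    by apply: eq_bigr => i _; rewrite tnthS.
  have : (\int[tuple_power mu n]_t (kl (b * P t) 1 + b + P t)%:E =
      \int[tuple_power mu n]_t (kl b 1 * P t + b * kl (P t) 1 + b * P t + 1)%:E)%E.
    by apply: eq_integral => t _; rewrite klM//; congr _%:E; ring.
  rewrite !integralD_real//; do ?[by move=> t; rewrite ?addr_ge0 ?mulr_ge0//];
    do ?[by do ?[apply: measurable_funD => //|apply: measurable_funM => //]].
  rewrite !integralZ_real// !integral_cst_prob P1 !mule1 => H.
  apply: (@adde_cancel_fin _ _ _ b); apply: (@adde_cancel_fin _ _ _ 1).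
  exact: H.
have IHg : (\int[tuple_power mu n]_t (kl (P t) 1)%:E =
    \sum_i \int[mu]_x (kl (g i x) 1)%:E)%E by apply: IH => i *; [exact: h0|exact: mh|exact: h1].
under eq_integral do rewrite E IHg.
set s := (\sum_i _)%E.
have s0 : (0%R <= s)%E.
  apply: sume_ge0 => i _; apply: integral_ge0_real => x.
  by apply: kl_ge0 => //; exact: h0.
rewrite ge0_integralD//.
- rewrite ge0_integralZr//; last 2 first.
  + by apply/measurable_EFinP; exact: mh.
  + by move=> x _; rewrite lee_fin ltW.
  by rewrite h1 mul1e big_ord_recl.
- by move=> x _; rewrite lee_fin kl_ge0.
- by apply/measurable_EFinP; exact: mkl1.
- by move=> x _; rewrite mule_ge0// lee_fin ltW.
- by apply: emeasurable_funM => //; apply/measurable_EFinP; exact: mh.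
Qed.

End kl_product.

Section tilted_rows.
Context {R : realType}.
Implicit Types a b v : R.

(** Density of the Gaussian law with mean [a] and variance [1/4], relative to the
    centred one. *)
Definition row_density a v := expR (4 * v * a - 2 * a ^+ 2).

Lemma row_density_gt0 a v : 0 < row_density a v. Proof. exact: expR_gt0. Qed.

Lemma measurable_row_density d (T : measurableType d) (f g : T -> R) :
  measurable_fun setT f -> measurable_fun setT g ->
  measurable_fun setT (fun x => row_density (f x) (g x)).
Proof.
move=> mf mg; apply: measurable_fun_expR; apply: measurable_funB.
  by apply: measurable_funM => //; exact: measurable_funM.
by apply: measurable_funM => //; exact: measurable_funX.
Qed.

Lemma integral_expR_affine (s t : R) :
  (\int[gauss1 R]_v (expR (s * v - t))%:E = (expR (s ^+ 2 / 8 - t))%:E)%E.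
Proof.
transitivity (\int[gauss1 R]_v (expR (- t) * expR (s * v))%:E)%E.
  by apply: eq_integral => v _; rewrite expRD mulrC.
have ms : measurable_fun setT (fun v : measurableTypeR R => expR (s * v)).
  by apply: measurable_fun_expR; exact: mulrl_measurable.
rewrite (integralZ_real _ ms) ?gauss1_exp ?expR_ge0//.
by rewrite -EFinM -expRD addrC.
Qed.

Lemma integral_row_density a : (\int[gauss1 R]_v (row_density a v)%:E = 1)%E.
Proof.
transitivity (\int[gauss1 R]_v (expR (4 * a * v - 2 * a ^+ 2))%:E)%E.
  by apply: eq_integral => v _; rewrite /row_density [4 * v * a]mulrAC.
rewrite integral_expR_affine (_ : _ - _ = 0) ?expR0//; by field.
Qed.

Lemma integral_row_densityM a b :
  (\int[gauss1 R]_v (row_density a v * row_density b v)%:E = (expR (4 * a * b))%:E)%E.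
Proof.
transitivity (\int[gauss1 R]_v
    (expR (4 * (a + b) * v - (2 * a ^+ 2 + 2 * b ^+ 2)))%:E)%E.
  by apply: eq_integral => v _; rewrite /row_density -expRD; congr (expR _)%:E; ring.
rewrite integral_expR_affine; congr (expR _)%:E; by field.
Qed.

Lemma integral_sqrt_row_density a b :
  (\int[gauss1 R]_v (Num.sqrt (row_density a v * row_density b v))%:E =
   (expR (- ((a - b) ^+ 2 / 2)))%:E)%E.
Proof.
transitivity (\int[gauss1 R]_v
    (expR (2 * (a + b) * v - (a ^+ 2 + b ^+ 2)))%:E)%E.
  apply: eq_integral => v _; rewrite /row_density -expRD; congr _%:E.
  set y := (X in _ = expR X).
  rewrite (_ : _ - _ + _ = 2 * y); last by rewrite /y; ring.
  by rewrite expRM_natl sqrtr_sqr ger0_norm ?expR_ge0.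
rewrite integral_expR_affine; congr (expR _)%:E; by field.
Qed.

End tilted_rows.

Section mixture_row.
Context {R : realType} (S : finType) (s0 : S).
Implicit Types (q : S -> R) (a : S -> R).

Lemma integral_mix_row_density q a : (forall s, 0 < q s) -> \sum_s q s = 1 ->
  (\int[gauss1 R]_v (\sum_s q s * row_density (a s) v)%:E = 1)%E.
Proof.
move=> q0 q1; rewrite integral_sum_real.
- rewrite -[RHS]/(1%:E) -q1 -sumEFin; apply: eq_bigr => s _.
  by rewrite integralZ_real ?integral_row_density ?mule1 ?ltW// => [|v];
    [exact: measurable_row_density|exact/ltW/row_density_gt0].
- by move=> s; apply: measurable_funM => //; exact: measurable_row_density.
- by move=> s v; rewrite mulr_ge0 ?ltW ?row_density_gt0.
Qed.

(** The divergence is at most the second moment minus one, a double sum of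
    [expR (4 * a s * a t)]. To first order in the exponent this is the square of
    the barycentre, and the remainder is quadratic in [rho]. *)
Lemma kl_mix_row_density q a (rho : R) : (forall s, 0 < q s) -> \sum_s q s = 1 ->
  0 < rho -> rho <= 8^-1 ->
  (\int[gauss1 R]_v (kl (\sum_s q s * row_density (a s) v) 1)%:E <=
   (4 * (\sum_s q s * a s) ^+ 2 +
    256 * rho ^+ 2 * \sum_s q s * expR (a s ^+ 2 / rho))%:E)%E.
Proof.
move=> q0 q1 r0 r8; pose A (v : measurableTypeR R) := \sum_s q s * row_density (a s) v.
have mA : measurable_fun [set: measurableTypeR R] A.
  by apply: measurable_sum => s; apply: measurable_funM => //; exact: measurable_row_density.
have A0 v : 0 < A v.
  rewrite /A (bigD1 s0)//= ltr_wpDr ?mulr_gt0 ?row_density_gt0// sumr_ge0// => s _.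
  by rewrite mulr_ge0 ?ltW ?row_density_gt0.
have A0' v := ltW (A0 v).
have A1 : (\int[gauss1 R]_v (A v)%:E = 1)%E by exact: integral_mix_row_density.
have mk : measurable_fun [set: measurableTypeR R] (fun v => kl (A v) 1) by exact: measurable_kl.
have A2 : (\int[gauss1 R]_v (A v ^+ 2)%:E =
    (\sum_s \sum_t q s * q t * expR (4 * a s * a t))%:E)%E.
  transitivity (\int[gauss1 R]_v (\sum_s \sum_t
      (q s * q t * (row_density (a s) v * row_density (a t) v)))%:E)%E.
    apply: eq_integral => v _; congr _%:E.
    rewrite expr2 /A mulr_suml; apply: eq_bigr => s _; rewrite mulr_sumr.
    by apply: eq_bigr => t _; rewrite mulrACA.
  have m2 s t : measurable_fun setT (fun v : measurableTypeR R => row_density (a s) v * row_density (a t) v).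
    by apply: measurable_funM; exact: measurable_row_density.
  have p2 s t v : 0 <= row_density (a s) v * row_density (a t) v.
    by rewrite mulr_ge0// ltW ?row_density_gt0.
  have q2 s t : 0 <= q s * q t by rewrite mulr_ge0// ltW.
  rewrite integral_sum_real.
  - rewrite -sumEFin; apply: eq_bigr => s _; rewrite integral_sum_real.
    + rewrite -sumEFin; apply: eq_bigr => t _.
      transitivity ((q s * q t)%:E *
        \int[gauss1 R]_v (row_density (a s) v * row_density (a t) v)%:E)%E.
        exact: (integralZ_real _ (m2 s t) (p2 s t) (q2 s t)).
      by rewrite integral_row_densityM.
    + by move=> t; exact: measurable_funM.
    + by move=> t v; rewrite mulr_ge0.
  - by move=> s; apply: measurable_sum => t; exact: measurable_funM.
  - by move=> s v; apply: sumr_ge0 => t _; rewrite mulr_ge0.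
apply: (@adde_le_cancel_fin _ _ _ 2).
have -> : (2%:E = \int[gauss1 R]_v (2 * A v)%:E)%E.
  by rewrite integralZ_real// A1 mule1.
rewrite -integralD_real//; last 3 first.
- by apply: measurable_funM.
- by move=> v; apply: kl_ge0 => //; exact: A0.
- by move=> v; rewrite mulr_ge0.
apply: (@le_trans _ _ (\int[gauss1 R]_v (A v ^+ 2 + 1)%:E)%E).
  apply: le_integral_real.
  - by apply: measurable_funD => //; apply: measurable_funM.
  - by apply: measurable_funD => //; exact: measurable_funX.
  - by move=> v; apply: addr_ge0; [apply: kl_ge0 => //; exact: A0|rewrite mulr_ge0].
  - by move=> v; exact: kl_le_sqr (A0 v).
rewrite integralD_real//; last 2 first.
- exact: measurable_funX.
- by move=> v; exact: sqr_ge0.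
rewrite A2 integral_cst_prob integralZ_real// A1 mule1 -!EFinD lee_fin.
rewrite (_ : 2 = 1 + 1 :> R)// addrA lerD2r.
pose e s := 128 * rho ^+ 2 * expR (a s ^+ 2 / rho).
apply: (@le_trans _ _ (\sum_s \sum_t q s * q t *
    (1 + 4 * a s * a t + (e s + e t)))).
  apply: ler_sum => s _; apply: ler_sum => t _.
  apply: ler_wpM2l; last exact: expR_4mul_le.
  by rewrite mulr_ge0 ?ltW.
rewrite le_eqVlt; apply/orP; left; apply/eqP.
pose X := \sum_s q s * a s; pose Y := \sum_s q s * e s.
have -> : 256 * rho ^+ 2 * (\sum_s q s * expR (a s ^+ 2 / rho)) = 2 * Y.
  by rewrite /Y !mulr_sumr; apply: eq_bigr => s _; rewrite /e; ring.
transitivity (\sum_s (q s * (1 + 4 * X * a s + e s + Y))).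
  apply: eq_bigr => s _.
  transitivity (\sum_t (q s * (1 + e s) * q t + q s * (4 * a s) * (q t * a t) +
      q s * (q t * e t))).
    by apply: eq_bigr => t _; ring.
  by rewrite !big_split/= -!mulr_sumr q1 -/X -/Y; ring.
transitivity (\sum_s ((1 + Y) * q s + 4 * X * (q s * a s) + q s * e s)).
  by apply: eq_bigr => s _; ring.
by rewrite !big_split/= -!mulr_sumr q1 -/X -/Y; ring.
Qed.

End mixture_row.

(** * Densities of a two-block Gaussian vector *)

Lemma sqrtr_prod (R : realType) (I : finType) (F : I -> R) : (forall i, 0 <= F i) ->
  Num.sqrt (\prod_i F i) = \prod_i Num.sqrt (F i).
Proof.
move=> F0; suff [] : Num.sqrt (\prod_i F i) = \prod_i Num.sqrt (F i) /\ 0 <= \prod_i F i by [].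
elim/big_rec2 : _ => [|i y x _ [<- x0]]; first by rewrite sqrtr1.
by rewrite sqrtrM ?mulr_ge0.
Qed.

Section matrix_density.
Context {R : realType} (p q : nat).
Local Notation Rm := (measurableTypeR R).
Implicit Types (C : 'I_q -> 'I_p -> R).

Definition first_block (x : (p + q).-tuple Rm) : p.-tuple Rm :=
  [tuple tnth x (lshift q i) | i < p].

Lemma first_block_cat (u : p.-tuple Rm) (v : q.-tuple Rm) :
  first_block [tuple of u ++ v] = u.
Proof. by apply: eq_from_tnth => i; rewrite tnth_mktuple tnth_lshift. Qed.

Lemma measurable_first_block : measurable_fun setT first_block.
Proof.
apply/measurable_fun_tnthP => i; rewrite (_ : _ \o _ = fun x => tnth x (lshift q i)).
  exact: measurable_tnth.
by apply/funext => x /=; rewrite tnth_mktuple.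
Qed.

Lemma measurable_lin_first_block (c : 'I_p -> R) :
  measurable_fun setT (fun x : (p + q).-tuple Rm => lin c (first_block x)).
Proof. exact: (measurableT_comp (measurable_lin c) measurable_first_block). Qed.

(** Density of a vector whose last [q] coordinates are, given the first block,
    independent Gaussian variables with means the linear forms [C r] of that
    block. *)
Definition block_density C (x : (p + q).-tuple Rm) : R :=
  \prod_r row_density (lin (C r) (first_block x)) (tnth x (rshift p r)).

Lemma block_density_gt0 C x : 0 < block_density C x.
Proof. by apply: prodr_gt0 => r _; exact: row_density_gt0. Qed.

Lemma measurable_block_density C : measurable_fun setT (block_density C).
Proof.
apply: measurable_prod => r _; apply: measurable_row_density.
  exact: measurable_lin_first_block.
exact: measurable_tnth.
Qed.

Lemma block_density_cat C (u : p.-tuple Rm) (v : q.-tuple Rm) :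
  block_density C [tuple of u ++ v] = \prod_r row_density (lin (C r) u) (tnth v r).
Proof. by apply: eq_bigr => r _; rewrite first_block_cat tnth_rshift. Qed.

Let Gu := tuple_power (gauss1 R) p.
Let Gx := tuple_power (gauss1 R) (p + q).

(** Given the first block, the coordinates of the second one are independent. *)
Lemma integral_rows (F : (p + q).-tuple Rm -> R)
    (h : 'I_q -> p.-tuple Rm -> Rm -> R) (g : 'I_q -> p.-tuple Rm -> R) :
  measurable_fun setT F -> (forall x, 0 <= F x) ->
  (forall (u : p.-tuple Rm) (v : q.-tuple Rm), F [tuple of u ++ v] = \prod_r h r u (tnth v r)) ->
  (forall r u, measurable_fun setT (h r u)) ->
  (forall r u v, 0 <= h r u v) ->
  (forall r u, (\int[gauss1 R]_v (h r u v)%:E = (g r u)%:E)%E) ->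
  (\int[Gx]_x (F x)%:E = \int[Gu]_u (\prod_r g r u)%:E)%E.
Proof.
move=> mF F0 FE mh h0 hg.
rewrite integral_tuple_power_cat; last 2 first.
- exact/measurable_EFinP.
- by move=> x; rewrite lee_fin.
apply: eq_integral => u _.
rewrite -(@integral_tuple_power_prod _ _ _ (gauss1 R) q (fun r => h r u))//.
by apply: eq_integral => v _; rewrite FE.
Qed.

Lemma integral_block_density C : (\int[Gx]_x (block_density C x)%:E = 1)%E.
Proof.
rewrite (@integral_rows _ (fun r u v => row_density (lin (C r) u) v) (fun _ _ => 1)).
- under eq_integral do rewrite big1//.
  by rewrite integral_cst_prob.
- exact: measurable_block_density.
- by move=> x; exact/ltW/block_density_gt0.
- exact: block_density_cat.
- by move=> r u; exact: measurable_row_density.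
- by move=> r u v; exact/ltW/row_density_gt0.
- by move=> r u; exact: integral_row_density.
Qed.

(** Given the first block, each row contributes a factor [expR (- x ^+ 2 / 2)], where
    [x] is the difference of two linear forms of that block; it is at least
    [1 - x ^+ 2 / 2], and the second moment of [x] is known. *)
Lemma affinity_block_density C C' : \sum_r sqn (fun i => C r i - C' r i) <= 1 ->
  ((1 - \sum_r sqn (fun i => C r i - C' r i))%:E <=
   \int[Gx]_x (Num.sqrt (block_density C x * block_density C' x))%:E)%E.
Proof.
set D := fun r i => C r i - C' r i; set s := \sum_r _ => s1.
have sq1 r : sqn (D r) <= 1.
  rewrite (le_trans _ s1)// /s (bigD1 r)//= lerDl sumr_ge0// => t _.
  exact: sqn_ge0.
pose E u := expR (- \sum_r (lin (D r) u) ^+ 2 / 2).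
have linB r u : lin (D r) u = lin (C r) u - lin (C' r) u.
  by rewrite /lin -sumrB; apply: eq_bigr => i _; rewrite /D mulrBl.
rewrite (@integral_rows _
  (fun r u v => Num.sqrt (row_density (lin (C r) u) v * row_density (lin (C' r) u) v))
  (fun r u => expR (- ((lin (C r) u - lin (C' r) u) ^+ 2 / 2)))).
- have -> : (\int[Gu]_u (\prod_r expR (- ((lin (C r) u - lin (C' r) u) ^+ 2 / 2)))%:E =
      \int[Gu]_u (E u)%:E)%E.
    apply: eq_integral => u _; rewrite -expR_sum /E -sumrN; congr (expR _)%:E.
    by apply: eq_bigr => r _; rewrite linB.
  have msq r : measurable_fun setT (fun u : p.-tuple Rm => lin (D r) u ^+ 2).
    by apply: measurable_funX; exact: measurable_lin.
  have mS : measurable_fun setT (fun u : p.-tuple Rm => \sum_r lin (D r) u ^+ 2 / 2).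
    by apply: measurable_sum => r; apply: measurable_funM.
  have mE : measurable_fun setT E.
    by apply: measurable_fun_expR; rewrite -[X in measurable_fun _ X]/(\- (fun u => \sum_r lin (D r) u ^+ 2 / 2)); exact: measurable_funN.
  apply: (@adde_le_cancel_fin _ _ _ s); rewrite -EFinD subrK.
  apply: (@le_trans _ _ (\int[Gu]_u (E u + \sum_r lin (D r) u ^+ 2 / 2)%:E)%E).
    rewrite -[leLHS](integral_cst_prob Gu); apply: le_integral_real => //.
    - exact: measurable_funD.
    - by move=> u; have := @expR_ge1Dx R (- \sum_r (lin (D r) u) ^+ 2 / 2); rewrite /E; lra.
  rewrite integralD_real//; last 2 first.
  + by move=> u; exact: expR_ge0.
  + by move=> u; apply: sumr_ge0 => r _; rewrite divr_ge0 ?sqr_ge0.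
  apply: leeD2l; rewrite integral_sum_real.
  + rewrite /s -sumEFin; apply: lee_sum => r _.
    have E1 : (\int[Gu]_u (lin (D r) u ^+ 2 / 2)%:E =
        (2^-1)%:E * \int[Gu]_u (lin (D r) u ^+ 2)%:E)%E.
      rewrite -integralZ_real//; last by move=> u; exact: sqr_ge0.
      by apply: eq_integral => u _; rewrite mulrC.
    rewrite E1 (@le_trans _ _ ((2^-1)%:E * (2 * sqn (D r))%:E)%E)//.
      by rewrite lee_wpmul2l// integral_lin_sqr.
    by rewrite -EFinM lee_fin mulrA mulVf ?mul1r.
  + by move=> r; apply: measurable_funM.
  + by move=> r u; rewrite divr_ge0 ?sqr_ge0.
- by apply: measurable_fun_sqrt => [x|]; rewrite ?mulr_gt0 ?block_density_gt0//;
    apply: measurable_funM; exact: measurable_block_density.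
- by move=> x; exact: sqrtr_ge0.
- move=> u v; rewrite !block_density_cat -big_split/=.
  by apply: sqrtr_prod => r; rewrite mulr_ge0 ?ltW ?row_density_gt0.
- move=> r u; apply: measurable_fun_sqrt => [x|]; rewrite ?mulr_gt0 ?row_density_gt0//.
  by apply: measurable_funM; exact: measurable_row_density.
- by move=> r u v; exact: sqrtr_ge0.
- by move=> r u; exact: integral_sqrt_row_density.
Qed.

End matrix_density.

Section matrix_mixture.
Context {R : realType} (p q : nat) (S : finType) (s0 : S) (c : S -> 'I_p -> R).
Local Notation Rm := (measurableTypeR R).
Let Gu := tuple_power (gauss1 R) p.
Let Gx : probability ((p + q).-tuple Rm) R := tuple_power (gauss1 R) (p + q).
Let J := {ffun 'I_q -> S}.

(** The index [W] selects one of finitely many coefficient vectors for each row. *)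
Definition rows_density (W : J) : (p + q).-tuple Rm -> R := block_density (fun r => c (W r)).

(** When the weights factor over the rows, so does the mixture given the first
    block, and only the barycentre of each row matters to first order. *)
Lemma divergence_rows_density_le (om : 'I_q -> S -> R) (rho : R) :
  (forall r s, 0 < om r s) -> 0 < rho -> rho <= 8^-1 ->
  (forall s, sqn (c s) <= rho) ->
  (divergence Gx rows_density (fun W : J => \prod_r om r (W r))%R <=
   (tot (fun W : J => \prod_r om r (W r)) *
    \sum_r (8 * sqn (fun i => \sum_s om r s * c s i / \sum_s om r s)
            + 512 * rho ^+ 2))%:E)%E.
Proof.
move=> om0 r0 r8 hc.
pose t r := \sum_s om r s.
have t0 r : 0 < t r.
  by rewrite /t (bigD1 s0)//= ltr_wpDr// sumr_ge0// => s _; exact: ltW.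
have totE : tot (fun W : J => \prod_r om r (W r)) = \prod_r t r.
  by rewrite /tot /t bigA_distr_bigA.
have P0 : 0 < \prod_r t r by apply: prodr_gt0 => r _; exact: t0.
pose qq r s := om r s / t r.
have q0 r s : 0 < qq r s by rewrite divr_gt0.
have q1 r : \sum_s qq r s = 1 by rewrite -mulr_suml divff// gt_eqF// t0.
pose m r i := \sum_s qq r s * c s i.
pose A r u v := \sum_s qq r s * row_density (lin (c s) u) v.
have A0 r u v : 0 < A r u v.
  rewrite /A (bigD1 s0)//=; apply: ltr_wpDr; last exact: mulr_gt0 (q0 _ _) (row_density_gt0 _ _).
  by apply: sumr_ge0 => s _; exact: mulr_ge0 (ltW (q0 _ _)) (ltW (row_density_gt0 _ _)).
pose b := 256 * rho ^+ 2.
have b0 : 0 <= b := mulr_ge0 (ler0n R 256) (sqr_ge0 rho).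
have bE : 512 * rho ^+ 2 = b * 2 by rewrite /b; ring.
have bE' : 256 * rho ^+ 2 = b by [].
move: b b0 bE bE' => b b0 bE bE'; rewrite bE.
pose psi r (u : p.-tuple Rm) := 4 * lin (m r) u ^+ 2 +
  b * \sum_s qq r s * expR (lin (c s) u ^+ 2 / rho).
have mlin2 (c' : 'I_p -> R) : measurable_fun setT (fun u : p.-tuple Rm => lin c' u ^+ 2).
  by apply: measurable_funX; exact: measurable_lin.
have mexp s : measurable_fun setT (fun u : p.-tuple Rm => expR (lin (c s) u ^+ 2 / rho)).
  by apply: measurable_fun_expR; apply: measurable_funM.
have msum r : measurable_fun setT (fun u : p.-tuple Rm =>
    \sum_s qq r s * expR (lin (c s) u ^+ 2 / rho)).
  by apply: measurable_sum => s; apply: measurable_funM.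
have sum0 r u : 0 <= \sum_s qq r s * expR (lin (c s) u ^+ 2 / rho).
  by apply: sumr_ge0 => s _; rewrite mulr_ge0 ?expR_ge0// ltW.
have mpsi r : measurable_fun setT (psi r).
  by apply: measurable_funD; apply: measurable_funM.
have psi0 r u : 0 <= psi r u.
  by apply: addr_ge0; apply: mulr_ge0 => //; exact: sqr_ge0.
have sqnm r : sqn (m r) <= rho.
  apply: (@le_trans _ _ (\sum_s qq r s * sqn (c s))); last first.
    rewrite -[leRHS]mul1r -(q1 r) mulr_suml; apply: ler_sum => s _.
    by rewrite ler_wpM2l// ltW.
  rewrite /sqn.
  under [leRHS]eq_bigr do rewrite mulr_sumr.
  rewrite exchange_big/=; apply: ler_sum => i _.
  have : 0 <= \sum_s qq r s * (c s i - m r i) ^+ 2.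
    by apply: sumr_ge0 => s _; rewrite mulr_ge0 ?sqr_ge0// ltW.
  rewrite (eq_bigr (fun s => qq r s * c s i ^+ 2 - 2 * m r i * (qq r s * c s i) +
    m r i ^+ 2 * qq r s)); last by move=> s _; ring.
  rewrite !big_split/= sumrN -!mulr_sumr q1 -/(m r i) mulr1 => h.
  by rewrite -subr_ge0; apply: (le_trans h); rewrite le_eqVlt; apply/orP; left; apply/eqP; ring.
have psi_int r : (\int[Gu]_u (psi r u)%:E <= (8 * sqn (m r) + b * 2)%:E)%E.
  rewrite integralD_real//; last 4 first.
  - by apply: measurable_funM.
  - by apply: measurable_funM.
  - by move=> u; rewrite mulr_ge0 ?sqr_ge0.
  - by move=> u; exact: mulr_ge0.
  rewrite EFinD; apply: leeD.
    rewrite integralZ_real//; last by move=> u; exact: sqr_ge0.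
    have -> : (8 * sqn (m r))%:E = (4%:E * (2 * sqn (m r))%:E)%E.
      by rewrite -EFinM; congr _%:E; ring.
    rewrite lee_wpmul2l// integral_lin_sqr// (le_trans (sqnm r))//.
    by rewrite (le_trans r8)// invf_le1// ler1n.
  rewrite integralZ_real//.
  rewrite EFinM.
  apply: lee_wpmul2l; first by rewrite lee_fin.
  rewrite integral_sum_real; last 2 first.
  - by move=> s; apply: measurable_funM.
  - by move=> s u; rewrite mulr_ge0 ?expR_ge0// ltW.
  apply: (@le_trans _ _ (\sum_s (qq r s * 2)%:E)%E); last first.
    by rewrite sumEFin -mulr_suml q1 mul1r.
  apply: lee_sum => s _; rewrite (integralZ_real _ (mexp s) _ (ltW (q0 r s)));
    last by move=> u; exact: expR_ge0.
  rewrite [leRHS]EFinM; apply: lee_wpmul2l; first by rewrite lee_fin ltW.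
  exact: integral_expR_lin_sqr.
(* the divergence, integrated over the two blocks *)
have E1 x : tot (fun W : J => (\prod_r om r (W r)) * rows_density W x) =
    \prod_r t r * \prod_r A r (first_block x) (tnth x (rshift p r)).
  rewrite -big_split/=.
  transitivity (\sum_(W : J) \prod_r (om r (W r) *
     row_density (lin (c (W r)) (first_block x)) (tnth x (rshift p r)))).
    by apply: eq_bigr => W _; rewrite big_split.
  rewrite -(bigA_distr_bigA (fun r s => om r s *
     row_density (lin (c s) (first_block x)) (tnth x (rshift p r)))).
  apply: eq_bigr => r _; rewrite /A mulr_sumr; apply: eq_bigr => s _.
  by rewrite /qq mulrA mulrCA divff ?mulr1// gt_eqF.
have mA r : measurable_fun setT (fun x : (p + q).-tuple Rm =>
    A r (first_block x) (tnth x (rshift p r))).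
  apply: measurable_sum => s; apply: measurable_funM => //.
  by apply: measurable_row_density; [exact: measurable_lin_first_block|exact: measurable_tnth].
have mPA : measurable_fun setT (fun x : (p + q).-tuple Rm =>
    \prod_r A r (first_block x) (tnth x (rshift p r))).
  by apply: measurable_prod => r _.
have PA0 (x : (p + q).-tuple Rm) : 0 < \prod_r A r (first_block x) (tnth x (rshift p r)).
  exact: prodr_gt0.
have mkl : measurable_fun setT (fun x : (p + q).-tuple Rm =>
    kl (\prod_r A r (first_block x) (tnth x (rshift p r))) 1).
  by apply: measurable_kl.
have kl0 (x : (p + q).-tuple Rm) :
    0 <= kl (\prod_r A r (first_block x) (tnth x (rshift p r))) 1.
  by apply: kl_ge0.
rewrite /divergence.
have -> : (\int[Gx]_x (kl (tot (fun W : J => (\prod_r om r (W r)) * rows_density W x))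
      (tot (fun W : J => \prod_r om r (W r))))%:E =
    (\prod_r t r)%:E * \int[Gx]_x
      (kl (\prod_r A r (first_block x) (tnth x (rshift p r))) 1)%:E)%E.
  rewrite -integralZ_real// ?ltW//; apply: eq_integral => x _.
  by rewrite E1 totE -klZ// mulr1.
rewrite totE EFinM; apply: lee_wpmul2l; first by rewrite lee_fin ltW.
rewrite integral_tuple_power_cat; last 2 first.
- exact/measurable_EFinP.
- by move=> x; rewrite lee_fin.
apply: (@le_trans _ _ (\int[Gu]_u (\sum_r psi r u)%:E)%E); last first.
  rewrite integral_sum_real// -sumEFin; apply: lee_sum => r _.
  rewrite (le_trans (psi_int r))// lee_fin lerD2r ler_wpM2l//.
  by rewrite /sqn ler_sum// => i _; rewrite /m /qq;
    under eq_bigr do rewrite mulrAC.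
apply: ge0_le_integral => //.
- by move=> u _; apply: integral_ge0_real.
- apply: (measurable_fun_fubini_tonelli_F (fun z : p.-tuple Rm * q.-tuple Rm =>
    (kl (\prod_r A r (first_block [tuple of z.1 ++ z.2]) (tnth [tuple of z.1 ++ z.2] (rshift p r))) 1)%:E)).
  + apply/measurable_EFinP.
    apply: (measurableT_comp (f := fun x : (p + q).-tuple Rm =>
       kl (\prod_r A r (first_block x) (tnth x (rshift p r))) 1)) => //.
    exact: measurable_cat.
  + by move=> z; rewrite lee_fin.
- by apply/measurable_EFinP; apply: measurable_sum => r.
- move=> u _.
  have -> : (\int[tuple_power (gauss1 R) q]_v
      (kl (\prod_r A r (first_block [tuple of u ++ v]) (tnth [tuple of u ++ v] (rshift p r))) 1)%:E =
    \int[tuple_power (gauss1 R) q]_v (kl (\prod_r A r u (tnth v r)) 1)%:E)%E.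
    apply: eq_integral => v _; congr (kl _ 1)%:E.
    by apply: eq_bigr => r _; rewrite first_block_cat tnth_rshift.
  rewrite (@kl_tensor _ _ _ (gauss1 R) q (fun r v => A r u v))//.
  + rewrite -sumEFin; apply: lee_sum => r _.
    rewrite (le_trans (kl_mix_row_density s0 (fun s => lin (c s) u) (q0 r) (q1 r) r0 r8))//.
    rewrite lee_fin bE' /psi lerD2r ler_wpM2l//.
    rewrite le_eqVlt; apply/orP; left; apply/eqP; congr (_ ^+ 2).
    rewrite /lin /m.
    under eq_bigr do rewrite mulr_sumr.
    rewrite exchange_big/=; apply: eq_bigr => i _; rewrite mulr_suml.
    by apply: eq_bigr => s _; rewrite mulrA.
  + move=> r; apply: measurable_sum => s; apply: measurable_funM => //.
    exact: measurable_row_density.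
  + by move=> r; exact: integral_mix_row_density.
Qed.

End matrix_mixture.

(** * Signs that the observations can hardly determine *)

Lemma sum_cauchy_schwarz (R : realType) (I : finType) (a b : I -> R) :
  (\sum_i a i * b i) ^+ 2 <= (\sum_i a i ^+ 2) * \sum_i b i ^+ 2.
Proof.
set A := \sum_i a i ^+ 2; set B := \sum_i b i ^+ 2; set C := \sum_i a i * b i.
have B0 : 0 <= B by apply: sumr_ge0 => i _; exact: sqr_ge0.
have key t : 0 <= A - 2 * t * C + t ^+ 2 * B.
  rewrite /A /B /C !mulr_sumr -sumrB -big_split/=.
  apply: sumr_ge0 => i _; have := sqr_ge0 (a i - t * b i).
  by congr (_ <= _); ring.
have [B00|Bn0] := eqVneq B 0.
  have : C = 0.
    rewrite /C big1// => i _; suff -> : b i = 0 by rewrite mulr0.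
    move/eqP: B00; rewrite psumr_eq0 => [/allP/(_ i (mem_index_enum i))|j _].
      by rewrite sqrf_eq0 => /eqP.
    exact: sqr_ge0.
  by move=> ->; rewrite B00 mulr0 expr0n.
have Bp : 0 < B by rewrite lt_def Bn0.
have := key (C / B); have -> : A - 2 * (C / B) * C + (C / B) ^+ 2 * B = A - C ^+ 2 / B.
  by field.
by rewrite subr_ge0 ler_pdivrMr.
Qed.

Section sign_flip.
Context {R : realType} (J : finType).
Implicit Types (w x : J -> R).

(** Pairing each index with its flip turns the mean into a sum of differences of
    weights; such a difference factors through the square roots of the weights,
    and Cauchy-Schwarz applies. So a sign whose reversal barely changes the
    weights has a small mean. *)
Lemma odd_mean_sqr_le (fl : J -> J) w x (tau : R) :
  involutive fl -> (forall j, 0 < w j) -> (forall j, x (fl j) = - x j) ->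
  (forall j, x j ^+ 2 = tau ^+ 2) ->
  (\sum_j w j * x j) ^+ 2 <= tau ^+ 2 * tot w *
    \sum_j (Num.sqrt (w j) - Num.sqrt (w (fl j))) ^+ 2.
Proof.
move=> flK w0 xN x2.
have w0' j := ltW (w0 j).
pose s j := Num.sqrt (w j).
have s2 j : s j ^+ 2 = w j by rewrite sqr_sqrtr.
have re (F : J -> R) : \sum_j F (fl j) = \sum_j F j.
  by rewrite [RHS](reindex_inj (inv_inj flK)).
pose a j := s j - s (fl j); pose b j := x j * (s j + s (fl j)).
have E1 : \sum_j w j * x j = 2^-1 * \sum_j a j * b j.
  have : \sum_j a j * b j = \sum_j (w j * x j + w (fl j) * x (fl j)).
    by apply: eq_bigr => j _; rewrite xN -!s2 /a /b; ring.
  by rewrite big_split/= (re (fun j => w j * x j)) => ->; field.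
have E2 : \sum_j b j ^+ 2 <= 4 * tau ^+ 2 * tot w.
  have : \sum_j b j ^+ 2 <= \sum_j (tau ^+ 2 * (2 * (w j + w (fl j)))).
    apply: ler_sum => j _; rewrite exprMn x2 ler_wpM2l ?sqr_ge0// -!s2.
    have := sqr_ge0 (s j - s (fl j)); nra.
  by rewrite -!mulr_sumr big_split/= (re w) /tot => h; apply: (le_trans h); rewrite le_eqVlt; apply/orP; left; apply/eqP; ring.
have CS : (\sum_j a j * b j) ^+ 2 <= (\sum_j a j ^+ 2) * \sum_j b j ^+ 2.
  exact: sum_cauchy_schwarz.
rewrite E1 exprMn.
have A0 : 0 <= \sum_j a j ^+ 2 by apply: sumr_ge0 => j _; exact: sqr_ge0.
have := ler_wpM2l A0 E2; rewrite -/(a _).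
under [X in _ -> _ <= _ * X]eq_bigr do rewrite -/(s _) -/(s (fl _)) -/(a _).
move=> h; rewrite exprVn; lra.
Qed.

End sign_flip.

Lemma bernoulli_le (R : realDomainType) (e : R) n : 0 <= e <= 1 ->
  1 - n%:R * e <= (1 - e) ^+ n.
Proof.
move=> /andP[e0 e1]; elim: n => [|n IH]; first by rewrite expr0; lra.
have h : 0 <= 1 - e by lra.
have := ler_wpM2l h IH; rewrite -exprS => h2; apply: (le_trans _ h2).
rewrite -natr1; have : 0 <= n%:R * e ^+ 2 by rewrite mulr_ge0// sqr_ge0.
nra.
Qed.

Lemma integral_fst_snd d1 d2 (T1 : measurableType d1) (T2 : measurableType d2)
  (R : realType) (P : probability T1 R) (Q : probability T2 R)
  (f : T1 -> R) (g : T2 -> R) (a b : R) :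
  measurable_fun setT f -> measurable_fun setT g ->
  (forall x, 0 <= f x) -> (forall x, 0 <= g x) ->
  (\int[P]_x (f x)%:E = a%:E)%E -> (\int[Q]_x (g x)%:E = b%:E)%E ->
  (\int[P \x Q]_z (f z.1 * g z.2)%:E = (a * b)%:E)%E.
Proof.
move=> mf mg f0 g0 fa gb; rewrite fubini_tonelli1/=; last 2 first.
- apply/measurable_EFinP; apply: measurable_funM.
    exact: (measurableT_comp mf measurable_fst).
  exact: (measurableT_comp mg measurable_snd).
- by move=> z; rewrite lee_fin mulr_ge0.
transitivity (\int[P]_x (b%:E * (f x)%:E))%E.
  by apply: eq_integral => x _; rewrite -gb muleC -integralZ_real.
rewrite ge0_integralZl//; last 3 first.
- exact/measurable_EFinP.
- by move=> x _; rewrite lee_fin.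
- by rewrite -gb integral_ge0_real.
by rewrite fa -EFinM mulrC.
Qed.

Section sign_ensemble.
Context {R : realType} (p q : nat) (tau : R).
Local Notation Rm := (measurableTypeR R).
Let S := {ffun 'I_p -> bool}.
Let J := {ffun 'I_q -> S}.
Let Gx : probability ((p + q).-tuple Rm) R := tuple_power (gauss1 R) (p + q).

Definition coef (s : 'S_p) (w : S) (i : 'I_p) : R := tau * (-1) ^+ w (s i).

Lemma coef_sqr s w i : coef s w i ^+ 2 = tau ^+ 2.
Proof. by rewrite exprMn sqrr_sign mulr1. Qed.

Lemma sqn_coef s w : sqn (coef s w) = p%:R * tau ^+ 2.
Proof.
rewrite /sqn (eq_bigr (fun=> tau ^+ 2)); last by move=> i _; exact: coef_sqr.
by rewrite sumr_const card_ord mulr_natl.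
Qed.

Definition flip (r : 'I_q) (j : 'I_p) (W : J) : J :=
  [ffun r' => [ffun i => ((r' == r) && (i == j)) (+) W r' i]].

Lemma flipK r j : involutive (flip r j).
Proof. by move=> W; apply/ffunP => r'; apply/ffunP => i; rewrite !ffunE addKb. Qed.

Lemma coef_flip s r i (W : J) : coef s (flip r (s i) W r) i = - coef s (W r) i.
Proof. by rewrite /coef !ffunE !eqxx/= signrN mulrN. Qed.

Lemma sqn_coef_flip s r j (W : J) :
  \sum_r' sqn (fun i => coef s (W r') i - coef s (flip r j W r') i) = 4 * tau ^+ 2.
Proof.
rewrite (bigD1 r)//= big1 ?addr0; last first.
  move=> r' r'r; rewrite /sqn big1// => i _.
  by rewrite /coef !ffunE (negbTE r'r)/= subrr expr0n.
rewrite /sqn (bigD1 (s^-1 j)%g)//= big1 ?addr0; last first.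
  move=> i ij; rewrite /coef !ffunE eqxx/= (_ : (s i == j) = false) ?subrr ?expr0n//.
  by apply: contraNF ij => /eqP <-; rewrite permK.
rewrite /coef !ffunE permKV !eqxx/= signrN mulrN opprK.
have := coef_sqr s (W r) (s^-1 j)%g; rewrite /coef permKV => <-; ring.
Qed.

(** One sign changes one coefficient by [2 * tau], so each observation lowers the
    affinity by a factor of at least [1 - 4 * tau ^+ 2]. *)
Lemma affinity_lik n s r j (W : J) : 4 * tau ^+ 2 <= 1 -> exists2 a : R,
  (\int[tuple_power Gx n]_X (Num.sqrt (lik (rows_density (coef s)) W X *
    lik (rows_density (coef s)) (flip r j W) X))%:E = a%:E)%E &
  (1 - 4 * tau ^+ 2) ^+ n <= a.
Proof.
move=> t1; set f := rows_density (coef s).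
have f0 W' x : 0 < f W' x by exact: block_density_gt0.
have mf W' : measurable_fun setT (f W') by exact: measurable_block_density.
have f1 W' : (\int[Gx]_x (f W' x)%:E = 1)%E by exact: integral_block_density.
pose g x := Num.sqrt (f W x * f (flip r j W) x).
have ff0 x : 0 < f W x * f (flip r j W) x by exact: mulr_gt0.
have mg : measurable_fun setT g.
  by apply: measurable_fun_sqrt => //; exact: measurable_funM.
have g0 x : 0 <= g x by exact: sqrtr_ge0.
have aff : ((1 - 4 * tau ^+ 2)%:E <= \int[Gx]_x (g x)%:E)%E.
  have := @affinity_block_density R p q (fun r' => coef s (W r')) (fun r' => coef s (flip r j W r')).
  by rewrite sqn_coef_flip => /(_ t1).
(* finiteness allows real powers of the affinity *)
have fin : (\int[Gx]_x (g x)%:E <= 2%:E)%E.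
  have -> : (2%:E = \int[Gx]_x (f W x + f (flip r j W) x)%:E)%E.
    rewrite integralD_real//; do ?[by move=> x; exact: ltW].
    by rewrite !f1 -EFinD.
  apply: le_integral_real => //; first exact: measurable_funD.
  move=> x; have h1 := f0 W x; have h2 := f0 (flip r j W) x; rewrite /g.
  rewrite -[leRHS](ger0_norm (addr_ge0 (ltW h1) (ltW h2))) -sqrtr_sqr.
  apply: ler_wsqrtr; nra.
have gfin : (\int[Gx]_x (g x)%:E)%E \is a fin_num.
  rewrite ge0_fin_numE ?integral_ge0_real//; exact: (le_lt_trans fin (ltry _)).
exists (fine (\int[Gx]_x (g x)%:E)%E ^+ n).
  under eq_integral => X _.
    have -> : Num.sqrt (lik f W X * lik f (flip r j W) X) = \prod_i g (tnth X i).
      rewrite /lik -big_split/= sqrtr_prod// => i; exact: ltW.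
    over.
  rewrite (@integral_tuple_power_prod _ _ _ Gx n (fun=> g)
    (fun=> fine (\int[Gx]_x (g x)%:E)%E))//.
    by rewrite prodr_const card_ord.
  by move=> _; rewrite fineK.
rewrite lerXn2r ?nnegrE//.
- by lra.
- by rewrite fine_ge0// integral_ge0_real.
- by rewrite -lee_fin fineK.
Qed.

End sign_ensemble.

(** * Information about the permutation in the smaller sample *)

Section information.
Context {R : realType} (p q : nat) (tau : R).
Local Notation Rm := (measurableTypeR R).
Let S := {ffun 'I_p -> bool}.
Let J := {ffun 'I_q -> S}.
Let T := (p + q).-tuple Rm.
Let Gx : probability T R := tuple_power (gauss1 R) (p + q).
Variables (s1 s2 : 'S_p) (N : nat).
Hypotheses (tau0 : 0 < tau) (tau1 : p%:R * tau ^+ 2 <= 8^-1) (p0 : (0 < p)%N).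

Let f1 : J -> T -> R := rows_density (coef tau s1).
Let f2 : J -> T -> R := rows_density (coef tau s2).
Let j0 : J := [ffun=> [ffun=> false]].

Let f1_gt0 W x : 0 < f1 W x. Proof. exact: block_density_gt0. Qed.
Let f2_gt0 W x : 0 < f2 W x. Proof. exact: block_density_gt0. Qed.
Let mf1 W : measurable_fun setT (f1 W). Proof. exact: measurable_block_density. Qed.
Let mf2 W : measurable_fun setT (f2 W). Proof. exact: measurable_block_density. Qed.
Let if1 W : (\int[Gx]_x (f1 W x)%:E = 1)%E. Proof. exact: integral_block_density. Qed.
Let if2 W : (\int[Gx]_x (f2 W x)%:E = 1)%E. Proof. exact: integral_block_density. Qed.

Let l1_gt0 n W (X : n.-tuple T) : 0 < lik f1 W X. Proof. exact: lik_gt0. Qed.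
Let l2_gt0 n W (X : n.-tuple T) : 0 < lik f2 W X. Proof. exact: lik_gt0. Qed.
Let l1_ge0 n W (X : n.-tuple T) : 0 <= lik f1 W X. Proof. exact: ltW. Qed.
Let l2_ge0 n W (X : n.-tuple T) : 0 <= lik f2 W X. Proof. exact: ltW. Qed.

(** Likelihood of the pair of samples, the large one of law given by [s1] and the
    small one by [s2]. *)
Definition joint_weight k (z : N.-tuple T * k.-tuple T) (W : J) : R :=
  lik f1 W z.1 * lik f2 W z.2.

Lemma joint_weight_gt0 k (z : N.-tuple T * k.-tuple T) W : 0 < joint_weight z W.
Proof. exact: mulr_gt0. Qed.

Let mlik1 n W : measurable_fun setT (@lik _ _ _ _ f1 n W).
Proof. exact: measurable_lik. Qed.

Let mlik2 n W : measurable_fun setT (@lik _ _ _ _ f2 n W).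
Proof. exact: measurable_lik. Qed.

Lemma measurable_joint_weight k W :
  measurable_fun setT (fun z : N.-tuple T * k.-tuple T => joint_weight z W).
Proof.
apply: measurable_funM.
  exact: (measurableT_comp (mlik1 W) measurable_fst).
exact: (measurableT_comp (mlik2 W) measurable_snd).
Qed.

Let mtot k : measurable_fun setT (fun z : N.-tuple T * k.-tuple T => tot (joint_weight z)).
Proof. by apply: measurable_sum => W; exact: measurable_joint_weight. Qed.

Let tot0 k (z : N.-tuple T * k.-tuple T) : 0 < tot (joint_weight z).
Proof. by apply: tot_gt0 => [|W]; [exact: j0|exact: joint_weight_gt0]. Qed.

Let P n : probability (n.-tuple T) R := tuple_power Gx n.

Lemma integral_joint_weight k W :
  (\int[P N \x P k]_z (joint_weight z W)%:E = 1)%E.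
Proof.
have l1 : (\int[P N]_X (lik f1 W X)%:E = 1)%E := integral_lik f1_gt0 mf1 if1 N W.
have l2 : (\int[P k]_X (lik f2 W X)%:E = 1)%E := integral_lik f2_gt0 mf2 if2 k W.
rewrite -[RHS]/(1%:E) -[1 in RHS]mulr1.
exact: (integral_fst_snd (mlik1 W) (mlik2 W) _ _ l1 l2).
Qed.

Lemma integral_tot_joint_weight k :
  (\int[P N \x P k]_z (tot (joint_weight z))%:E = (#|J|%:R)%:E)%E.
Proof.
rewrite integral_sum_real.
- rewrite (eq_bigr (fun=> (1 : R)%:E)); last by move=> W _; exact: integral_joint_weight.
  by rewrite sumEFin sumr_const.
- exact: measurable_joint_weight.
- by move=> W z; exact/ltW/joint_weight_gt0.
Qed.

(** Squared Hellinger distance, summed over all sign matrices, between a matrix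
    and its image by [fl]; it measures how much the observations reveal about
    the signs that [fl] changes. *)
Definition hellinger_gap k (fl : J -> J) (z : N.-tuple T * k.-tuple T) : R :=
  \sum_W (Num.sqrt (joint_weight z W) - Num.sqrt (joint_weight z (fl W))) ^+ 2.

Let msqrt k W : measurable_fun setT (fun z : N.-tuple T * k.-tuple T =>
  Num.sqrt (joint_weight z W)).
Proof.
apply: measurable_fun_sqrt; last exact: measurable_joint_weight.
by move=> z; exact: joint_weight_gt0.
Qed.

Lemma measurable_hellinger_gap k fl : measurable_fun setT (@hellinger_gap k fl).
Proof.
by apply: measurable_sum => W; apply: measurable_funX; apply: measurable_funB; exact: msqrt.
Qed.

Lemma hellinger_gap_ge0 k fl z : 0 <= @hellinger_gap k fl z.
Proof. by apply: sumr_ge0 => W _; exact: sqr_ge0. Qed.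

(** The squared Hellinger distance is twice one minus the affinity, and the
    affinity of [N + k] observations is at least [1 - 4 * (N + k) * tau ^+ 2] by
    the Bernoulli inequality. *)
Lemma integral_hellinger_gap k r j : (k <= N)%N ->
  (\int[P N \x P k]_z (hellinger_gap (flip r j) z)%:E <=
    (#|J|%:R * (16 * N%:R * tau ^+ 2))%:E)%E.
Proof.
move=> kN; rewrite integral_sum_real; last 2 first.
- by move=> W; apply: measurable_funX; apply: measurable_funB; exact: msqrt.
- by move=> W z; exact: sqr_ge0.
apply: (@le_trans _ _ (\sum_(W : J) (16 * N%:R * tau ^+ 2)%:E)%E); last first.
  by rewrite sumEFin sumr_const lee_fin -[leLHS]mulr_natl.
apply: lee_sum => W _; set W' := flip r j W.
have t2 : 0 <= tau ^+ 2 := sqr_ge0 _.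
have t1 : 4 * tau ^+ 2 <= 1.
  have : tau ^+ 2 <= p%:R * tau ^+ 2 by rewrite ler_peMl// ler1n.
  move=> h; have := le_trans h tau1; lra.
have [a1 ia1 a1E] := @affinity_lik R p q tau N s1 r j W t1.
have [a2 ia2 a2E] := @affinity_lik R p q tau k s2 r j W t1.
have w0 z V := @joint_weight_gt0 k z V.
have e0 : 0 <= 1 - 4 * tau ^+ 2 by lra.
have aa : 1 - (16 * N%:R * tau ^+ 2) / 2 <= a1 * a2.
  rewrite (@le_trans _ _ ((1 - 4 * tau ^+ 2) ^+ (N + k)))//; last first.
    by rewrite exprD ler_pM// exprn_ge0.
  rewrite (le_trans _ (@bernoulli_le _ _ _ _))//; last by rewrite mulr_ge0.
  rewrite lerD2l lerN2 natrD.
  have : k%:R * tau ^+ 2 <= N%:R * tau ^+ 2 by rewrite ler_wpM2r// ler_nat.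
  move=> ?; lra.
have isq : (\int[P N \x P k]_z (Num.sqrt (joint_weight z W) * Num.sqrt (joint_weight z W'))%:E
    = (a1 * a2)%:E)%E.
  transitivity (\int[P N \x P k]_z (Num.sqrt (lik f1 W z.1 * lik f1 W' z.1) *
      Num.sqrt (lik f2 W z.2 * lik f2 W' z.2))%:E)%E.
    apply: eq_integral => z _; congr _%:E.
    by rewrite /joint_weight !sqrtrM//; ring.
  apply: (@integral_fst_snd _ _ _ _ _ (P N) (P k)
    (fun X => Num.sqrt (lik f1 W X * lik f1 W' X))
    (fun X => Num.sqrt (lik f2 W X * lik f2 W' X))) => //.
  - apply: measurable_fun_sqrt; last by apply: measurable_funM; exact: mlik1.
    by move=> X; exact: mulr_gt0.
  - apply: measurable_fun_sqrt; last by apply: measurable_funM; exact: mlik2.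
    by move=> X; exact: mulr_gt0.
pose A := (\int[P N \x P k]_z
  ((Num.sqrt (joint_weight z W) - Num.sqrt (joint_weight z W')) ^+ 2)%:E)%E.
have : (A + (2 * (a1 * a2))%:E = 2%:E)%E.
  have mg : measurable_fun setT (fun z : N.-tuple T * k.-tuple T =>
      Num.sqrt (joint_weight z W) * Num.sqrt (joint_weight z W')).
    by apply: measurable_funM; exact: msqrt.
  have isq2 : (\int[P N \x P k]_z
      (2 * (Num.sqrt (joint_weight z W) * Num.sqrt (joint_weight z W')))%:E =
      (2 * (a1 * a2))%:E)%E.
    rewrite [RHS]EFinM -isq; exact: integralZ_real.
  rewrite -isq2.
  have mA : measurable_fun setT (fun z : N.-tuple T * k.-tuple T =>
      (Num.sqrt (joint_weight z W) - Num.sqrt (joint_weight z W')) ^+ 2).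
    by apply: measurable_funX; apply: measurable_funB; exact: msqrt.
  have mg2 : measurable_fun setT (fun z : N.-tuple T * k.-tuple T =>
      2 * (Num.sqrt (joint_weight z W) * Num.sqrt (joint_weight z W'))).
    by apply: measurable_funM.
  rewrite /A -(integralD_real _ mA mg2); last 2 first.
  - by move=> z; exact: sqr_ge0.
  - by move=> z; rewrite !mulr_ge0.
  transitivity (\int[P N \x P k]_z (joint_weight z W + joint_weight z W')%:E)%E.
    apply: eq_integral => z _; congr _%:E.
    rewrite -[in RHS](sqr_sqrtr (ltW (w0 z W))) -[in RHS](sqr_sqrtr (ltW (w0 z W'))).
    ring.
  rewrite integralD_real; do ?[exact: measurable_joint_weight|by move=> z; exact/ltW].
  by rewrite !integral_joint_weight -EFinD.
rewrite -/A => AE; apply: (@adde_le_cancel_fin _ _ _ (2 * (a1 * a2))).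
rewrite AE -EFinD lee_fin; lra.
Qed.

(** The rows of the sign matrix are independent a posteriori, because each of
    them acts on its own coordinate of the second block. *)
Lemma joint_weight_rows k (z : N.-tuple T * k.-tuple T) :
  exists2 om : 'I_q -> S -> R, (forall r s, 0 < om r s) &
  forall W, joint_weight z W = \prod_r om r (W r).
Proof.
exists (fun r s =>
  (\prod_j row_density (lin (coef tau s1 s) (first_block (tnth z.1 j))) (tnth (tnth z.1 j) (rshift p r))) *
  (\prod_j row_density (lin (coef tau s2 s) (first_block (tnth z.2 j))) (tnth (tnth z.2 j) (rshift p r)))).
- by move=> r s; rewrite mulr_gt0// prodr_gt0// => i _; exact: row_density_gt0.
- move=> W; rewrite /joint_weight /lik /f1 /f2 /rows_density /block_density.
  by rewrite exchange_big/= [X in _ * X]exchange_big/= -big_split.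
Qed.

(** By independence of the rows, the posterior mean of an entry computed in its
    row is the posterior mean computed from the whole matrix. *)
Lemma tot_sqr_barycentre (om : 'I_q -> S -> R) r i : (forall r s, 0 < om r s) ->
  let w := fun W : J => \prod_r om r (W r) in
  tot w * (\sum_s om r s * coef tau s2 s i / \sum_s om r s) ^+ 2 =
  (\sum_W w W * coef tau s2 (W r) i) ^+ 2 / tot w.
Proof.
move=> om0 w; pose t r := \sum_s om r s.
have t0 r' : 0 < t r'.
  rewrite /t (bigD1 [ffun=> false])//= ltr_wpDr// sumr_ge0// => s _; exact: ltW.
have totE : tot w = \prod_r t r by rewrite /tot /t bigA_distr_bigA.
have tw0 : 0 < tot w by rewrite totE prodr_gt0.
pose cs := \sum_s om r s * coef tau s2 s i.
have E : (\sum_W w W * coef tau s2 (W r) i) = tot w * (cs / t r).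
  transitivity (\sum_(W : J) \prod_r' (om r' (W r') *
      (if r' == r then coef tau s2 (W r') i else 1))).
    apply: eq_bigr => W _; rewrite big_split/=; congr (_ * _).
    by rewrite -big_mkcond/= big_pred1_eq.
  rewrite -(bigA_distr_bigA (fun r' s => om r' s * (if r' == r then coef tau s2 s i else 1))).
  rewrite totE (bigD1 r)//= [in RHS](bigD1 r)//= eqxx.
  rewrite (eq_bigr t); last first.
    by move=> r' /negbTE r'r; apply: eq_bigr => s _; rewrite r'r mulr1.
  by rewrite -/cs; field; rewrite gt_eqF.
rewrite -mulr_suml -/cs -/(t r) E; field.
by rewrite !gt_eqF.
Qed.

(** Information about the permutation in one observation of the small sample.
    The first term is the energy of the posterior mean of the signs: with [b]
    the trivial bound by the energy of the signs is used, and without [b] the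
    posterior mean is small because [N] observations determine the signs badly. *)
Definition information_rate (b : bool) : R :=
  q%:R * (8 * p%:R * tau ^+ 2 * (if b then 1 else 16 * N%:R * tau ^+ 2) +
          512 * (p%:R * tau ^+ 2) ^+ 2).

Let gap (b : bool) k r i (z : N.-tuple T * k.-tuple T) : R :=
  if b then tot (joint_weight z) else hellinger_gap (flip r (s2 i)) z.

Let bnd (b : bool) k (z : N.-tuple T * k.-tuple T) : R :=
  \sum_(r < q) (\sum_(i < p) 8 * tau ^+ 2 * gap b r i z +
    512 * (p%:R * tau ^+ 2) ^+ 2 * tot (joint_weight z)).

Let mgap b k r i : measurable_fun setT (@gap b k r i).
Proof. by rewrite /gap; case: b => //; exact: measurable_hellinger_gap. Qed.

Let gap0 b k r i z : 0 <= @gap b k r i z.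
Proof. by rewrite /gap; case: b; [exact: ltW|exact: hellinger_gap_ge0]. Qed.

Let c8 : 0 <= 8 * tau ^+ 2.
Proof. exact: mulr_ge0 (ler0n R 8) (sqr_ge0 _). Qed.

Let c512 : 0 <= 512 * (p%:R * tau ^+ 2) ^+ 2.
Proof. exact: mulr_ge0 (ler0n R 512) (sqr_ge0 _). Qed.

Let mrow b k r : measurable_fun setT (fun z : N.-tuple T * k.-tuple T =>
  \sum_(i < p) 8 * tau ^+ 2 * gap b r i z).
Proof. by apply: measurable_sum => i; apply: measurable_funM => //; exact: mgap. Qed.

Let row0 b k r (z : N.-tuple T * k.-tuple T) :
  0 <= \sum_(i < p) 8 * tau ^+ 2 * gap b r i z.
Proof. by apply: sumr_ge0 => i _; apply: mulr_ge0 => //; exact: gap0. Qed.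

Let mbnd b k : measurable_fun setT (@bnd b k).
Proof.
apply: measurable_sum => r; apply: measurable_funD; first exact: mrow.
by apply: measurable_funM => //; exact: mtot.
Qed.

Let bnd0 b k z : 0 <= @bnd b k z.
Proof.
apply: sumr_ge0 => r _; apply: addr_ge0; first exact: row0.
by apply: mulr_ge0 => //; exact: ltW.
Qed.

Let integral_bnd b k : (k <= N)%N ->
  (\int[P N \x P k]_z (@bnd b k z)%:E <= (#|J|%:R * information_rate b)%:E)%E.
Proof.
move=> kN; rewrite integral_sum_real; last 2 first.
- move=> r; apply: measurable_funD; first exact: mrow.
  by apply: measurable_funM => //; exact: mtot.
- move=> r z; apply: addr_ge0; first exact: row0.
  by apply: mulr_ge0 => //; exact: ltW.
pose m : R := if b then 1 else 16 * N%:R * tau ^+ 2.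
pose e := p%:R * (8 * tau ^+ 2 * (#|J|%:R * m)) +
  512 * (p%:R * tau ^+ 2) ^+ 2 * #|J|%:R.
apply: (@le_trans _ _ (\sum_(r < q) e%:E)%E); last first.
  rewrite sumEFin sumr_const card_ord -[e *+ q]mulr_natl lee_fin.
  rewrite le_eqVlt; apply/orP; left; apply/eqP.
  rewrite /information_rate -/m /e; ring.
have mt : measurable_fun setT (fun z : N.-tuple T * k.-tuple T =>
    512 * (p%:R * tau ^+ 2) ^+ 2 * tot (joint_weight z)).
  by apply: measurable_funM => //; exact: mtot.
have mt0 (z : N.-tuple T * k.-tuple T) :
    0 <= 512 * (p%:R * tau ^+ 2) ^+ 2 * tot (joint_weight z).
  by apply: mulr_ge0 => //; exact: ltW.
apply: lee_sum => r _; rewrite (integralD_real _ (@mrow b k r) mt (@row0 b k r) mt0).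
rewrite /e EFinD; apply: leeD; last first.
  rewrite (integralZ_real _ (@mtot k) (fun z => ltW (tot0 z)) c512).
  by rewrite integral_tot_joint_weight -EFinM.
rewrite integral_sum_real; last 2 first.
- by move=> i; apply: measurable_funM => //; exact: mgap.
- by move=> i z; apply: mulr_ge0 => //; exact: gap0.
apply: (@le_trans _ _ (\sum_(i < p) (8 * tau ^+ 2 * (#|J|%:R * m))%:E)%E); last first.
  by rewrite sumEFin sumr_const card_ord lee_fin -[leLHS]mulr_natl.
apply: lee_sum => i _; rewrite (integralZ_real _ (@mgap b k r i) (@gap0 b k r i) c8).
rewrite [leRHS]EFinM; apply: lee_wpmul2l; first by rewrite lee_fin.
rewrite /gap /m {m e}; case: b.
  by rewrite integral_tot_joint_weight mulr1.
exact: integral_hellinger_gap.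
Qed.

Let divergence_bnd b k (z : N.-tuple T * k.-tuple T) :
  (divergence Gx f2 (joint_weight z) <= (bnd b z)%:E)%E.
Proof.
have [om om0 omE] := joint_weight_rows z.
have wE : joint_weight z = (fun W => \prod_r om r (W r)) by apply/funext.
have rho0 : 0 < p%:R * tau ^+ 2 by rewrite mulr_gt0 ?ltr0n// exprn_gt0.
rewrite wE; apply: (le_trans (@divergence_rows_density_le R p q S [ffun=> false]
  (coef tau s2) om (p%:R * tau ^+ 2) om0 rho0 tau1 _)).
  by move=> s; rewrite sqn_coef.
rewrite lee_fin mulr_sumr /bnd; apply: ler_sum => r _.
rewrite mulrDr [_ * (512 * _)]mulrC -wE lerD2r mulrCA /sqn !mulr_sumr.
apply: ler_sum => i _; rewrite -mulrA ler_wpM2l// wE tot_sqr_barycentre// -wE.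
rewrite ler_pdivrMr// (eq_bigr (fun W => joint_weight z W * coef tau s2 (W r) i));
  last by move=> W _; rewrite omE.
have w0 := joint_weight_gt0 z.
rewrite /gap; case: b.
- have CS := sum_cauchy_schwarz (fun W => Num.sqrt (joint_weight z W))
    (fun W => Num.sqrt (joint_weight z W) * coef tau s2 (W r) i).
  rewrite (eq_bigr (fun W : J => Num.sqrt (joint_weight z W) *
    (Num.sqrt (joint_weight z W) * coef tau s2 (W r) i))); last first.
    by move=> W _; rewrite mulrA -expr2 sqr_sqrtr// ltW.
  apply: (le_trans CS); rewrite le_eqVlt; apply/orP; left; apply/eqP.
  rewrite (eq_bigr (joint_weight z)); last by move=> W _; rewrite sqr_sqrtr// ltW.
  rewrite [X in _ * X](eq_bigr (fun W => tau ^+ 2 * joint_weight z W)); last first.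
    by move=> W _; rewrite exprMn coef_sqr sqr_sqrtr ?ltW// mulrC.
  by rewrite -mulr_sumr -/(tot _); ring.
- rewrite mulrAC; apply: odd_mean_sqr_le => //.
  + exact: flipK.
  + by move=> W; exact: coef_flip.
  + by move=> W; exact: coef_sqr.
Qed.

(** By the chain rule in the small sample, the divergence between the two
    marginal laws of the data is a sum over time of expected information gains,
    each of which is at most the rate: the barycentre of each row is bounded by
    Cauchy-Schwarz when [b] holds and by the Hellinger distance to the flipped
    matrix otherwise. *)
Lemma information_bound b k : (k <= N)%N ->
  (\int[P N \x P k]_z (kl (tot (joint_weight z)) (tot (fun W => lik f1 W z.1)))%:E <=
   (#|J|%:R * (k%:R * information_rate b))%:E)%E.
Proof.
move=> kN.
have tl0 (X : N.-tuple T) : 0 < tot (fun W => lik f1 W X).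
  by apply: tot_gt0 => [|W]; [exact: j0|exact: l1_gt0].
have mkl : measurable_fun setT (fun z : N.-tuple T * k.-tuple T =>
    kl (tot (joint_weight z)) (tot (fun W => lik f1 W z.1))).
  apply: measurable_kl => //; first exact: mtot.
  apply: measurable_sum => W.
  exact: (measurableT_comp (mlik1 W) measurable_fst).
have kl0 (z : N.-tuple T * k.-tuple T) :
    0 <= kl (tot (joint_weight z)) (tot (fun W => lik f1 W z.1)) by exact: kl_ge0.
rewrite fubini_tonelli1//=; last exact/measurable_EFinP.
apply: (@le_trans _ _ (\int[P N]_X \sum_(i < k) \int[P i]_Y (bnd b (X, Y))%:E)%E).
  apply: ge0_le_integral => //.
  - by move=> X _; apply: integral_ge0_real => Y; exact: kl0.
  - apply: (measurable_fun_fubini_tonelli_F (fun z : N.-tuple T * k.-tuple T =>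
      (kl (tot (joint_weight z)) (tot (fun W => lik f1 W z.1)))%:E)) => //.
    exact/measurable_EFinP.
  - apply: emeasurable_sum => i; apply: (measurable_fun_fubini_tonelli_F
      (fun z : N.-tuple T * i.-tuple T => (bnd b z)%:E)).
    + by apply/measurable_EFinP; exact: mbnd.
    + by move=> z; rewrite lee_fin.
  - move=> X _; rewrite /fubini_F/=.
    rewrite (@kl_chain_rule _ _ _ Gx J j0 f2 f2_gt0 mf2 if2 k
      (fun W => lik f1 W X) (fun W => l1_gt0 W X)).
    apply: lee_sum => i _; apply: ge0_le_integral => //.
    + by move=> Y _; apply: (divergence_ge0 Gx j0 f2_gt0) => W; exact: mulr_gt0.
    + exact: (measurable_divergence_lik Gx j0 f2_gt0 mf2 (fun W => l1_gt0 W X)).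
    + apply/measurable_EFinP.
      exact: (measurableT_comp (@mbnd b i) (measurable_pair1 X)).
    + by move=> Y _; exact: (divergence_bnd b (X, Y)).
rewrite ge0_integral_sum//.
- apply: (@le_trans _ _ (\sum_(i < k) (#|J|%:R * information_rate b)%:E)%E); last first.
    by rewrite sumEFin sumr_const card_ord lee_fin -[leLHS]mulr_natl [leRHS]mulrCA.
  apply: lee_sum => i _; have iN : (i <= N)%N by rewrite (leq_trans _ kN)// ltnW.
  rewrite (le_trans _ (integral_bnd b iN))// fubini_tonelli1//.
    by apply/measurable_EFinP; exact: mbnd.
  by move=> z; rewrite lee_fin.
- move=> i; apply: (measurable_fun_fubini_tonelli_F
      (fun z : N.-tuple T * i.-tuple T => (bnd b z)%:E)).
  + by apply/measurable_EFinP; exact: mbnd.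
  + by move=> z; rewrite lee_fin.
- by move=> i X _; apply: integral_ge0_real => Y.
Qed.

End information.

(** * Averages over random signs *)

Section random_signs.
Context {R : realType} (p q : nat).
Let S := {ffun 'I_p -> bool}.
Let J := {ffun 'I_q -> S}.
Implicit Types (W : J).

Definition sgn W r i : R := (-1) ^+ W r i.

Lemma sgn_sqr W r i : sgn W r i ^+ 2 = 1.
Proof. exact: sqrr_sign. Qed.

Lemma sgn_flip r i W r' i' :
  sgn (flip r i W) r' i' = if (r' == r) && (i' == i) then - sgn W r' i' else sgn W r' i'.
Proof. by rewrite /sgn !ffunE; case: (_ && _); rewrite //= signrN. Qed.

(** Averaging over the sign [e] leaves the other factors unchanged, and replaces
    the factor of [e] by its mean over that sign, at most [kap e]; one factor is
    removed at a time. *)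
Lemma sum_prod_flip (l : seq ('I_q * 'I_p)) (g : 'I_q * 'I_p -> J -> R)
    (kap : 'I_q * 'I_p -> R) :
  uniq l -> (forall e W, 0 <= g e W) -> (forall e, 0 <= kap e) ->
  (forall e W, e \in l -> g e W + g e (flip e.1 e.2 W) <= 2 * kap e) ->
  (forall e e' W, e \in l -> e' \in l -> e != e' -> g e (flip e'.1 e'.2 W) = g e W) ->
  \sum_W \prod_(e <- l) g e W <= #|J|%:R * \prod_(e <- l) kap e.
Proof.
move=> + g0 k0; elim: l => [_ _ _|e l IH /= /andP[el ul] hk hi].
  rewrite big_nil mulr1 -sumr_const; apply: ler_sum => W _.
  by rewrite big_nil.
have {}IH : \sum_W \prod_(e <- l) g e W <= #|J|%:R * \prod_(e <- l) kap e.
  apply: IH => // [e' W e'l|e1 e2 W e1l e2l].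
    by apply: hk; rewrite inE e'l orbT.
  by apply: hi; rewrite inE ?e1l ?e2l orbT.
pose P W := \prod_(e <- l) g e W.
have P0 W : 0 <= P W by apply: prodr_ge0.
have PE W : P (flip e.1 e.2 W) = P W.
  rewrite /P !big_seq; apply: eq_bigr => e' e'l; apply: hi.
  - by rewrite inE e'l orbT.
  - by rewrite inE eqxx.
  - by apply: contraNneq el => <-.
have E : \sum_W g e W * P W = \sum_W g e (flip e.1 e.2 W) * P W.
  rewrite (reindex_inj (inv_inj (flipK e.1 e.2))) /=.
  by apply: eq_bigr => W _; rewrite PE.
rewrite big_cons mulrCA.
under eq_bigr do rewrite big_cons.
apply: le_trans (ler_wpM2l (k0 e) IH).
have : 2 * \sum_W g e W * P W <= 2 * (kap e * \sum_W P W).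
  rewrite [2 * _]mulr_natl mulr2n {2}E -big_split/= mulrA mulr_sumr.
  apply: ler_sum => W _; rewrite -mulrDl ler_wpM2r// hk// inE eqxx//.
by rewrite ler_pM2l.
Qed.

(** The exponential Markov inequality for the uniform law on sign matrices. *)
Lemma card_le_exp (E : pred J) (F : J -> R) : (forall W, 0 <= F W) ->
  (forall W, E W -> 1 <= F W) -> #|E|%:R <= \sum_W F W.
Proof.
move=> F0 F1; rewrite -sum1_card natr_sum big_mkcond/=.
by apply: ler_sum => W _; case: ifP => // /F1.
Qed.

End random_signs.

Section exp_bounds.
Context {R : realType}.

Lemma expR1_ge2 : 2 <= expR 1 :> R.
Proof. by have := @expR_ge1Dx R 1; lra. Qed.

Lemma expRN1_le : expR (- 1) <= 2^-1 :> R.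
Proof. by rewrite expRN lef_pV2 ?posrE ?expR_gt0// expR1_ge2. Qed.

Lemma expR_cosh_le (a : R) : expR a + expR (- a) <= 2 * expR (4 * a ^+ 2).
Proof.
have a2 := sqr_ge0 a.
have h1 := expR_le_quadratic a; have h2 := expR_le_quadratic (- a).
rewrite normrN sqrrN in h2.
suff h : 1 + a ^+ 2 * expR `|a| <= expR (4 * a ^+ 2) by lra.
have [a1|a1] := leP `|a| 1.
  have e4 : expR `|a| <= 4.
    apply: (@le_trans _ _ (expR 1)); first by rewrite ler_expR.
    have h := @expR_ge1Dx R (- 2^-1).
    rewrite [X in expR X](_ : (1 : R) = 2 * 2^-1); last by lra.
    rewrite expRM_natl.
    have e0 := @expR_gt0 R (2^-1).
    have : expR (2^-1) <= 2 :> R.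
      rewrite expRN in h; have h3 : 2^-1 <= (expR (2^-1))^-1 :> R by lra.
      by rewrite lef_pV2 ?posrE in h3.
    move=> h4; rewrite [leRHS](_ : (4 : R) = 2 ^+ 2); last by ring.
    by rewrite ler_pXn2r// nnegrE// ltW.
  apply: le_trans (expR_ge1Dx _); rewrite lerD2l [4 * _]mulrC.
  exact: ler_wpM2l.
have h3 : expR `|a| <= expR (a ^+ 2).
  rewrite ler_expR -[a ^+ 2]real_normK ?num_real// expr2 ler_peMl// ltW//.
have -> : 4 * a ^+ 2 = 3 * a ^+ 2 + a ^+ 2 by ring.
rewrite expRD.
have h4 := @expR_ge1Dx R (3 * a ^+ 2).
have e1 : 1 <= expR (a ^+ 2) by rewrite -[leLHS]expR0 ler_expR.
have h5 : (1 + 3 * a ^+ 2) * expR (a ^+ 2) <= expR (3 * a ^+ 2) * expR (a ^+ 2).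
  by rewrite ler_wpM2r ?expR_ge0.
have h6 : a ^+ 2 * expR `|a| <= a ^+ 2 * expR (a ^+ 2) by rewrite ler_wpM2l.
have h7 : 0 <= a ^+ 2 * expR (a ^+ 2) by rewrite mulr_ge0 ?expR_ge0.
lra.
Qed.

End exp_bounds.

(** * Operator norm of a random sign matrix *)

Section integer_points.
Context {R : realType}.

Lemma sum_geometric_half n : \sum_(k < n) (2^-1) ^+ k <= 2 :> R.
Proof.
suff -> : \sum_(k < n) (2^-1) ^+ k = 2 - 2 * (2^-1) ^+ n :> R.
  by rewrite gerBl mulr_ge0// exprn_ge0.
elim: n => [|n IH]; first by rewrite big_ord0 expr0; lra.
by rewrite big_ord_recr/= IH exprS; field.
Qed.

(** Vectors of [n] integers between [-M] and [M], shifted to be natural numbers. *)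
Definition intvec n M := {ffun 'I_n -> 'I_(M + M.+1)}.
Definition ival n M (z : intvec n M) i : R := (z i)%:R - M%:R.

(** When the squares of integers have sum at most [L], so have their absolute
    values; hence the count is at most [2 ^ L] times a product of geometric
    series. *)
Lemma card_intvec_le n M (L : nat) :
  #|[pred z : intvec n M | \sum_i ival z i ^+ 2 <= L%:R]|%:R <= 2 ^+ L * 3 ^+ n :> R.
Proof.
pose dz (k : nat) : nat := (k - M + (M - k))%N.
have dz2 (k : nat) : (dz k)%:R <= (k%:R - M%:R) ^+ 2 :> R.
  have [kM|Mk] := leqP k M.
    have -> : dz k = (M - k)%N by rewrite /dz (eqP kM).
    rewrite -sqrrN opprB -natrB// -natrX ler_nat.
    by case: (M - k)%N => // j; rewrite -mulnn leq_pmulr.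
  have Mk' := ltnW Mk.
  have -> : dz k = (k - M)%N by rewrite /dz (eqP Mk') addn0.
  rewrite -natrB// -natrX ler_nat.
  by case: (k - M)%N => // j; rewrite -mulnn leq_pmulr.
pose h (k : nat) : R := (2^-1) ^+ dz k.
have h0 k : 0 <= h k by rewrite exprn_ge0.
have hsum : \sum_(k < M + M.+1) h k <= 3.
  rewrite big_split_ord/=.
  have -> : \sum_(i < M) h i = 2^-1 * \sum_(i < M) (2^-1) ^+ i.
    rewrite (reindex_inj rev_ord_inj)/= mulr_sumr; apply: eq_bigr => i _.
    rewrite -exprS /h; congr (_ ^+ _); rewrite /dz.
    by have := ltn_ord i; lia.
  have -> : \sum_(i < M.+1) h (M + i)%N = \sum_(i < M.+1) (2^-1) ^+ i.
    by apply: eq_bigr => i _; rewrite /h; congr (_ ^+ _); rewrite /dz; lia.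
  have := sum_geometric_half M; have := sum_geometric_half M.+1; lra.
rewrite -sum1_card natr_sum.
apply: (@le_trans _ _ (\sum_(z : intvec n M) 2 ^+ L * \prod_i h (z i))).
  rewrite big_mkcond/=; apply: ler_sum => z _; rewrite inE.
  case: ifP => hz; last by rewrite mulr_ge0// ?exprn_ge0// prodr_ge0.
  have dL : (\sum_i dz (z i) <= L)%N.
    rewrite -(ler_nat R) natr_sum (le_trans _ hz)//.
    by apply: ler_sum => i _; exact: dz2.
  rewrite -expr_sum exprVn ler_pdivlMr ?exprn_gt0// mul1r.
  by rewrite ler_weXn2l// ler1n.
rewrite -mulr_sumr ler_wpM2l ?exprn_ge0//.
rewrite -(bigA_distr_bigA (fun (_ : 'I_n) (k : 'I_(M + M.+1)) => h k))/=.
rewrite prodr_const card_ord lerXn2r// nnegrE// sumr_ge0//.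
Qed.

(** Every coordinate is rounded in the direction of the sign of [l]. *)
Lemma round_up n M (l X : 'I_n -> R) : (forall i, `|X i| + 1 <= M%:R) ->
  exists2 z : intvec n M, forall i, `|ival z i| <= `|X i| + 1 &
    \sum_i l i * X i <= \sum_i l i * ival z i.
Proof.
move=> XM.
have step i : exists k : 'I_(M + M.+1), `|(k%:R - M%:R) : R| <= `|X i| + 1 /\
    l i * X i <= l i * (k%:R - M%:R).
  have := XM i; rewrite -lerBrDr => h; have := h; rewrite ler_norml => /andP[h1 h2].
  pose Y := X i + M%:R; have Y0 : 0 <= Y by rewrite /Y; lra.
  have /andP[t1 t2] := truncn_itv Y0; rewrite -natr1 in t2.
  have nX := ler_norm (X i); have nX' := ler_norm (- X i); rewrite normrN in nX'.
  have tM : (Num.truncn Y < M + M)%N.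
    rewrite -(ltr_nat R) natrD (le_lt_trans t1)// /Y; lra.
  have [l0|l0] := leP 0 (l i).
    have kM : ((Num.truncn Y).+1 < M + M.+1)%N by rewrite addnS ltnS.
    exists (Ordinal kM) => /=; rewrite -natr1; split.
      rewrite ler_norml; apply/andP; split; rewrite /Y in t1 t2; lra.
    by rewrite ler_wpM2l//; rewrite /Y in t1 t2; lra.
  have kM : (Num.truncn Y < M + M.+1)%N by rewrite addnS ltnS ltnW.
  exists (Ordinal kM) => /=; split.
    rewrite ler_norml; apply/andP; split; rewrite /Y in t1 t2; lra.
  apply: ler_wnM2l; first exact: ltW.
  by rewrite /Y in t1 t2; lra.
have [f hf] := fin_all_exists step.
exists [ffun i => f i]; first by move=> i; rewrite /ival ffunE; case: (hf i).
by apply: ler_sum => i _; rewrite /ival ffunE; case: (hf i).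
Qed.

End integer_points.

Section operator_norm_signs.
Context {R : realType} (p q : nat).
Let J := {ffun 'I_q -> {ffun 'I_p -> bool}}.
Implicit Types (W : J).

Definition bil W (y : 'I_q -> R) (x : 'I_p -> R) : R :=
  \sum_r \sum_i y r * sgn W r i * x i.

Lemma bilZ W a b y x : bil W (fun r => a * y r) (fun i => b * x i) = a * b * bil W y x.
Proof.
rewrite /bil mulr_sumr; apply: eq_bigr => r _; rewrite mulr_sumr.
by apply: eq_bigr => i _; ring.
Qed.

(** Operator norm at most [80 * sqrt q], as a bound on the bilinear form. *)
Definition op_bounded W : Prop := forall y x, sqn y <= 1 -> sqn x <= 1 ->
  bil W y x <= 80 * Num.sqrt q%:R.

Hypotheses (q0 : (0 < q)%N) (pq : (p <= q)%N).

Let M := q.+1.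
Let heavy (z : @intvec q M) (x : @intvec p M) : pred J :=
  [pred W | (80 * q%:R * Num.sqrt q%:R < bil W (ival z) (ival x)) ].
Let short n : pred (@intvec n M) := [pred z | \sum_i ival z i ^+ 2 <= (4 * q)%:R :> R].

(** The integer points of norm at most [2 * sqrt q] serve as a net: scaled by
    [sqrt q], both unit vectors can be rounded one after the other to such points
    without decreasing the bilinear form. *)
Lemma op_bounded_of_integer_points W :
  (forall z x, short z -> short x -> ~~ heavy z x W) -> op_bounded W.
Proof.
move=> H y x y1 x1; rewrite leNgt; apply/negP => hlt.
set s := Num.sqrt q%:R in hlt.
have s0 : 0 <= s by exact: sqrtr_ge0.
have s2 : s ^+ 2 = q%:R by rewrite sqr_sqrtr.
have q1 : 1 <= q%:R :> R by rewrite ler1n.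
have sq : s <= q%:R.
  by rewrite -s2 expr2 ler_peMl// -[1]sqrtr1 ler_wsqrtr.
have coord n (w : 'I_n -> R) : sqn w <= 1 -> forall i, `|s * w i| + 1 <= M%:R.
  move=> w1 i; rewrite /M -natr1 lerD2r normrM ger0_norm//.
  have wi : `|w i| <= 1.
    rewrite -(@ler_pXn2r _ 2)// ?nnegrE// expr1n real_normK ?num_real//.
    by apply: le_trans w1; rewrite /sqn (bigD1 i)//= lerDl sumr_ge0// => j _; exact: sqr_ge0.
  by rewrite (le_trans _ sq)// ler_piMr.
have shortP n (w : 'I_n -> R) (z : intvec n M) : (n <= q)%N -> sqn w <= 1 ->
    (forall i, `|ival z i| <= `|s * w i| + 1) -> short z.
  move=> nq w1 hz; rewrite /short inE.
  apply: (@le_trans _ _ (\sum_i (2 * s ^+ 2 * w i ^+ 2 + 2))).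
    apply: ler_sum => i _; rewrite -[leLHS]real_normK ?num_real//.
    apply: (@le_trans _ _ ((`|s * w i| + 1) ^+ 2)).
      by rewrite ler_pXn2r// nnegrE// addr_ge0.
    have e : `|s * w i| ^+ 2 = s ^+ 2 * w i ^+ 2.
      by rewrite real_normK ?num_real// exprMn.
    have := sqr_ge0 (`|s * w i| - 1).
    rewrite sqrrB sqrrD e expr1n mulr1 => ?; lra.
  rewrite big_split/= -mulr_sumr -/(sqn w) sumr_const card_ord s2.
  have h1 : q%:R * sqn w <= q%:R :> R by rewrite ler_piMr.
  have h2 : (n%:R : R) <= q%:R by rewrite ler_nat.
  rewrite -[2 *+ n]mulr_natl natrM; lra.
have [z hz1 hz2] := round_up (fun r => \sum_i sgn W r i * (s * x i)) (coord _ y y1).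
have [v hv1 hv2] := round_up (fun i => \sum_r ival z r * sgn W r i) (coord _ x x1).
have : ~~ heavy z v W by apply: H; [exact: shortP y1 hz1|exact: shortP x1 hv1].
rewrite /heavy/= -leNgt => hh.
have e1 : s ^+ 2 * bil W y x <= bil W (ival z) (fun i => s * x i).
  rewrite expr2 -bilZ /bil.
  rewrite (eq_bigr (fun r => (\sum_i sgn W r i * (s * x i)) * (s * y r))); last first.
    by move=> r _; rewrite mulr_suml; apply: eq_bigr => i _; ring.
  apply: (le_trans hz2); rewrite le_eqVlt; apply/orP; left; apply/eqP.
  by apply: eq_bigr => r _; rewrite mulr_suml; apply: eq_bigr => i _; ring.
have e2 : bil W (ival z) (fun i => s * x i) <= bil W (ival z) (ival v).
  rewrite /bil exchange_big/=.
  rewrite (eq_bigr (fun i => (\sum_r ival z r * sgn W r i) * (s * x i))); last first.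
    by move=> i _; rewrite mulr_suml; apply: eq_bigr => r _; ring.
  apply: (le_trans hv2); rewrite le_eqVlt; apply/orP; left; apply/eqP.
  by rewrite exchange_big/=; apply: eq_bigr => i _; rewrite mulr_suml.
have : s ^+ 2 * (80 * s) < s ^+ 2 * bil W y x.
  by rewrite ltr_pM2l// s2 ltr0n.
have := le_trans e1 (le_trans e2 hh); rewrite -/s s2 => h3 h4; lra.
Qed.

(** The bilinear form at a fixed pair of points is a sum of independent signs, so
    its upper tail is sub-Gaussian. *)
Lemma card_heavy z x : short z -> short x ->
  #|heavy z x|%:R <= #|J|%:R * expR (- (16 * q%:R)) :> R.
Proof.
move=> hz hx; rewrite /short/= in hz hx.
set s := Num.sqrt (q%:R : R).
have q1 : 0 < q%:R :> R by rewrite ltr0n.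
have s0 : 0 < s by rewrite sqrtr_gt0.
have s2 : s ^+ 2 = q%:R by rewrite sqr_sqrtr ?ltW.
(* the parameter that optimises the exponential moment, up to a constant *)
pose lam : R := (4 * s)^-1.
have lam2 : lam ^+ 2 = (16 * q%:R)^-1 by rewrite /lam exprVn -s2; congr _^-1; ring.
have lam0 : 0 < lam by rewrite invr_gt0 mulr_gt0.
pose a (e : 'I_q * 'I_p) : R := lam * ival z e.1 * ival x e.2.
pose g (e : 'I_q * 'I_p) W : R := expR (a e * sgn W e.1 e.2).
pose F W : R := expR (- (20 * q%:R)) * \prod_(e : 'I_q * 'I_p) g e W.
have FE W : F W = expR (lam * bil W (ival z) (ival x) - 20 * q%:R).
  rewrite /F expRD mulrC; congr (_ * _); rewrite -[LHS]expR_sum; congr (expR _).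
  rewrite /bil pair_big/= mulr_sumr; apply: eq_bigr => -[r i] _.
  by rewrite /a/=; ring.
apply: (@le_trans _ _ (\sum_W F W)).
  apply: card_le_exp => W; first by rewrite FE expR_ge0.
  rewrite /heavy/= => hW; rewrite FE -[leLHS]expR0 ler_expR subr_ge0.
  have := ler_wpM2l (ltW lam0) (ltW hW); rewrite -/s; apply: le_trans.
  rewrite /lam le_eqVlt; apply/orP; left; apply/eqP; field.
  by rewrite gt_eqF.
rewrite -mulr_sumr.
apply: (@le_trans _ _ (expR (- (20 * q%:R)) * (#|J|%:R *
    \prod_(e : 'I_q * 'I_p) expR (4 * a e ^+ 2)))).
  apply: ler_wpM2l; first exact: expR_ge0.
  apply: sum_prod_flip.
  - exact: index_enum_uniq.
  - by move=> e W; exact: expR_ge0.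
  - by move=> e; exact: expR_ge0.
  - move=> e W _; rewrite /g sgn_flip !eqxx/= mulrN.
    rewrite /sgn; case: (W e.1 e.2); rewrite ?expr1 ?expr0 ?mulrN1 ?mulr1 ?opprK.
      by rewrite addrC expR_cosh_le.
    exact: expR_cosh_le.
  - move=> e e' W _ _ ee'; rewrite /g sgn_flip; case: ifP => // /andP[/eqP h1 /eqP h2].
    by case/eqP: ee'; case: e e' h1 h2 => ? ? [? ?] /= -> ->.
rewrite mulrCA ler_wpM2l// -expR_sum -expRD ler_expR.
have -> : \sum_(e : 'I_q * 'I_p) 4 * a e ^+ 2 =
    4 * lam ^+ 2 * ((\sum_r ival z r ^+ 2) * \sum_i ival x i ^+ 2).
  rewrite mulr_suml mulr_sumr.
  under [RHS]eq_bigr do rewrite !mulr_sumr.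
  by rewrite pair_big/=; apply: eq_bigr => -[r i] _; rewrite /a/=; ring.
have h : (\sum_r ival z r ^+ 2) * (\sum_i ival x i ^+ 2) <= (4 * q)%:R * (4 * q)%:R :> R.
  by rewrite ler_pM// sumr_ge0// => i _; exact: sqr_ge0.
have c0 : 0 <= 4 * lam ^+ 2 by rewrite mulr_ge0// sqr_ge0.
have := ler_wpM2l c0 h; rewrite [X in _ <= X](_ : _ = 4 * q%:R); last first.
  by rewrite lam2 natrM; field; rewrite gt_eqF.
move=> h2; lra.
Qed.

(** Union bound over the pairs of integer points, whose number is exponential in
    [q] with a smaller rate than that of the tail. *)
Lemma card_not_op_bounded :
  #|[pred W | ~~ `[< op_bounded W >]]|%:R <= #|J|%:R / 16 :> R.
Proof.
pose zz := [pred zx : @intvec q M * @intvec p M | short zx.1 && short zx.2].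
apply: (@le_trans _ _ (\sum_(zx in zz) #|heavy zx.1 zx.2|%:R)).
  apply: (@le_trans _ _ (\sum_W \sum_(zx in zz) (heavy zx.1 zx.2 W)%:R)); last first.
    rewrite exchange_big/=; apply: ler_sum => zx _.
    rewrite -sum1_card natr_sum [leRHS]big_mkcond/=; apply: ler_sum => W _.
    by rewrite -[W \in _]/(heavy zx.1 zx.2 W); case: (heavy _ _ _).
  apply: card_le_exp => W; first by rewrite sumr_ge0.
  rewrite inE => hW; rewrite -natr_sum ler1n lt0n sum_nat_eq0.
  apply: contraNN hW => /forallP hn; apply/asboolP.
  apply: op_bounded_of_integer_points => z x hz hx.
  have /implyP := hn (z, x); rewrite inE/= hz hx => /(_ isT).
  by rewrite eqb0.
have q1 : 1 <= q%:R :> R by rewrite ler1n.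
apply: (@le_trans _ _ (\sum_(zx in zz) #|J|%:R * expR (- (16 * q%:R)))).
  by apply: ler_sum => -[z x]; rewrite inE => /andP[hz hx]; exact: card_heavy.
rewrite sumr_const -[leLHS]mulr_natr -mulrA ler_wpM2l//.
have cz : #|zz|%:R <= (2 ^+ (4 * q) * 3 ^+ q) * (2 ^+ (4 * q) * 3 ^+ p) :> R.
  have -> : #|zz| = (#|short (n := q)| * #|short (n := p)|)%N by rewrite -cardX.
  by rewrite natrM ler_pM//; exact: card_intvec_le.
have e2 : 2 <= expR 1 :> R := expR1_ge2.
have cz2 : #|zz|%:R <= expR (12 * q%:R) :> R.
  apply: (le_trans cz); apply: (@le_trans _ _ ((2 ^+ (4 * q) * 3 ^+ q) ^+ 2)).
    rewrite expr2 ler_wpM2l// ?mulr_ge0 ?exprn_ge0//.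
    by rewrite ler_wpM2l ?exprn_ge0// ler_weXn2l// ler1n.
  have -> : (2 ^+ (4 * q) * 3 ^+ q) ^+ 2 = (2 ^+ 8 * 3 ^+ 2) ^+ q :> R.
    have e (x : R) a b : (x ^+ a) ^+ b = (x ^+ b) ^+ a by rewrite -!exprM mulnC.
    by rewrite exprMn [RHS]exprMn (e 3) exprM (e 2 8%N) -!exprM; congr (_ ^+ _ * _); lia.
  rewrite expRM_natr lerXn2r// ?nnegrE ?expR_ge0 ?mulr_ge0 ?exprn_ge0//.
  have -> : expR 12 = expR 1 ^+ 8 * expR 1 ^+ 4 :> R.
    by rewrite -!expRM_natl -expRD !mulr1 -natrD.
  apply: ler_pM; rewrite ?exprn_ge0//.
    by rewrite lerXn2r ?nnegrE ?expR_ge0// (le_trans _ e2).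
  apply: (@le_trans _ _ (2 ^+ 4)).
    by rewrite -!natrX ler_nat.
  by rewrite lerXn2r ?nnegrE ?expR_ge0// (le_trans _ e2).
apply: (@le_trans _ _ (expR (- 4))).
  apply: (@le_trans _ _ (expR (- (16 * q%:R)) * expR (12 * q%:R))).
    by rewrite ler_wpM2l ?expR_ge0.
  by rewrite -expRD ler_expR; lra.
rewrite (_ : - 4 = 4%:R * (- 1)); last by rewrite mulrN1.
rewrite expRM_natl (_ : 16^-1 = (2^-1) ^+ 4 :> R); last by field.
by rewrite lerXn2r// ?nnegrE ?expR_ge0// expRN1_le.
Qed.

End operator_norm_signs.

(** * Rigidity of a random sign matrix *)

Section rigidity.
Context {R : realType} (p q : nat).
Let J := {ffun 'I_q -> {ffun 'I_p -> bool}}.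
Implicit Types (W : J) (s : 'S_(p + q)).

(** The leading part, up to a factor, of the covariance of two distinct
    coordinates; the rest is an entry of the Gram matrix of the rows. *)
Definition cross W (x y : 'I_(p + q)) : R :=
  match fintype.split x, fintype.split y with
  | inl i, inr r => sgn W r i
  | inr r, inl i => sgn W r i
  | _, _ => 0
  end.

Lemma cross_lr W i r : cross W (lshift q i) (rshift p r) = sgn W r i.
Proof.
by rewrite /cross -[lshift q i]/(unsplit (inl i)) -[rshift p r]/(unsplit (inr r)) !unsplitK.
Qed.

Lemma cross_cases W x y : [\/ cross W x y = 0, cross W x y = 1 | cross W x y = -1].
Proof.
have sg r i : [\/ sgn W r i = 0 :> R, sgn W r i = 1 :> R | sgn W r i = -1 :> R].
  by rewrite /sgn; case: (W r i); [constructor 3|constructor 2]; rewrite ?expr1 ?expr0.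
rewrite /cross; case: (fintype.split x) => a; case: (fintype.split y) => b //;
  by constructor.
Qed.

Lemma cross_flip r i W x y : x != lshift q i -> y != lshift q i ->
  cross (flip r i W) x y = cross W x y.
Proof.
move=> xi yi; rewrite /cross.
case: (fintype.splitP x) => a xa; case: (fintype.splitP y) => b yb //;
  rewrite sgn_flip; case: ifP => // /andP[_ /eqP ai].
- by case/eqP: xi; apply/val_inj; rewrite /= xa ai.
- by case/eqP: yi; apply/val_inj; rewrite /= yb ai.
Qed.

Definition discrepancy s W : R :=
  \sum_r \sum_i (cross W (s (lshift q i)) (s (rshift p r)) - sgn W r i) ^+ 2.

Definition moved s : {set 'I_p} := [set i | s (lshift q i) != lshift q i]%SET.

(** A maximal set of moved points that is disjoint from its image is large: any
    other moved point is sent to it or comes from it, and so the set, its image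
    and its inverse image cover all the moved points, unless the set has already
    reached half of [q]. *)
Lemma exists_displaced s : (2 <= q)%N -> (p <= q)%N -> (p <= 2 * #|moved s|)%N ->
  exists I : {set 'I_p}, [/\ (2 * #|I| <= q)%N, (p <= 6 * #|I|)%N &
    forall i j, i \in I -> j \in I -> s (lshift q i) != lshift q j].
Proof.
move=> q2 pq hm.
(* the size constraint keeps half of the rows available below *)
pose ok (I : {set 'I_p}) := [&& I \subset moved s, (2 * #|I| <= q)%N &
  [forall i in I, forall j in I, s (lshift q i) != lshift q j]].
have ok0 : ok finset.set0.
  apply/and3P; split; rewrite ?finset.sub0set ?cards0//.
  by apply/forall_inP => i; rewrite inE.
have [I /and3P[IM Iq /forall_inP Id] Imax] := @arg_maxnP _ _ ok (fun I => #|I|) ok0.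
exists I; split=> //; last by move=> i j /Id /forall_inP; apply.
have [big|small] := leqP q (2 * #|I|).+1; first by lia.
suff : (#|moved s| <= 3 * #|I|)%N by lia.
pose A := [set i | [exists j in I, s (lshift q i) == lshift q j]]%SET.
pose B := [set i | [exists j in I, s (lshift q j) == lshift q i]]%SET.
have cA : (#|A| <= #|I|)%N.
  pose f (j : 'I_p) := (s^-1)%g (lshift q j).
  rewrite -(card_imset (mem A) (@lshift_inj p q)) -(card_imset (mem I) (@lshift_inj p q)).
  rewrite -(card_imset (mem [set lshift q x | x in I]%SET) (@perm_inj _ s^-1%g)).
  apply: subset_leq_card; apply/fintype.subsetP => x /imsetP[i + ->].
  rewrite inE => /exists_inP[j jI /eqP sij].
  by apply/imsetP; exists (lshift q j); [exact: finset.imset_f|rewrite -sij permK].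
have cB : (#|B| <= #|I|)%N.
  rewrite -(card_imset (mem B) (@lshift_inj p q)) -(card_imset (mem I) (@lshift_inj p q)).
  rewrite -(card_imset (mem [set lshift q x | x in I]%SET) (@perm_inj _ s)).
  apply: subset_leq_card; apply/fintype.subsetP => x /imsetP[i + ->].
  rewrite inE => /exists_inP[j jI /eqP sji].
  by apply/imsetP; exists (lshift q j); [exact: finset.imset_f|rewrite sji].
suff sub : moved s \subset I :|: A :|: B.
  apply: (leq_trans (subset_leq_card sub)).
  apply: (leq_trans (leq_card_setU _ _)).
  apply: leq_trans (leq_add (leq_trans (leq_card_setU I A) (leq_add (leqnn _) cA)) cB) _.
  lia.
apply/fintype.subsetP => j jM; apply/negPn/negP; rewrite !inE !negb_or => /andP[/andP[jI jA] jB].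
have : ok (j |: I)%SET.
  apply/and3P; split.
  - by rewrite finset.subUset finset.sub1set jM.
  - by rewrite cardsU1 jI; lia.
  - apply/forall_inP => i1 /finset.setU1P hi1; apply/forall_inP => i2 /finset.setU1P hi2.
    case: hi1 => [->|i1I]; case: hi2 => [->|i2I].
    + by rewrite inE in jM.
    + apply: contraNN jA => h; apply/exists_inP; exists i2 => //.
    + apply: contraNN jB => h; apply/exists_inP; exists i1 => //.
    + by move/forall_inP : (Id _ i1I); apply.
by move=> /Imax; rewrite cardsU1 jI; lia.
Qed.

(** On the rectangle formed by a displaced set of columns and the rows not sent
    into that set, the permuted entries do not depend on the entries that they
    are compared with. So each pair contributes an independent error, and the
    discrepancy has an exponential lower tail. *)
Lemma card_discrepancy_le s (th : R) :
  (2 <= q)%N -> (p <= q)%N -> (p <= 2 * #|moved s|)%N ->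
  96 * th <= (p * q)%:R ->
  #|[pred W | discrepancy s W <= th]|%:R <=
    #|J|%:R * expR (- ((p * q)%:R / 96)) :> R.
Proof.
move=> q2 pq hm hth.
have [I [Iq Ip Id]] := exists_displaced q2 pq hm.
(* rows whose image avoids the displaced columns *)
pose V := [set r | [forall i in I, s (rshift p r) != lshift q i]]%SET.
have cV : (q <= #|V| + #|I|)%N.
  have : (#|~: V| <= #|I|)%N.
    rewrite -(card_imset (mem (~: V)) (@rshift_inj p q)) -(card_imset (mem I) (@lshift_inj p q)).
    rewrite -(card_imset (mem [set lshift q x | x in I]%SET) (@perm_inj _ s^-1%g)).
    apply: subset_leq_card; apply/fintype.subsetP => x /imsetP[r + ->].
    rewrite !inE negb_forall_in => /exists_inP[i iI]; rewrite negbK => /eqP sri.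
    by apply/imsetP; exists (lshift q i); [exact: finset.imset_f|rewrite -sri permK].
  by have := cardsC V; rewrite card_ord; lia.
pose l := [seq e <- index_enum ('I_q * 'I_p)%type | (e.1 \in V) && (e.2 \in I)].
have sl : size l = (#|V| * #|I|)%N.
  rewrite -finset.cardsX cardE; apply: perm_size; apply: uniq_perm.
  - by rewrite filter_uniq// index_enum_uniq.
  - exact: enum_uniq.
  - by move=> e; rewrite mem_filter mem_index_enum andbT mem_enum !inE.
have big : (p * q <= 12 * size l)%N by rewrite sl; nia.
pose b (e : 'I_q * 'I_p) W : R := cross W (s (lshift q e.2)) (s (rshift p e.1)).
pose g (e : 'I_q * 'I_p) W : R := expR (- (b e W - sgn W e.1 e.2) ^+ 2).
have lP e : e \in l -> (e.1 \in V) /\ (e.2 \in I).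
  by rewrite mem_filter => /andP[/andP[]].
have bflip e e' W : e \in l -> e' \in l -> b e (flip e'.1 e'.2 W) = b e W.
  move=> /lP[eV eI] /lP[e'V e'I]; apply: cross_flip; first exact: Id.
  by move: eV; rewrite inE => /forall_inP; apply.
apply: (@le_trans _ _ (\sum_W expR th * \prod_(e <- l) g e W)).
  apply: card_le_exp => W; first by rewrite mulr_ge0 ?expR_ge0// prodr_ge0// => e _; exact: expR_ge0.
  rewrite inE => hW; rewrite -expR_sum -expRD -[leLHS]expR0 ler_expR sumrN subr_ge0.
  apply: le_trans hW; rewrite /discrepancy pair_big/= big_filter big_mkcond/=.
  apply: ler_sum => -[r i] _ /=; case: ifP => // _.
  exact: sqr_ge0.
rewrite -mulr_sumr.
apply: (@le_trans _ _ (expR th * (#|J|%:R * \prod_(e <- l) (3 / 4)))).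
  apply: ler_wpM2l; first exact: expR_ge0.
  apply: sum_prod_flip.
  - by rewrite filter_uniq// index_enum_uniq.
  - by move=> e W; exact: expR_ge0.
  - by move=> e; lra.
  - move=> e W el; rewrite /g bflip// sgn_flip !eqxx/= opprK.
    have e0 := @expRN1_le R.
    have e4 : expR (- 4) <= 2^-1 :> R.
      by apply: (le_trans _ e0); rewrite ler_expR; lra.
    have key (v x : R) : x ^+ 2 = 1 -> v = 0 \/ v = x \/ v = - x ->
        expR (- (v - x) ^+ 2) + expR (- (v + x) ^+ 2) <= 3 / 2.
      move=> x2; have x4 : (x + x) ^+ 2 = 4.
        by rewrite -mulr2n -[x *+ 2]mulr_natl exprMn x2; ring.
      case=> [->|[->|->]].
      - by rewrite sub0r sqrrN add0r x2; lra.
      - by rewrite subrr expr0n/= oppr0 expR0 x4; lra.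
      - by rewrite addNr expr0n/= oppr0 expR0 -opprD sqrrN x4; lra.
    apply: (@le_trans _ _ (3 / 2)); last by rewrite /=; lra.
    apply: key; first exact: sgn_sqr.
    rewrite /b; case: (cross_cases W (s (lshift q e.2)) (s (rshift p e.1))) => ->.
    - by left.
    - by right; rewrite /sgn; case: (W _ _); rewrite ?expr1 ?expr0 ?opprK; [right|left].
    - by right; rewrite /sgn; case: (W _ _); rewrite ?expr1 ?expr0 ?opprK; [left|right].
  - move=> e e' W el e'l ee'; rewrite /g bflip// sgn_flip; case: ifP => // /andP[/eqP h1 /eqP h2].
    by case/eqP: ee'; case: e e' h1 h2 {el e'l} => ? ? [? ?] /= -> ->.
rewrite big_const_seq count_predT iter_mulr_1 mulrCA ler_wpM2l//.
have h34 : 3 / 4 <= expR (- (4^-1)) :> R by have := @expR_ge1Dx R (- 4^-1); lra.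
apply: (@le_trans _ _ (expR th * expR (- (4^-1)) ^+ size l)).
  rewrite ler_wpM2l ?expR_ge0// lerXn2r ?nnegrE ?expR_ge0//; lra.
rewrite -expRM_natl -expRD ler_expR.
have : (p * q)%:R <= 12 * (size l)%:R :> R by rewrite -natrM ler_nat.
by move=> hh; lra.
Qed.

(** No permutation that moves many coordinates of the first block approximately
    preserves the correlations. *)
Definition rigid W : Prop := forall s, (p <= 2 * #|moved s|)%N ->
  (p * q)%:R / 96 <= discrepancy s W.

(** Union bound over all permutations; the tail is exponential in [p * q] and thus
    beats the factorial. *)
Lemma card_not_rigid : (2 <= q)%N -> (p <= q)%N ->
  #|[pred W | ~~ `[< rigid W >]]|%:R <=
    #|J|%:R * ((p + q)`!%:R * expR (- ((p * q)%:R / 96))) :> R.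
Proof.
move=> q2 pq.
pose bad s W := (p <= 2 * #|moved s|)%N && (discrepancy s W <= (p * q)%:R / 96).
apply: (@le_trans _ _ (\sum_W \sum_s (bad s W)%:R)).
  apply: card_le_exp => W; first by rewrite sumr_ge0.
  rewrite inE => hW; rewrite -natr_sum ler1n lt0n sum_nat_eq0.
  apply: contraNN hW => /forallP hn; apply/asboolP => s hs.
  have := hn s; rewrite /= eqb0 /bad hs/= -ltNge; exact: ltW.
rewrite exchange_big/=.
apply: (@le_trans _ _ (\sum_(s : 'S_(p + q)) #|J|%:R * expR (- ((p * q)%:R / 96)))).
  apply: ler_sum => s _; rewrite /bad.
  have [hs|hs] := boolP (p <= 2 * #|moved s|)%N; last first.
    by rewrite big1// mulr_ge0// expR_ge0.
  apply: le_trans (card_discrepancy_le q2 pq hs (th := (p * q)%:R / 96) _); last by lra.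
  rewrite -sum1_card natr_sum [leRHS]big_mkcond/=; apply: ler_sum => W _.
  by rewrite inE; case: ifP.
by rewrite sumr_const card_Sn -[leLHS]mulr_natl mulrCA.
Qed.

End rigidity.

(** * Covariance matrices with two blocks, and their Gaussian laws *)

Section gaussian_law.
Context {R : realType} (d : nat).
Local Notation Rm := (measurableTypeR R).
Let leb : {sigma_finite_measure set (d.-tuple Rm) -> \bar R} :=
  tuple_power (@lebesgue_measure R) d.
Let Gx : probability (d.-tuple Rm) R := tuple_power (gauss1 R) d.

Definition base_pdf (x : d.-tuple Rm) : R := \prod_i normal_pdf 0 2^-1 (tnth x i).

Lemma measurable_base_pdf : measurable_fun setT base_pdf.
Proof.
apply: (measurable_tuple_prod (h := fun=> normal_pdf 0 2^-1)) => i.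
exact: measurable_normal_pdf.
Qed.

Lemma base_pdf_ge0 x : 0 <= base_pdf x.
Proof. by apply: prodr_ge0 => i _; exact: normal_pdf_ge0. Qed.

Lemma integral_base (F : d.-tuple Rm -> \bar R) :
  measurable_fun setT F -> (forall x, (0 <= F x)%E) ->
  (\int[Gx]_x F x = \int[leb]_x (F x * (base_pdf x)%:E))%E.
Proof.
move=> mF F0; apply: (@integral_tuple_power_density _ _ _ lebesgue_measure) => //.
  exact: measurable_normal_pdf.
by move=> x; exact: normal_pdf_ge0.
Qed.

(** Gaussian laws are handled through a density relative to a product of centred
    laws of variance [1/4]; then all integrals are taken for one fixed probability. *)
Lemma gaussian_law (S : 'M[R]_d) (f : d.-tuple Rm -> R) :
  measurable_fun setT f -> (forall x, 0 <= f x) ->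
  (\int[Gx]_x (f x)%:E = 1)%E ->
  (forall x, gaussian_pdf S x = base_pdf x * f x) ->
  exists P : probability (d.-tuple Rm) R,
    (P : set _ -> \bar R) = gaussian_prob S /\
    forall A, measurable A -> P A = (\int[Gx]_(x in A) (f x)%:E)%E.
Proof.
move=> mf f0 f1 pdfE.
have mg : measurable_fun setT (gaussian_pdf S).
  rewrite (_ : gaussian_pdf S = fun x => base_pdf x * f x); last exact/funext.
  by apply: measurable_funM => //; exact: measurable_base_pdf.
have g0 x : 0 <= gaussian_pdf S x by rewrite pdfE mulr_ge0// base_pdf_ge0.
have E A : measurable A -> (\int[leb]_(x in A) (gaussian_pdf S x)%:E =
    \int[Gx]_(x in A) (f x)%:E)%E.
  move=> mA; rewrite [RHS]integral_mkcond integral_base; last 2 first.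
  - by apply/(measurable_restrictT _ _).1 => //; apply/measurable_EFinP; exact: measurable_funTS.
  - by move=> x; apply: erestrict_ge0 => y _; rewrite lee_fin.
  rewrite [LHS]integral_mkcond; apply: eq_integral => x _.
  rewrite !patchE; case: ifP => _; last by rewrite mul0e.
  by rewrite pdfE mulrC EFinM.
have h1 : (\int[leb]_x (gaussian_pdf S x)%:E = 1)%E by rewrite E.
have [P PE] := density_packaged mg g0 h1.
by exists P; split => // A mA; rewrite PE E.
Qed.

End gaussian_law.

Section block_covariance.
Context {R : realType} (p q : nat).
Local Notation Rm := (measurableTypeR R).
Implicit Types (A : 'M[R]_(q, p)).

(** Covariance of a vector with a first block of independent coordinates of
    variance [1/4] and a second block equal to [A] times the first one plus
    independent noise of the same variance. *)
Definition sigma_mx A : 'M[R]_(p + q) :=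
  4^-1 *: block_mx 1%:M A^T A (1%:M + A *m A^T).

Let Lmx A : 'M[R]_(p + q) := block_mx 1%:M 0 A 1%:M.
Let Kmx A : 'M[R]_(p + q) := block_mx 1%:M 0 (- A) 1%:M.

(** This factorisation makes the determinant constant and the inverse explicit. *)
Lemma sigma_mxE A : sigma_mx A = 4^-1 *: (Lmx A *m (Lmx A)^T).
Proof.
rewrite /sigma_mx /Lmx tr_block_mx mulmx_block !trmx1 trmx0.
by rewrite !mul1mx !mulmx1 ?mul0mx ?mulmx0 !addr0 [A *m A^T + _]addrC.
Qed.

Let KL A : Kmx A *m Lmx A = 1%:M.
Proof.
rewrite /Kmx /Lmx mulmx_block !mul1mx !mulmx1 ?mul0mx ?mulmx0 !addr0 add0r addNr.
by rewrite -scalar_mx_block.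
Qed.

Lemma det_sigma_mx A : \det (sigma_mx A) = 4^-1 ^+ (p + q).
Proof.
by rewrite sigma_mxE detZ det_mulmx det_tr /Lmx det_lblock !det1 !mulr1.
Qed.

Lemma invmx_sigma_mx A : invmx (sigma_mx A) = 4 *: ((Kmx A)^T *m Kmx A).
Proof.
have LK : Lmx A *m Kmx A = 1%:M by apply: mulmx1C; exact: KL.
have E : (4 *: ((Kmx A)^T *m Kmx A)) *m sigma_mx A = 1%:M.
  rewrite sigma_mxE -scalemxAl -scalemxAr scalerA mulfV// scale1r.
  rewrite -mulmxA (mulmxA (Kmx A)) KL mul1mx -trmx_mul LK trmx1//.
have [_ U] := mulmx1_unit E.
by rewrite -[LHS]mul1mx -E -mulmxA mulmxV// mulmx1.
Qed.

Lemma positive_definite_sigma_mx A : positive_definite (sigma_mx A).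
Proof.
split.
  by rewrite sigma_mxE linearZ/= trmx_mul trmxK.
move=> x x0; rewrite sigma_mxE -scalemxAr -scalemxAl mxE mulr_gt0//.
have -> : x^T *m (Lmx A *m (Lmx A)^T) *m x = ((Lmx A)^T *m x)^T *m ((Lmx A)^T *m x).
  by rewrite trmx_mul trmxK !mulmxA.
set y := _ *m x.
have y0 : y != 0.
  apply: contraNneq x0 => y0.
  have : (Kmx A)^T *m y = x by rewrite /y mulmxA -trmx_mul (mulmx1C (KL A)) trmx1 mul1mx.
  by rewrite y0 mulmx0 => <-.
rewrite mxE.
have [i yi] : exists i, y i 0 != 0.
  apply: contrapT => hn; case/eqP: y0; apply/matrixP => i j.
  rewrite ord1 [RHS]mxE; apply/eqP/negPn/negP => h; apply: hn.
  by exists i.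
rewrite (bigD1 i)//= ltr_wpDr//.
  by apply: sumr_ge0 => j _; rewrite mxE -expr2 sqr_ge0.
by rewrite mxE -expr2 exprn_even_gt0.
Qed.

Lemma gaussian_pdf_sigma_mx A x :
  gaussian_pdf (sigma_mx A) x = base_pdf x * block_density (fun r i => A r i) x.
Proof.
rewrite /gaussian_pdf det_sigma_mx invmx_sigma_mx; set v := \col_i _.
have pi0 := @pi_gt0 R.
have -> : (Num.sqrt ((2 * pi) ^+ (p + q) * 4^-1 ^+ (p + q)))^-1 =
    \prod_(i < p + q) normal_peak 2^-1 :> R.
  rewrite prodr_const card_ord /normal_peak [RHS]exprVn; congr (_^-1).
  rewrite -exprMn.
  have -> : 2 * pi * 4^-1 = 2^-1 ^+ 2 * pi *+ 2 :> R by rewrite -[RHS]mulr_natl; field.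
  have c0 : 0 <= 2^-1 ^+ 2 * pi *+ 2 :> R by rewrite mulrn_wge0// mulr_ge0// ltW.
  elim: (p + q)%N => [|n IH]; first by rewrite !expr0 sqrtr1.
  by rewrite [in LHS](exprS _ n) sqrtrM// IH -exprS.
have -> : (v^T *m (4 *: ((Kmx A)^T *m Kmx A)) *m v) 0 0 =
    4 * (\sum_i tnth x (lshift q i) ^+ 2 +
      \sum_r (tnth x (rshift p r) - lin (fun i => A r i) (first_block x)) ^+ 2).
  rewrite -scalemxAr -scalemxAl mxE; congr (_ * _).
  have -> : v^T *m ((Kmx A)^T *m Kmx A) *m v = (Kmx A *m v)^T *m (Kmx A *m v).
    by rewrite trmx_mul !mulmxA.
  have -> : Kmx A *m v = col_mx (\col_i tnth x (lshift q i))
      (\col_r (tnth x (rshift p r) - lin (fun i => A r i) (first_block x))).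
    rewrite -[v]vsubmxK /Kmx mul_block_col !mul1mx mul0mx addr0; congr col_mx.
      by apply/matrixP => i j; rewrite !mxE.
    apply/matrixP => r j; rewrite !mxE addrC; congr (_ + _).
    rewrite /lin -sumrN; apply: eq_bigr => i _.
    by rewrite !mxE tnth_mktuple mulNr.
  rewrite tr_col_mx mul_row_col !mxE; congr (_ + _).
    by apply: eq_bigr => i _; rewrite !mxE expr2.
  by apply: eq_bigr => i _; rewrite !mxE expr2.
have -> : base_pdf x = \prod_(i < p + q) normal_peak 2^-1 *
    expR (- (\sum_(i < p + q) 2 * tnth x i ^+ 2)).
  rewrite -sumrN expR_sum -big_split/=; apply: eq_bigr => i _.
  rewrite normal_pdfE// /normal_fun subr0; congr (_ * expR _); by field.
rewrite -mulrA; congr (_ * _).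
rewrite /block_density /row_density -expR_sum -expRD; congr expR.
rewrite big_split_ord/= -!mulr_sumr.
have -> : \sum_r (tnth x (rshift p r) - lin (fun i => A r i) (first_block x)) ^+ 2 =
   \sum_r tnth x (rshift p r) ^+ 2 - 2^-1 * \sum_r (4 * tnth x (rshift p r) *
      lin (fun i => A r i) (first_block x) - 2 * lin (fun i => A r i) (first_block x) ^+ 2).
  rewrite mulr_sumr -sumrB; apply: eq_bigr => r _; by field.
by field.
Qed.

End block_covariance.

(** * Permutations of the first block *)

Section block_permutation.
Context {R : realType} (p q : nat).
Implicit Types (A : 'M[R]_(q, p)) (t : 'S_p) (s : 'S_(p + q)).

Definition extend_perm_fun t (x : 'I_(p + q)) : 'I_(p + q) :=
  match fintype.split x with inl i => lshift q (t i) | inr r => rshift p r end.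

Lemma extend_perm_fun_l t i : extend_perm_fun t (lshift q i) = lshift q (t i).
Proof. by rewrite /extend_perm_fun -[lshift q i]/(unsplit (inl i)) unsplitK. Qed.

Lemma extend_perm_fun_r t r : extend_perm_fun t (rshift p r) = rshift p r.
Proof. by rewrite /extend_perm_fun -[rshift p r]/(unsplit (inr r)) unsplitK. Qed.

Lemma extend_perm_fun_inj t : injective (extend_perm_fun t).
Proof.
apply: (can_inj (g := extend_perm_fun t^-1%g)) => x; rewrite -[x]fintype.splitK.
by case: (fintype.split x) => a /=; rewrite ?extend_perm_fun_l ?extend_perm_fun_r ?permK.
Qed.

Definition extend_perm t : 'S_(p + q) := perm (@extend_perm_fun_inj t).

Lemma extend_perm_l t i : extend_perm t (lshift q i) = lshift q (t i).
Proof. by rewrite permE extend_perm_fun_l. Qed.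

Lemma extend_perm_r t r : extend_perm t (rshift p r) = rshift p r.
Proof. by rewrite permE extend_perm_fun_r. Qed.

Definition col_permuted A t : 'M[R]_(q, p) := \matrix_(r, i) A r (t i).

Lemma conj_extend_perm_sigma_mx A t :
  conj_perm (sigma_mx A) (extend_perm t) = sigma_mx (col_permuted A t).
Proof.
apply/matrixP => x y; rewrite mxE -[x]fintype.splitK -[y]fintype.splitK.
case: (fintype.split x) => a; case: (fintype.split y) => b /=;
  rewrite ?extend_perm_l ?extend_perm_r /sigma_mx [LHS]mxE [RHS]mxE; congr (_ * _);
  rewrite ?(block_mxEul, block_mxEur, block_mxEdl, block_mxEdr).
- by rewrite !mxE (inj_eq perm_inj).
- by rewrite !mxE.
- by rewrite !mxE.
- rewrite !mxE; congr (_ + _); rewrite [LHS](reindex_inj (@perm_inj _ t)).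
  by apply: eq_bigr => i _; rewrite !mxE.
Qed.

Definition agree s t : {set 'I_p} := [set i | s (lshift q i) == lshift q (t i)]%SET.

Lemma card_fix_on (I : {set 'I_p}) (h : 'I_p -> 'I_(p + q)) :
  (#|[pred t : 'S_p | [forall i in I, h i == lshift q (t i)]]| <= (p - #|I|)`!)%N.
Proof.
set P := [pred t | _].
have [t0 t0P|P0] := pickP P; last by rewrite (@eq_card0 _ P).
have cI : (#|I| + #|~: I| = p)%N by rewrite cardsC card_ord.
have -> : (p - #|I|)%N = #|~: I| by lia.
rewrite -card_perm.
rewrite -(card_imset (mem P) (@mulIg _ (t0^-1)%g)).
apply: subset_leq_card; apply/fintype.subsetP => u /imsetP[t + ->].
move=> /forall_inP ht; move/forall_inP : t0P => ht0.
rewrite unfold_in; apply/fintype.subsetP => i; rewrite !inE permM; apply: contraNN => iI.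
have /eqP := ht i iI; rewrite (eqP (ht0 i iI)) => /lshift_inj <-.
by rewrite permK.
Qed.

(** There are ['C(p, g)] sets of [g] points, and each of them is fixed by at most
    [(p - g)`!] permutations. *)
Lemma card_agree_le s g :
  (#|[pred t : 'S_p | (g <= #|agree s t|)%N]| * g`! <= p`!)%N.
Proof.
have [gp|pg] := leqP g p; last first.
  rewrite eq_card0 ?mul0n// => t; rewrite inE; apply/negbTE; rewrite -ltnNge.
  by rewrite (leq_ltn_trans _ pg)// -[p in (_ <= p)%N]card_ord max_card.
suff h : (#|[pred t : 'S_p | (g <= #|agree s t|)%N]| <= 'C(p, g) * (p - g)`!)%N.
  rewrite (leq_trans (leq_mul h (leqnn _)))//.
  by rewrite -mulnA [((p - g)`! * _)%N]mulnC bin_fact.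
pose P (I : {set 'I_p}) := [pred t : 'S_p | [forall i in I, s (lshift q i) == lshift q (t i)]].
apply: (@leq_trans (\sum_(I : {set 'I_p} | #|I| == g) #|P I|)).
  rewrite -sum1_card; under [X in (_ <= X)%N]eq_bigr do rewrite -sum1_card.
  rewrite (exchange_big_dep predT)//= big_mkcond/=; apply: leq_sum => t _.
  case: ifP => // ht; have := ht; rewrite inE => ht'.
  have [I Is Ic] : exists2 I : {set 'I_p}, I \subset agree s t & #|I| == g.
    exists [set x in take g (enum (agree s t))]%SET.
      by apply/fintype.subsetP => x; rewrite inE => /mem_take; rewrite mem_enum.
    have /card_uniqP e : uniq (take g (enum (agree s t))) by rewrite take_uniq// enum_uniq.
    by rewrite cardsE e size_takel// -cardE.
  rewrite (bigD1 I)//= Ic/=; apply/forall_inP => i /(fintype.subsetP Is).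
  by rewrite inE.
apply: (@leq_trans (\sum_(I : {set 'I_p} | #|I| == g) (p - g)`!)).
  by apply: leq_sum => I /eqP <-; exact: card_fix_on.
rewrite sum_nat_const leq_mul2r; apply/orP; right.
by rewrite -cardsE card_draws card_ord.
Qed.

(** The estimate composed with the inverse of the true permutation fixes exactly
    the columns of agreement. *)
Lemma moved_left s t : #|moved (s * (extend_perm t)^-1)%g| = (p - #|agree s t|)%N.
Proof.
have -> : moved (s * (extend_perm t)^-1)%g = (~: agree s t)%SET.
  apply/setP => i; rewrite !inE permM -(extend_perm_l t); congr negb.
  by rewrite -(inj_eq (@perm_inj _ (extend_perm t))) permKV.
by rewrite cardsCs finset.setCK card_ord.
Qed.

Lemma moved_right s t : #|moved ((extend_perm t)^-1 * s)%g| = (p - #|agree s t|)%N.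
Proof.
have -> : moved ((extend_perm t)^-1 * s)%g = (t @: ~: agree s t)%SET.
  apply/setP => i; rewrite !inE permM.
  have -> : ((extend_perm t)^-1)%g (lshift q i) = lshift q (t^-1%g i).
    by rewrite -{1}(permKV t i) -extend_perm_l permK.
  apply/idP/imsetP => [h|[j + ->]].
    by exists (t^-1%g i); rewrite ?inE permKV.
  by rewrite !inE permK.
rewrite card_imset; last exact: perm_inj.
apply/eqP; rewrite -(eqn_add2l #|agree s t|) cardsC card_ord subnKC//.
by rewrite -[leqRHS]card_ord max_card.
Qed.

End block_permutation.

(** * Loss and operator norm in the two-block model *)

Section conjugation.
Context {R : realType} (d : nat).
Implicit Types (S : 'M[R]_d) (s t : 'S_d).

Lemma conj_permM S s t : conj_perm (conj_perm S s) t = conj_perm S (t * s)%g.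
Proof. by apply/matrixP => i j; rewrite !mxE !permM. Qed.

Lemma frobenius_conj_perm S s : frobenius_norm (conj_perm S s) = frobenius_norm S.
Proof.
rewrite /frobenius_norm; congr Num.sqrt.
rewrite [RHS](reindex_inj (@perm_inj _ s)); apply: eq_bigr => i _.
rewrite [RHS](reindex_inj (@perm_inj _ s)); apply: eq_bigr => j _.
by rewrite mxE.
Qed.

Lemma frobenius_sqr m n (A : 'M[R]_(m, n)) :
  frobenius_norm A ^+ 2 = \sum_i \sum_j A i j ^+ 2.
Proof.
rewrite sqr_sqrtr//; apply: sumr_ge0 => i _; apply: sumr_ge0 => j _; exact: sqr_ge0.
Qed.

Lemma euclidean_sqr n (x : 'cV[R]_n) : euclidean_norm x ^+ 2 = \sum_i x i 0 ^+ 2.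
Proof. by rewrite sqr_sqrtr// sumr_ge0// => i _; exact: sqr_ge0. Qed.

Lemma euclidean_ge0 n (x : 'cV[R]_n) : 0 <= euclidean_norm x.
Proof. exact: sqrtr_ge0. Qed.

Lemma operator_norm_le1 S :
  (forall x : 'cV[R]_d, \sum_i (S *m x) i 0 ^+ 2 <= \sum_i x i 0 ^+ 2) ->
  operator_norm S <= 1.
Proof.
move=> h; apply: ge_sup.
  by exists (euclidean_norm (S *m 0)), 0 => //=; rewrite /euclidean_norm big1 ?sqrtr0//
    => i _; rewrite mxE expr0n.
move=> _ [x /= x1 <-]; apply: (le_trans _ x1).
rewrite -(@ler_pXn2r _ 2)// ?nnegrE ?euclidean_ge0//.
by rewrite !euclidean_sqr.
Qed.

Lemma conj_perm_contracting S s :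
  (forall x : 'cV[R]_d, \sum_i (S *m x) i 0 ^+ 2 <= \sum_i x i 0 ^+ 2) ->
  forall x : 'cV[R]_d, \sum_i (conj_perm S s *m x) i 0 ^+ 2 <= \sum_i x i 0 ^+ 2.
Proof.
move=> h x; pose y : 'cV[R]_d := \col_i x (s^-1%g i) 0.
have -> : \sum_i x i 0 ^+ 2 = \sum_i y i 0 ^+ 2.
  rewrite [RHS](reindex_inj (@perm_inj _ s)); apply: eq_bigr => i _.
  by rewrite mxE permK.
apply: le_trans (h y).
rewrite [leRHS](reindex_inj (@perm_inj _ s)) le_eqVlt; apply/orP; left; apply/eqP.
apply: eq_bigr => i _; congr (_ ^+ 2); rewrite !mxE.
rewrite [RHS](reindex_inj (@perm_inj _ s)); apply: eq_bigr => j _.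
by rewrite !mxE permK.
Qed.

End conjugation.

Section small_block.
Context {R : realType} (p q : nat).
Implicit Types (A : 'M[R]_(q, p)).

(** Squared operator norm at most [eta], for the matrix and its transpose. *)
Definition bounded_mx A (eta : R) : Prop :=
  (forall x : 'cV[R]_p, \sum_i (A *m x) i 0 ^+ 2 <= eta * \sum_i x i 0 ^+ 2) /\
  (forall y : 'cV[R]_q, \sum_i (A^T *m y) i 0 ^+ 2 <= eta * \sum_i y i 0 ^+ 2).

Lemma sigma_mx_contracting A eta : eta <= 4^-1 -> 0 <= eta -> bounded_mx A eta ->
  forall x : 'cV[R]_(p + q), \sum_i (sigma_mx A *m x) i 0 ^+ 2 <= \sum_i x i 0 ^+ 2.
Proof.
move=> e4 e0 [bA bAT] x.
pose x1 := usubmx x; pose x2 := dsubmx x.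
have xE : x = col_mx x1 x2 by rewrite vsubmxK.
pose a := A^T *m x2; pose b := A *m x1; pose c := A *m a.
have mulE : sigma_mx A *m x = col_mx (4^-1 *: (x1 + a)) (4^-1 *: (b + (x2 + c))).
  rewrite xE /sigma_mx -scalemxAl mul_block_col mul1mx mulmxDl mul1mx -mulmxA.
  by rewrite scale_col_mx.
have sum_col (u : 'cV[R]_p) (v : 'cV[R]_q) :
    \sum_i (col_mx u v) i 0 ^+ 2 = \sum_i u i 0 ^+ 2 + \sum_i v i 0 ^+ 2.
  rewrite big_split_ord/=; congr (_ + _); apply: eq_bigr => i _;
    by rewrite ?col_mxEu ?col_mxEd.
rewrite mulE xE !sum_col.
have ha : \sum_i a i 0 ^+ 2 <= eta * \sum_i x2 i 0 ^+ 2 by exact: bAT.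
have hb : \sum_i b i 0 ^+ 2 <= eta * \sum_i x1 i 0 ^+ 2 by exact: bA.
have hc : \sum_i c i 0 ^+ 2 <= eta * \sum_i a i 0 ^+ 2 by exact: bA.
have n0 n (u : 'cV[R]_n) : 0 <= \sum_i u i 0 ^+ 2.
  by apply: sumr_ge0 => i _; exact: sqr_ge0.
have h1 : \sum_i (4^-1 *: (x1 + a)) i 0 ^+ 2 <=
    8^-1 * (\sum_i x1 i 0 ^+ 2 + \sum_i a i 0 ^+ 2).
  rewrite -big_split/= mulr_sumr; apply: ler_sum => i _.
  have -> : (4^-1 *: (x1 + a)) i 0 = 4^-1 * (x1 i 0 + a i 0).
    by rewrite mxE; congr (_ * _); rewrite mxE.
  move: (x1 i 0) (a i 0) => u v.
  have := sqr_ge0 (u - v); nra.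
have h2 : \sum_i (4^-1 *: (b + (x2 + c))) i 0 ^+ 2 <=
    (3 / 16) * (\sum_i b i 0 ^+ 2 + \sum_i x2 i 0 ^+ 2 + \sum_i c i 0 ^+ 2).
  rewrite -!big_split/= mulr_sumr; apply: ler_sum => i _.
  have -> : (4^-1 *: (b + (x2 + c))) i 0 = 4^-1 * (b i 0 + (x2 i 0 + c i 0)).
    by rewrite mxE; congr (_ * _); rewrite mxE; congr (_ + _); rewrite mxE.
  move: (b i 0) (x2 i 0) (c i 0) => u v w.
  have := sqr_ge0 (u - v); have := sqr_ge0 (u - w); have := sqr_ge0 (v - w); nra.
have := n0 _ x1; have := n0 _ x2; have := n0 _ a.
move: (\sum_i x1 i 0 ^+ 2) (\sum_i x2 i 0 ^+ 2) (\sum_i a i 0 ^+ 2) (\sum_i b i 0 ^+ 2)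
  (\sum_i c i 0 ^+ 2) (\sum_i (4^-1 *: (x1 + a)) i 0 ^+ 2)
  (\sum_i (4^-1 *: (b + (x2 + c))) i 0 ^+ 2) ha hb hc h1 h2.
move=> X1 X2 Aa B C Y1 Y2 ha hb hc h1 h2 a0 x20 x10.
have : eta * X2 <= 4^-1 * X2 by rewrite ler_wpM2r.
have : eta * X1 <= 4^-1 * X1 by rewrite ler_wpM2r.
have : eta * Aa <= 4^-1 * Aa by rewrite ler_wpM2r.
move=> h3 h4 h5; lra.
Qed.

(** Each column of the Gram matrix is the image by [A] of a row of [A]. *)
Lemma gram_sqr_le A eta : bounded_mx A eta ->
  \sum_r \sum_s (A *m A^T) r s ^+ 2 <= eta * \sum_r \sum_i A r i ^+ 2.
Proof.
move=> [bA _]; rewrite exchange_big/= mulr_sumr; apply: ler_sum => s _.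
have := bA (col s A^T).
have colE r : (A *m col s A^T) r 0 = (A *m A^T) r s.
  by rewrite !mxE; apply: eq_bigr => i _; rewrite !mxE.
rewrite (eq_bigr (fun r => (A *m A^T) r s ^+ 2)); last by move=> r _; rewrite -colE.
rewrite [X in _ <= _ * X -> _](eq_bigr (fun i => A s i ^+ 2))//.
by move=> i _; rewrite !mxE.
Qed.

End small_block.

Section sign_block.
Context {R : realType} (p q : nat) (tau : R).
Let J := {ffun 'I_q -> {ffun 'I_p -> bool}}.
Implicit Types (W : J).

Definition sign_mx W : 'M[R]_(q, p) := \matrix_(r, i) (tau * sgn W r i).

(** The bound on the bilinear form passes to the norms of images by testing the
    form at the image itself. *)
Lemma bounded_sign_mx W : @op_bounded R p q W -> bounded_mx (sign_mx W) (6400 * q%:R * tau ^+ 2).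
Proof.
move=> gW; pose K : R := 80 * Num.sqrt q%:R.
have K0 : 0 <= K by rewrite mulr_ge0// sqrtr_ge0.
have K2 : K ^+ 2 = 6400 * q%:R by rewrite exprMn sqr_sqrtr ?ler0n//; ring.
have key y x : bil W y x <= K * (Num.sqrt (sqn y) * Num.sqrt (sqn x)).
  have sq0 n (z : 'I_n -> R) : 0 <= sqn z by apply: sumr_ge0 => i _; exact: sqr_ge0.
  have deg n (z : 'I_n -> R) : Num.sqrt (sqn z) = 0 -> forall i, z i = 0.
    move=> /eqP; rewrite sqrtr_eq0 => h i.
    have /eqP : sqn z = 0 by apply/eqP; rewrite eq_le h sq0.
    rewrite psumr_eq0; last by move=> j _; exact: sqr_ge0.
    by move/allP/(_ i (mem_index_enum _)); rewrite sqrf_eq0 => /eqP.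
  have [y0|yn] := eqVneq (Num.sqrt (sqn y)) 0.
    rewrite y0 mul0r mulr0 /bil big1// => r _; rewrite big1// => i _.
    by rewrite (deg _ _ y0) !mul0r.
  have [x0|xn] := eqVneq (Num.sqrt (sqn x)) 0.
    rewrite x0 !mulr0 /bil big1// => r _; rewrite big1// => i _.
    by rewrite (deg _ _ x0) mulr0.
  have nrm n (z : 'I_n -> R) : Num.sqrt (sqn z) != 0 ->
      sqn (fun i => (Num.sqrt (sqn z))^-1 * z i) <= 1.
    move=> zn; rewrite /sqn; under eq_bigr do rewrite exprMn.
    rewrite -mulr_sumr -/(sqn z) exprVn sqr_sqrtr// mulVf//.
    by apply: contraNneq zn => ->; rewrite sqrtr0.
  have := gW _ _ (nrm _ y yn) (nrm _ x xn); rewrite bilZ -/K.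
  have y_gt0 : 0 < Num.sqrt (sqn y) by rewrite lt_def yn sqrtr_ge0.
  have x_gt0 : 0 < Num.sqrt (sqn x) by rewrite lt_def xn sqrtr_ge0.
  by rewrite -invfM ler_pdivrMl ?mulr_gt0// mulrC.
(* testing the bilinear form at the image bounds the norm of the image *)
have dual (a b : R) : 0 <= a -> 0 <= b -> a <= K * (Num.sqrt a * Num.sqrt b) -> a <= K ^+ 2 * b.
  move=> a0 b0 h.
  have sa : Num.sqrt a ^+ 2 = a by rewrite sqr_sqrtr.
  have sb : Num.sqrt b ^+ 2 = b by rewrite sqr_sqrtr.
  have sa0 := sqrtr_ge0 a; have sb0 := sqrtr_ge0 b.
  move: (Num.sqrt a) (Num.sqrt b) sa sb sa0 sb0 h => u v <- <- u0 v0 h.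
  have [->|un] := eqVneq u 0; first by rewrite expr0n/= mulr_ge0// sqr_ge0.
  have u1 : 0 < u by rewrite lt_def un.
  have : u <= K * v by rewrite -(ler_pM2l u1) -expr2 mulrCA.
  by move=> h'; rewrite -exprMn lerXn2r// nnegrE mulr_ge0.
have scale n (z : 'I_n -> R) : \sum_i (tau * z i) ^+ 2 = tau ^+ 2 * sqn z.
  by rewrite mulr_sumr; apply: eq_bigr => i _; rewrite exprMn.
split=> [x|y].
- pose b (r : 'I_q) := \sum_i sgn W r i * x i 0.
  rewrite (eq_bigr (fun r => (tau * b r) ^+ 2)); last first.
    move=> r _; congr (_ ^+ 2); rewrite mxE /b mulr_sumr; apply: eq_bigr => i _.
    by rewrite mxE mulrA.
  rewrite scale -K2 [leRHS]mulrAC [leRHS]mulrC ler_wpM2l ?sqr_ge0//.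
  apply: dual; [exact: sqn_ge0|exact: sqn_ge0|apply: le_trans (key b (fun i => x i 0))].
  rewrite le_eqVlt; apply/orP; left; apply/eqP; apply: eq_bigr => r _.
  by rewrite expr2 {2}/b mulr_sumr; apply: eq_bigr => i _; rewrite mulrA.
- pose b (i : 'I_p) := \sum_r y r 0 * sgn W r i.
  rewrite (eq_bigr (fun i => (tau * b i) ^+ 2)); last first.
    move=> i _; congr (_ ^+ 2); rewrite mxE /b mulr_sumr; apply: eq_bigr => r _.
    by rewrite !mxE; ring.
  rewrite scale -K2 [leRHS]mulrAC [leRHS]mulrC ler_wpM2l ?sqr_ge0//.
  apply: dual; [exact: sqn_ge0|exact: sqn_ge0|rewrite [X in K * X]mulrC].
  apply: le_trans (key (fun r => y r 0) b).
  rewrite le_eqVlt; apply/orP; left; apply/eqP; rewrite /bil exchange_big/=.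
  by apply: eq_bigr => i _; rewrite expr2 {1}/b mulr_suml.
Qed.

Let noise W : 'M[R]_(p + q) := block_mx 0 0 0 (sign_mx W *m (sign_mx W)^T).

Let sigma_off W x y : x != y ->
  sigma_mx (sign_mx W) x y = 4^-1 * (tau * @cross R p q W x y + noise W x y).
Proof.
rewrite -[x]fintype.splitK -[y]fintype.splitK /cross.
case: (fintype.split x) => a; case: (fintype.split y) => b; rewrite !unsplitK /= => ab;
  rewrite /sigma_mx /noise mxE; congr (_ * _);
  rewrite !(block_mxEul, block_mxEur, block_mxEdl, block_mxEdr) !mxE ?addr0 ?mulr0 ?add0r//.
- by have /negbTE -> : a != b by apply: contraNneq ab => ->.
- have /negbTE -> : a != b by apply: contraNneq ab => ->.
  by rewrite mulr0n add0r.
Qed.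

(** The entries between the two blocks of the permuted covariance differ from
    the original ones by the discrepancy of the sign matrix, up to entries of the
    Gram matrix, whose total energy is smaller by a constant factor. *)
Lemma sign_loss_ge W (s : 'S_(p + q)) : @op_bounded R p q W -> @rigid R p q W ->
  6400 * q%:R * tau ^+ 2 <= 384^-1 -> (p <= 2 * #|moved s|)%N ->
  tau ^+ 2 * (p * q)%:R / 6144 <=
  frobenius_norm (conj_perm (sigma_mx (sign_mx W)) s - sigma_mx (sign_mx W)) ^+ 2.
Proof.
move=> gW rW hq hs; set D := conj_perm _ _ - _.
have bW := bounded_sign_mx gW.
have dW := rW s hs.
pose x (i : 'I_p) := s (lshift q i); pose y (r : 'I_q) := s (rshift p r).
have DE i r : D (lshift q i) (rshift p r) =
    4^-1 * (tau * (@cross R p q W (x i) (y r) - sgn W r i) + noise W (x i) (y r)).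
  rewrite /D mxE [X in X + _]mxE [X in _ + X]mxE -/(x i) -/(y r).
  have lr : lshift q i != rshift p r by rewrite eq_lrshift.
  rewrite (sigma_off W lr) sigma_off ?(inj_eq perm_inj)// cross_lr.
  have -> : noise W (lshift q i) (rshift p r) = 0 by rewrite /noise block_mxEur mxE.
  ring.
have -> : frobenius_norm D ^+ 2 = \sum_a \sum_b D a b ^+ 2 by exact: frobenius_sqr.
apply: (@le_trans _ _ (\sum_i \sum_r D (lshift q i) (rshift p r) ^+ 2)); last first.
  rewrite [leRHS]big_split_ord/= -[leLHS]addr0 lerD//.
    apply: ler_sum => i _; rewrite [leRHS]big_split_ord/= -[leLHS]add0r lerD//.
    by apply: sumr_ge0 => ? _; exact: sqr_ge0.
  by apply: sumr_ge0 => ? _; apply: sumr_ge0 => ? _; exact: sqr_ge0.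
have noise_le : \sum_i \sum_r noise W (x i) (y r) ^+ 2 <=
    384^-1 * (tau ^+ 2 * (p * q)%:R).
  apply: (@le_trans _ _ (\sum_a \sum_b noise W (s a) (s b) ^+ 2)).
    rewrite [leRHS]big_split_ord/= -[leLHS]addr0 lerD//.
      apply: ler_sum => i _; rewrite [leRHS]big_split_ord/= -[leLHS]add0r lerD//.
      by apply: sumr_ge0 => ? _; exact: sqr_ge0.
    by apply: sumr_ge0 => ? _; apply: sumr_ge0 => ? _; exact: sqr_ge0.
  have -> : \sum_a \sum_b noise W (s a) (s b) ^+ 2 = \sum_a \sum_b noise W a b ^+ 2.
    rewrite [RHS](reindex_inj (@perm_inj _ s)); apply: eq_bigr => a _.
    by rewrite [RHS](reindex_inj (@perm_inj _ s)).
  rewrite big_split_ord/= big1 ?add0r; last first.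
    move=> i _; rewrite big_split_ord/= !big1 ?addr0// => j _;
    by rewrite /noise ?block_mxEul ?block_mxEur mxE expr0n.
  have -> : tau ^+ 2 * (p * q)%:R = \sum_r \sum_i sign_mx W r i ^+ 2.
    rewrite (eq_bigr (fun=> tau ^+ 2 *+ p)); last first.
      move=> r _; rewrite -[in RHS](card_ord p) -sumr_const; apply: eq_bigr => i _.
      by rewrite mxE exprMn sgn_sqr mulr1.
    by rewrite sumr_const card_ord -mulrnA mulr_natr.
  apply: (@le_trans _ _ ((6400 * q%:R * tau ^+ 2) * \sum_r \sum_i sign_mx W r i ^+ 2)).
    apply: le_trans (gram_sqr_le bW).
    apply: ler_sum => r _; rewrite big_split_ord/= big1 ?add0r; last first.
      by move=> i _; rewrite /noise block_mxEdl mxE expr0n.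
    by apply: ler_sum => r' _; rewrite /noise block_mxEdr.
  rewrite ler_wpM2r//; apply: sumr_ge0 => ? _; apply: sumr_ge0 => ? _; exact: sqr_ge0.
apply: (@le_trans _ _ (tau ^+ 2 / 32 * @discrepancy R p q s W -
    16^-1 * \sum_i \sum_r noise W (x i) (y r) ^+ 2)).
  have := ler_wpM2l (sqr_ge0 tau) dW.
  lra.
rewrite /discrepancy exchange_big/= !mulr_sumr -sumrB; apply: ler_sum => i _.
rewrite !mulr_sumr -sumrB; apply: ler_sum => r _.
rewrite DE -/(x i) -/(y r); set u := @cross R p q W _ _ - _; set v := noise W _ _.
have := sqr_ge0 (tau * u + 2 * v); nra.
Qed.

End sign_block.

(** * The risk in terms of densities *)

Section risk_density.
Context {R : realType} (d : nat).
Local Notation Rm := (measurableTypeR R).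
Let T := d.-tuple Rm.
Let Gx : probability T R := tuple_power (gauss1 R) d.
Implicit Types (S : 'M[R]_d) (f g : T -> R).

(** Positivity is required everywhere, which makes all divergences finite. *)
Definition gaussian_density S f : Prop :=
  [/\ measurable_fun setT f, (forall x, 0 < f x),
      (\int[Gx]_x (f x)%:E = 1)%E &
      forall x, gaussian_pdf S x = base_pdf x * f x].

Let Pw n : probability (n.-tuple T) R := tuple_power Gx n.

Definition lik2 m n f g (z : m.-tuple T * n.-tuple T) : R :=
  (\prod_i f (tnth z.1 i)) * (\prod_i g (tnth z.2 i)).

Lemma measurable_lik2 m n f g : measurable_fun setT f -> measurable_fun setT g ->
  measurable_fun setT (@lik2 m n f g).
Proof.
move=> mf mg.
have mF : measurable_fun setT (fun X : m.-tuple T => \prod_i f (tnth X i)).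
  by apply: (measurable_tuple_prod (h := fun=> f)) => i; exact: mf.
have mG : measurable_fun setT (fun Y : n.-tuple T => \prod_i g (tnth Y i)).
  by apply: (measurable_tuple_prod (h := fun=> g)) => i; exact: mg.
apply: measurable_funM; first exact: (measurableT_comp mF measurable_fst).
exact: (measurableT_comp mG measurable_snd).
Qed.

Lemma lik2_ge0 m n f g z : (forall x, 0 < f x) -> (forall x, 0 < g x) -> 0 <= @lik2 m n f g z.
Proof. by move=> f0 g0; apply: mulr_ge0; apply: prodr_ge0 => i _; exact: ltW. Qed.

(** Both factors of the law of the data have densities relative to powers of the
    same probability. *)
Lemma integral_sample_law m n S (s : 'S_d) f g (h : samples R m n d -> R) :
  gaussian_density S f -> gaussian_density (conj_perm S s) g ->
  measurable_fun setT h -> (forall z, 0 <= h z) ->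
  (\int[sample_law S s]_z (h z)%:E = \int[Pw m \x Pw n]_z (h z * lik2 f g z)%:E)%E.
Proof.
move=> [mf f0 f1 fE] [mg g0 g1 gE] mh h0.
have [P [PS PE]] := gaussian_law mf (fun x => ltW (f0 x)) f1 fE.
have [Q [QS QE]] := gaussian_law mg (fun x => ltW (g0 x)) g1 gE.
rewrite /sample_law -PS -QS.
pose Pm : probability (m.-tuple T) R := tuple_power P m.
pose Qn : probability (n.-tuple T) R := tuple_power Q n.
have mh' : measurable_fun setT (fun z : m.-tuple T * n.-tuple T => (h z)%:E).
  exact/measurable_EFinP.
have mF : measurable_fun setT (fun X : m.-tuple T => \prod_i f (tnth X i)).
  by apply: (measurable_tuple_prod (h := fun=> f)) => i; exact: mf.
have mG : measurable_fun setT (fun Y : n.-tuple T => \prod_i g (tnth Y i)).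
  by apply: (measurable_tuple_prod (h := fun=> g)) => i; exact: mg.
have F0 (X : m.-tuple T) : 0 <= \prod_i f (tnth X i).
  by apply: prodr_ge0 => i _; exact: ltW.
have G0 (Y : n.-tuple T) : 0 <= \prod_i g (tnth Y i).
  by apply: prodr_ge0 => i _; exact: ltW.
have ml : measurable_fun setT (fun z : m.-tuple T * n.-tuple T => h z * lik2 f g z).
  by apply: measurable_funM => //; exact: measurable_lik2.
rewrite -[LHS]/(\int[Pm \x Qn]_z (h z)%:E)%E.
rewrite fubini_tonelli1//.
rewrite [RHS]fubini_tonelli1//; last 2 first.
- exact/measurable_EFinP.
- by move=> z; rewrite lee_fin mulr_ge0// mulr_ge0.
rewrite (integral_tuple_power_density mf (fun x => ltW (f0 x)) PE); last 2 first.
- by apply: (measurable_fun_fubini_tonelli_F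
    (fun z : m.-tuple T * n.-tuple T => (h z)%:E)) => // z; rewrite lee_fin.
- by move=> X; apply: integral_ge0_real => Y; exact: h0.
apply: eq_integral => X _; rewrite /fubini_F/=.
rewrite (integral_tuple_power_density mg (fun x => ltW (g0 x)) QE); last 2 first.
- exact: (measurableT_comp mh' (measurable_pair1 X)).
- by move=> Y; rewrite lee_fin.
rewrite muleC -ge0_integralZl//; last 3 first.
- apply: emeasurable_funM; last exact/measurable_EFinP.
  exact: (measurableT_comp mh' (measurable_pair1 X)).
- by move=> Y _; rewrite mule_ge0// lee_fin.
- by rewrite lee_fin.
apply: eq_integral => Y _; rewrite -!EFinM; congr _%:E.
by rewrite /lik2/=; ring.
Qed.

(** Markov's inequality for the loss. *)
Lemma risk_ge m n S (s : 'S_d) f g (pihat : samples R m n d -> 'S_d) (A : pred 'S_d) (thr : R) :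
  gaussian_density S f -> gaussian_density (conj_perm S s) g ->
  estimator pihat -> 0 <= thr ->
  (forall t, A t -> thr <= frobenius_norm (conj_perm S t - conj_perm S s) ^+ 2) ->
  (thr%:E * \int[Pw m \x Pw n]_z ((A (pihat z))%:R * lik2 f g z)%:E <= risk pihat S s)%E.
Proof.
move=> dS dT mpi thr0 hA.
pose loss t : R := frobenius_norm (conj_perm S t - conj_perm S s) ^+ 2.
have loss0 t : 0 <= loss t by exact: sqr_ge0.
have mloss : measurable_fun setT (fun z => loss (pihat z)).
  exact: (measurable_fun_selection loss mpi).
rewrite /risk (integral_sample_law dS dT mloss (fun z => loss0 (pihat z))).
case: dS dT => [mf f0 _ _] [mg g0 _ _].
have l0 (z : m.-tuple T * n.-tuple T) : 0 <= lik2 f g z by exact: lik2_ge0.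
have ml : measurable_fun setT (fun z : m.-tuple T * n.-tuple T => lik2 f g z).
  exact: measurable_lik2.
have mA : measurable_fun setT (fun z : m.-tuple T * n.-tuple T => (A (pihat z))%:R * lik2 f g z).
  apply: measurable_funM => //.
  exact: (measurable_fun_selection (fun t => (A t)%:R) mpi).
have mL : measurable_fun setT (fun z : m.-tuple T * n.-tuple T =>
    loss (pihat z) * lik2 f g z) by exact: measurable_funM.
have B0 (z : m.-tuple T * n.-tuple T) : 0 <= (A (pihat z))%:R * lik2 f g z.
  exact: mulr_ge0.
rewrite -(integralZ_real _ mA B0 thr0).
apply: le_integral_real => //.
- exact: measurable_funM.
- by move=> z; exact: mulr_ge0.
- move=> z; rewrite mulrA ler_wpM2r//.
  case: (boolP (A (pihat z))) => [/hA|_]; first by rewrite mulr1.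
  by rewrite mulr0.
Qed.

End risk_density.

(** * Lower bound for the sign ensemble *)

Section sign_fano.
Context {R : realType} (p q : nat) (tau : R) (N k : nat).
Local Notation Rm := (measurableTypeR R).
Let J := {ffun 'I_q -> {ffun 'I_p -> bool}}.
Let T := (p + q).-tuple Rm.
Let Gx : probability T R := tuple_power (gauss1 R) (p + q).
Let P n : probability (n.-tuple T) R := tuple_power Gx n.
Hypotheses (tau0 : 0 < tau) (tau1 : p%:R * tau ^+ 2 <= 8^-1) (p0 : (0 < p)%N).
Hypothesis kN : (k <= N)%N.

(** The sum over sign matrices of the weights is the law of the data for a random
    sign matrix. The permutation acts on its small sample only, so the law for
    given [pi] is compared with the one in which the small sample is pure noise,
    where success amounts to guessing: [kap] of the [p`!] permutations. The
    average failure rate [rho] is then bounded from below, up to the matrices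
    that are not [good]. The map [u] allows the permutation or its inverse. *)
Lemma sign_fano (u : 'S_p -> 'S_p) (D : finType) (sel : N.-tuple T * k.-tuple T -> D)
    (miss : 'S_p -> pred D) (good : pred J) (b : bool) (t kap beta rho : R) :
  1 < t -> (forall s, measurable (sel @^-1` [set s])) ->
  (forall s, #|[pred pi | ~~ miss pi s]|%:R <= kap) ->
  #|[pred W | ~~ good W]|%:R <= #|J|%:R * beta :> R ->
  (forall pi W, good W ->
    (\int[P N \x P k]_z ((miss pi (sel z))%:R * joint_weight tau 1 (u pi) z W)%:E <= rho%:E)%E) ->
  0 <= rho ->
  1 <= rho + beta + expR t * kap / p`!%:R +
    k%:R * information_rate p q tau N b / (t - 1).
Proof.
move=> t1 msel hkap hbeta hrho rho0.
pose jw pi (z : N.-tuple T * k.-tuple T) W := joint_weight tau 1 (u pi) z W.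
have jw0 pi z W : 0 < jw pi z W by exact: joint_weight_gt0.
have mjw pi W : measurable_fun setT (fun z => jw pi z W) by exact: measurable_joint_weight.
have ijw pi W : (\int[P N \x P k]_z (jw pi z W)%:E = 1)%E by exact: integral_joint_weight.
pose a pi z := tot (jw pi z).
pose b0 (z : N.-tuple T * k.-tuple T) := tot (fun W : J => lik (rows_density (coef tau 1)) W z.1).
have jpos : J by exact: [ffun=> [ffun=> false]].
have a0 pi z : 0 < a pi z by apply: tot_gt0.
have ma pi : measurable_fun setT (a pi) by apply: measurable_sum => W; exact: mjw.
have b0pos z : 0 < b0 z.
  by apply: tot_gt0 => // W; apply: lik_gt0 => *; exact: block_density_gt0.
have mb0 : measurable_fun setT b0.
  apply: measurable_sum => W.
  by apply: (measurableT_comp _ measurable_fst); apply: measurable_lik => *; exact: measurable_block_density.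
have ib0 : (\int[P N \x P k]_z (b0 z)%:E = #|J|%:R%:E)%E.
  have l0 n W (X : n.-tuple T) : 0 < lik (rows_density (coef tau 1)) W X.
    by apply: lik_gt0 => *; exact: block_density_gt0.
  have ml n W : measurable_fun setT (@lik _ _ _ _ (rows_density (coef tau 1)) n W : n.-tuple T -> R).
    by apply: measurable_lik => *; exact: measurable_block_density.
  rewrite integral_sum_real; last 2 first.
  - by move=> W; exact: (measurableT_comp (ml N W) measurable_fst).
  - by move=> W z; exact: ltW.
  rewrite (eq_bigr (fun=> (1 : R)%:E)); first by rewrite sumEFin sumr_const.
  move=> W _; have := @integral_fst_snd _ _ _ _ _ (P N) (P k)
    (fun X => lik (rows_density (coef tau 1)) W X) (cst 1) 1 1 (ml N W)
    (measurable_cst _) (fun X => ltW (l0 N W X)) (fun=> ler01).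
  rewrite mulr1 => <-.
  - by apply: eq_integral => z _; rewrite mulr1.
  - by apply: integral_lik => *; [exact: block_density_gt0|exact: measurable_block_density|exact: integral_block_density].
  - exact: (integral_cst_prob (P k) 1%E).
have info pi : (\int[P N \x P k]_z (kl (a pi z) (b0 z))%:E <=
   (#|J|%:R * (k%:R * information_rate p q tau N b))%:E)%E.
  exact: information_bound.
have hf := fano_success_bound t1 a0 b0pos ma mb0 msel ib0 info hkap.
have J0 : 0 < #|J|%:R :> R by rewrite ltr0n; apply/card_gt0P; exists jpos.
have pf0 : 0 < p`!%:R :> R by rewrite ltr0n fact_gt0.
pose A pi W := (\int[P N \x P k]_z ((miss pi (sel z))%:R * jw pi z W)%:E)%E.
have Ale pi W : (A pi W <= (rho + (~~ good W)%:R)%:E)%E.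
  case: (boolP (good W)) => gW; first by rewrite addr0; exact: hrho.
  apply: (@le_trans _ _ 1%E); last by rewrite lee_fin /= lerDr.
  rewrite -(ijw pi W); apply: le_integral_real => //.
  - apply: measurable_funM => //.
    exact: (measurable_fun_selection (fun s => (miss pi s)%:R) msel).
  - by move=> z; rewrite mulr_ge0// ltW.
  - by move=> z; rewrite ler_piMl ?(ltW (jw0 _ _ _))// lern1; case: (miss pi _).
have parts pi : (#|J|%:R%:E = \sum_W A pi W +
    \int[P N \x P k]_z (a pi z * (~~ miss pi (sel z))%:R)%:E)%E.
  rewrite -integral_sum_real; last 2 first.
  - move=> W; apply: measurable_funM => //.
    exact: (measurable_fun_selection (fun s => (miss pi s)%:R) msel).
  - by move=> W z; rewrite mulr_ge0// ltW.
  rewrite -integralD_real; last 4 first.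
  - apply: measurable_sum => W; apply: measurable_funM => //.
    exact: (measurable_fun_selection (fun s => (miss pi s)%:R) msel).
  - apply: measurable_funM => //.
    exact: (measurable_fun_selection (fun s => (~~ miss pi s)%:R) msel).
  - by move=> z; apply: sumr_ge0 => W _; rewrite mulr_ge0// ltW.
  - by move=> z; rewrite mulr_ge0// ltW.
  rewrite -(@integral_tot_joint_weight R p q tau 1 (u pi) N k); apply: eq_integral => z _; congr _%:E.
  rewrite -mulr_sumr -/(a pi z).
  by case: (miss pi _); rewrite ?mul1r ?mul0r ?mulr0 ?mulr1 ?addr0 ?add0r.
have total : ((p`!%:R * #|J|%:R)%:E <= (p`!%:R * (#|J|%:R * (rho + beta)) +
    (expR t * kap * #|J|%:R + p`!%:R * (#|J|%:R * (k%:R * information_rate p q tau N b) /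
      (t - 1))))%:E :> \bar R)%E.
  have -> : ((p`!%:R * #|J|%:R)%:E = \sum_(pi : 'S_p) #|J|%:R%:E :> \bar R)%E.
    by rewrite sumEFin sumr_const card_Sn -[#|J|%:R *+ _]mulr_natl.
  rewrite (eq_bigr _ (fun pi _ => parts pi)).
  rewrite big_split/= EFinD; apply: leeD; last first.
    by apply: (le_trans hf); rewrite lee_fin card_Sn.
  apply: (@le_trans _ _ (\sum_(pi : 'S_p) (#|J|%:R * (rho + beta))%:E)%E); last first.
    by rewrite sumEFin sumr_const card_Sn lee_fin -[leLHS]mulr_natl.
  apply: lee_sum => pi _.
  apply: (@le_trans _ _ (\sum_W (rho + (~~ good W)%:R)%:E)%E).
    by apply: lee_sum => W _; exact: Ale.
  rewrite sumEFin lee_fin big_split/= sumr_const -[X in X + _]mulr_natl mulrDr lerD2l.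
  apply: le_trans hbeta; rewrite -sum1_card natr_sum [leRHS]big_mkcond/=.
  by apply: ler_sum => W _; rewrite inE; case: (good W).
move: total; rewrite lee_fin.
have -> : p`!%:R * (#|J|%:R * (rho + beta)) + (expR t * kap * #|J|%:R +
    p`!%:R * (#|J|%:R * (k%:R * information_rate p q tau N b) / (t - 1))) =
  (p`!%:R * #|J|%:R) * (rho + beta + expR t * kap / p`!%:R +
    k%:R * information_rate p q tau N b / (t - 1)).
  by field; rewrite gt_eqF//=; lra.
by rewrite -[X in X <= _]mulr1 ler_pM2l// mulr_gt0.
Qed.

End sign_fano.

Lemma integral_swap d1 d2 (T1 : measurableType d1) (T2 : measurableType d2)
    (R : realType) (P : probability T1 R) (Q : probability T2 R) (F : T1 * T2 -> R) :
  measurable_fun setT F -> (forall z, 0 <= F z) ->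
  (\int[P \x Q]_z (F z)%:E = \int[Q \x P]_z (F (z.2, z.1))%:E)%E.
Proof.
move=> mF F0.
have mF' : measurable_fun setT (fun z : T2 * T1 => F (z.2, z.1)).
  by apply: measurableT_comp => //; apply/measurable_fun_pair; [exact: measurable_snd|exact: measurable_fst].
rewrite (fubini_tonelli1 (fun z => (F z)%:E)); last 2 first.
- exact/measurable_EFinP.
- by move=> z; rewrite lee_fin.
rewrite (fubini_tonelli2 (fun z => (F (z.2, z.1))%:E))//.
- exact/measurable_EFinP.
- by move=> z; rewrite lee_fin.
Qed.

Section sign_minimax.
Context {R : realType} (p q : nat) (tau : R).
Local Notation Rm := (measurableTypeR R).
Let J := {ffun 'I_q -> {ffun 'I_p -> bool}}.
Implicit Types (W : J) (pi : 'S_p).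
Hypotheses (tau0 : 0 < tau) (tau1 : p%:R * tau ^+ 2 <= 8^-1).
Hypothesis small_norm : 6400 * q%:R * tau ^+ 2 <= 384^-1.
Hypotheses (p0 : (0 < p)%N) (q2 : (2 <= q)%N) (pq : (p <= q)%N).

Let Sg W : 'M[R]_(p + q) := sigma_mx (sign_mx tau W).

Lemma gaussian_density_sign W pi :
  gaussian_density (sigma_mx (col_permuted (sign_mx tau W) pi)) (rows_density (coef tau pi) W).
Proof.
split.
- exact: measurable_block_density.
- exact: block_density_gt0.
- exact: integral_block_density.
- move=> x; rewrite gaussian_pdf_sigma_mx /rows_density; congr (_ * block_density _ x).
  by apply/funext => r; apply/funext => i; rewrite !mxE.
Qed.

Let col_permuted1 (A : 'M[R]_(q, p)) : col_permuted A 1%g = A.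
Proof. by apply/matrixP => r i; rewrite mxE perm1. Qed.

Let extend_permV pi : extend_perm q (pi^-1)%g = (extend_perm q pi)^-1%g.
Proof.
apply/permP => x; apply: (@perm_inj _ (extend_perm q pi)); rewrite permKV.
by rewrite -[x]fintype.splitK; case: (fintype.split x) => a /=; rewrite ?extend_perm_l ?extend_perm_r ?permKV.
Qed.

Let good W := `[< @op_bounded R p q W >] && `[< @rigid R p q W >].

Let card_not_good : #|[pred W | ~~ good W]|%:R <=
  #|J|%:R * (16^-1 + (p + q)`!%:R * expR (- ((p * q)%:R / 96))) :> R.
Proof.
have q0 : (0 < q)%N by exact: ltnW.
have h1 : #|[pred W | ~~ `[< @op_bounded R p q W >]]|%:R <= #|J|%:R / 16 :> R.
  exact: card_not_op_bounded.
have h2 := @card_not_rigid R p q q2 pq.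
rewrite mulrDr; apply: le_trans (lerD h1 h2).
rewrite -natrD ler_nat -(cardUI [pred W | ~~ `[< @op_bounded R p q W >]]).
rewrite (leq_trans _ (leq_addr _ _))//; apply: subset_leq_card.
by apply/fintype.subsetP => W; rewrite !inE negb_and.
Qed.

Let thr : R := tau ^+ 2 * (p * q)%:R / 6144.

Let thr_gt0 : 0 < thr.
Proof.
apply: divr_gt0; last by rewrite ltr0n.
by apply: mulr_gt0; [exact: exprn_gt0|rewrite ltr0n muln_gt0 p0 (leq_trans _ q2)].
Qed.

Let contracting W : good W ->
  forall x : 'cV[R]_(p + q), \sum_i (Sg W *m x) i 0 ^+ 2 <= \sum_i x i 0 ^+ 2.
Proof.
move=> /andP[/asboolP gW _]; apply: (sigma_mx_contracting _ _ (bounded_sign_mx tau gW)).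
  apply: (le_trans small_norm); lra.
exact: mulr_ge0 (mulr_ge0 (ler0n R 6400) (ler0n R q)) (sqr_ge0 tau).
Qed.

Let in_parameters W pi (s : 'S_(p + q)) : good W ->
  parameters (s, sigma_mx (col_permuted (sign_mx tau W) pi)).
Proof.
move=> gW; split=> /=; first exact: positive_definite_sigma_mx.
rewrite -conj_extend_perm_sigma_mx; apply: operator_norm_le1.
by apply: conj_perm_contracting; exact: contracting.
Qed.

Let thr_le W s : good W -> (p <= 2 * #|moved s|)%N ->
  thr <= frobenius_norm (conj_perm (Sg W) s - Sg W) ^+ 2.
Proof. by move=> /andP[/asboolP oW /asboolP rW]; exact: sign_loss_ge. Qed.

(** If [n] is the smaller size, [X] has the unpermuted law and the permutation
    acts on [Y]. Otherwise the covariance itself is permuted by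
    the inverse of [pi], so that the sample [Y] has the unpermuted law, and the
    roles of the two samples are exchanged. *)
Lemma sign_minimax (m n : nat) (pihat : samples R m n (p + q) -> 'S_(p + q))
    (b : bool) (t r : R) (g : nat) :
  estimator pihat -> 1 < t -> 0 <= r -> (2 * g <= p)%N ->
  (forall s S, parameters (s, S) -> (risk pihat S s <= r%:E)%E) ->
  1 <= r / thr + (16^-1 + (p + q)`!%:R * expR (- ((p * q)%:R / 96))) +
    expR t / g`!%:R +
    (minn m n)%:R * information_rate p q tau (maxn m n) b / (t - 1).
Proof.
move=> mpi t1 r0 gp hr.
have fg : 0 < g`!%:R :> R by rewrite ltr0n fact_gt0.
have fp : 0 < p`!%:R :> R by rewrite ltr0n fact_gt0.
have near (T' : 'S_p -> 'S_(p + q) -> nat) s :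
  (forall pi, T' pi s = (p - #|agree s pi|)%N) ->
  #|[pred pi | ~~ (p <= 2 * T' pi s)%N]|%:R <= p`!%:R / g`!%:R :> R.
  move=> TE; rewrite ler_pdivlMr// -natrM ler_nat.
  apply: leq_trans (card_agree_le s g); rewrite leq_mul2r; apply/orP; right.
  apply: subset_leq_card; apply/fintype.subsetP => pi; rewrite !inE TE -ltnNge.
  by move: #|agree s pi| gp => a; clear; lia.
have kapE : expR t * (p`!%:R / g`!%:R) / p`!%:R = expR t / g`!%:R :> R.
  by field; rewrite !gt_eqF.
rewrite -kapE.
have div_thr (x : \bar R) : (thr%:E * x <= r%:E)%E -> (x <= (r / thr)%:E)%E.
  by rewrite -lee_pdivlMl// -EFinM mulrC.
have rt0 : 0 <= r / thr by rewrite divr_ge0// ltW.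
have [nm|mn] := leqP n m.
- apply: (sign_fano tau0 tau1 p0 nm (u := id) (sel := pihat)
    (miss := fun pi s => (p <= 2 * #|moved ((extend_perm q pi)^-1 * s)%g|)%N) (good := good)) => //.
  + by move=> s; apply: (near (fun pi s => #|moved ((extend_perm q pi)^-1 * s)%g|)) => pi; exact: moved_right.
  + move=> pi W gW; apply: div_thr.
    apply: le_trans (hr (extend_perm q pi) (Sg W) _); last first.
      by rewrite /Sg -[sign_mx tau W]col_permuted1; exact: in_parameters.
    have dS : gaussian_density (Sg W) (rows_density (coef tau 1%g) W).
      by rewrite /Sg -[sign_mx tau W]col_permuted1; exact: gaussian_density_sign.
    have dSs : gaussian_density (conj_perm (Sg W) (extend_perm q pi)) (rows_density (coef tau pi) W).
      by rewrite /Sg conj_extend_perm_sigma_mx; exact: gaussian_density_sign.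
    apply: (risk_ge dS dSs mpi (ltW thr_gt0) (A := fun s =>
      (p <= 2 * #|moved ((extend_perm q pi)^-1 * s)%g|)%N)) => s hs.
    apply: le_trans (thr_le gW hs) _.
    rewrite -(frobenius_conj_perm _ (extend_perm q pi)) le_eqVlt; apply/orP; left; apply/eqP.
    congr (frobenius_norm _ ^+ 2); apply/matrixP => x y.
    by rewrite !mxE !permM !permK.
- apply: (sign_fano tau0 tau1 p0 (ltnW mn) (u := fun pi => pi^-1%g)
    (sel := fun z => pihat (z.2, z.1))
    (miss := fun pi s => (p <= 2 * #|moved (s * (extend_perm q pi)^-1)%g|)%N) (good := good)) => //.
  + move=> s.
    have msw : measurable_fun setT (fun z : n.-tuple ((p + q).-tuple Rm) *
        m.-tuple ((p + q).-tuple Rm) => (z.2, z.1)).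
      by apply/measurable_fun_pair; [exact: measurable_snd|exact: measurable_fst].
    rewrite -[X in measurable X]setTI.
    exact: (msw measurableT _ (mpi s)).
  + by move=> s; apply: (near (fun pi s => #|moved (s * (extend_perm q pi)^-1)%g|)) => pi; exact: moved_left.
  + move=> pi W gW; apply: div_thr.
    pose S := sigma_mx (col_permuted (sign_mx tau W) pi^-1%g).
    have SE : S = conj_perm (Sg W) ((extend_perm q pi)^-1)%g by rewrite -extend_permV conj_extend_perm_sigma_mx.
    have SsE : conj_perm S (extend_perm q pi) = Sg W.
      by rewrite SE conj_permM mulgV; apply/matrixP => x y; rewrite mxE !perm1.
    apply: le_trans (hr (extend_perm q pi) S _); last exact: in_parameters.
    pose T := (p + q).-tuple Rm.
    pose Gx : probability T R := tuple_power (gauss1 R) (p + q).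
    pose P n : probability (n.-tuple T) R := tuple_power Gx n.
    pose A s := (p <= 2 * #|moved (s * (extend_perm q pi)^-1)%g|)%N.
    pose f := rows_density (coef tau pi^-1%g) W; pose f' := rows_density (coef tau 1%g) W.
    have dS : gaussian_density S f by exact: gaussian_density_sign.
    have dSs : gaussian_density (conj_perm S (extend_perm q pi)) f'.
      by rewrite SsE /Sg -[sign_mx tau W]col_permuted1; exact: gaussian_density_sign.
    have hA s : A s -> thr <= frobenius_norm (conj_perm S s - conj_perm S (extend_perm q pi)) ^+ 2.
      by move=> hs; rewrite SsE SE conj_permM; exact: thr_le.
    apply: le_trans (risk_ge dS dSs mpi (ltW thr_gt0) hA).
    rewrite le_eqVlt; apply/orP; left; apply/eqP; congr (_ * _)%E.
    pose F (z : m.-tuple T * n.-tuple T) : R := (A (pihat z))%:R * lik2 f f' z.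
    have [mf f0 _ _] := dS; have [mf' f'0 _ _] := dSs.
    have mF : measurable_fun setT F.
      apply: measurable_funM; first exact: (measurable_fun_selection (fun t => (A t)%:R) mpi).
      by apply: measurable_lik2.
    have F0 z : 0 <= F z by rewrite mulr_ge0// lik2_ge0.
    rewrite -[RHS]/(\int[P m \x P n]_z (F z)%:E)%E (integral_swap _ _ mF F0).
    by apply: eq_integral => z _; congr (_ * _)%:E; rewrite /joint_weight /lik2/= mulrC.
Qed.

End sign_minimax.

(** * Choice of the signal strength in large dimension *)

Section large_dimension.
Context {R : realType}.

Lemma expn_le_fact a b : (a ^ b <= (a + b)`!)%N.
Proof.
elim: b => [|b IH]; first by rewrite fact_gt0.
rewrite expnS addnS factS leq_mul//; lia.
Qed.

Lemma fact_le_expn n a : (n <= a)%N -> (n`! <= a ^ n)%N.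
Proof.
elim: n => [|n IH] na //.
by rewrite factS expnS leq_mul// IH// ltnW.
Qed.

Lemma expRN3_le : expR (- 3) <= 8^-1 :> R.
Proof.
have := @expRN1_le R; have := expR_gt0 (- (1 : R)).
have -> : expR (- 3) = expR (- (1 : R)) ^+ 3 by rewrite -expRM_natl; congr expR; ring.
move: (expR _) => e e0 e1.
have e2 : e ^+ 2 <= 4^-1 by nra.
rewrite exprS; nra.
Qed.

Let eighth (d : nat) : (16 <= d)%N -> (d <= 16 * (d %/ 8))%N.
Proof. lia. Qed.

Let quarter (d : nat) : (d %/ 8 + d %/ 8 <= d %/ 4)%N.
Proof. lia. Qed.

Let halves (d : nat) : (16 <= d)%N -> (d ^ 2 <= d %/ 2 * (d - d %/ 2) * 8)%N.
Proof.
move=> d16; have := divn_eq d 2; have : (d %% 2 < 2)%N by rewrite ltn_mod.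
move: (d %/ 2)%N (d %% 2)%N => p e e2 dE.
have -> : (d - p = p + e)%N by lia.
have p7 : (7 <= p)%N by lia.
rewrite dE expnS expn1; nia.
Qed.

Variables (d : nat).
Let D : R := d%:R.
Let L : R := ln D.
Let s : R := Num.sqrt D.
Hypothesis hs : (64 * 64) <= s.

Let s2 : s ^+ 2 = D. Proof. by rewrite sqr_sqrtr ?ler0n. Qed.
Let Dbig : (64 * 64) * s <= D. Proof. by rewrite -s2 expr2; apply: ler_wpM2r; [exact: sqrtr_ge0|exact: hs]. Qed.
Let Dbig2 : (64 * 64) * (64 * 64) <= D.
Proof. have := hs; have := Dbig; lra. Qed.
Let D0 : 0 < D.
Proof. have := Dbig2; lra. Qed.
Let s0 : 0 < s.
Proof. have := hs; lra. Qed.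
Let LE : L = 2 * ln s.
Proof. by rewrite /L -s2 lnXn// mulr_natl. Qed.
Let L_le : L <= 2 * s.
Proof. by have := ln_le_sub1 s0; rewrite LE; lra. Qed.
Let L_ge : 2^-1 <= L.
Proof.
have Dv0 : 0 < D^-1 by rewrite invr_gt0.
have := ln_le_sub1 Dv0; rewrite lnV ?posrE// -/L.
have : D^-1 <= 2^-1 by rewrite lef_pV2 ?posrE//; have := Dbig2; lra.
lra.
Qed.
Let DL_ge : 256 <= D * L.
Proof.
have : D * 2^-1 <= D * L by rewrite ler_wpM2l// ltW.
have := Dbig2; lra.
Qed.

Let d16 : (16 <= d)%N.
Proof. by rewrite -(ler_nat R) -/D; have := Dbig2; lra. Qed.

Lemma large_dimension_ge : 256 <= D * L /\ (16 <= d)%N.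
Proof. by split; [exact: DL_ge|exact: d16]. Qed.

Lemma sqr_le_halves : D ^+ 2 / 8 <= (d %/ 2 * (d - d %/ 2))%:R.
Proof.
rewrite ler_pdivrMr// -natrX -natrM ler_nat.
exact: halves.
Qed.

(** The factorial is at least [a ^ a] with [a] of order [d / 8] and at least
    [sqrt d], so its logarithm is of order [d * ln d]. *)
Lemma fact_quarter_ge : expR (1 + D * L / 64) / (d %/ 4)`!%:R <= 8^-1.
Proof.
set a := (d %/ 8)%N; have d1 := Dbig; have d2 := Dbig2; have dl := DL_ge; have s1 := hs.
have L1 := L_ge.
have a16 : (d <= 16 * a)%N by exact: eighth.
have aD : D / 16 <= a%:R by rewrite ler_pdivrMr// mulrC -natrM ler_nat.
have a0 : 0 < a%:R :> R by lra.
have sa : s <= a%:R by lra.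
have lna : L / 2 <= ln a%:R by rewrite LE mulrC mulKf// ler_ln ?posrE//; lra.
have fg : (a ^ a <= (d %/ 4)`!)%N.
  by apply: (leq_trans (expn_le_fact a a)); apply: leq_fact; exact: quarter.
have fgR : expR (D * L / 32) <= (d %/ 4)`!%:R.
  apply: (@le_trans _ _ (a ^ a)%:R); last by rewrite ler_nat.
  rewrite natrX -[leRHS]lnK ?posrE ?exprn_gt0// ler_expR lnXn// -mulr_natl.
  have : D / 16 * (L / 2) <= a%:R * ln a%:R by apply: ler_pM => //; lra.
  lra.
rewrite ler_pdivrMr ?ltr0n ?fact_gt0//.
apply: (@le_trans _ _ (8^-1 * expR (D * L / 32))); last by rewrite ler_wpM2l.
apply: le_trans (ler_wpM2r (expR_ge0 _) expRN3_le).
rewrite -expRD ler_expR; lra.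
Qed.

(** The exponent [d * ln d] of the factorial is negligible before [d ^ 2]. *)
Lemma fact_mul_expRN_le : d`!%:R * expR (- ((d %/ 2 * (d - d %/ 2))%:R / 96)) <= 16^-1 :> R.
Proof.
have d1 := Dbig; have d2 := Dbig2; have s1 := hs; have l1 := L_le.
have pq8 := sqr_le_halves.
have fR : d`!%:R <= expR (D * L).
  apply: (@le_trans _ _ (d ^ d)%:R); first by rewrite ler_nat fact_le_expn.
  rewrite natrX -[leLHS]lnK ?posrE ?exprn_gt0// ler_expR lnXn// -[ln _ *+ d]mulr_natl.
  exact: lexx.
apply: (@le_trans _ _ (expR (D * L) * expR (- (D ^+ 2 / 8 / 96)))).
  apply: ler_pM; [exact: ler0n|exact: expR_ge0|exact: fR|].
  rewrite ler_expR; lra.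
have e4 : expR (- 4) <= 16^-1 :> R.
  have -> : expR (- 4 : R) = expR (- 3) * expR (- 1) by rewrite -expRD; congr expR; ring.
  have := expRN3_le; have := @expRN1_le R; have := expR_ge0 (- 3 : R); have := expR_ge0 (- 1 : R).
  move: (expR _) (expR _) => e f; nra.
apply: le_trans e4; rewrite -expRD ler_expR.
have : D * L <= D * (2 * s) by rewrite ler_wpM2l// ltW.
have : D * ((64 * 64) * s) <= D ^+ 2 by rewrite expr2 ler_wpM2l// ltW.
have : D * ((64 * 64) * (64 * 64)) <= D * ((64 * 64) * s) by apply: ler_wpM2l; lra.
lra.
Qed.

End large_dimension.

Section signal_strength.
Context {R : realType} (c D K N L : R).
Hypotheses (c0 : 0 < c) (c1 : 80 * 80 * c <= 1) (D0 : 0 < D) (K0 : 0 < K) (N0 : 0 < N)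
  (L0 : 0 < L) (LK : L <= K) (DN : D <= N).

Let x : R := L / (D * K).
Let y : R := Num.sqrt (L / (D * K * N)).

(** Squared amplitude of the signs. The first term of the maximum is the strength
    at which the small sample reveals the permutation when the signs are known;
    the second one is the strength at which it does so when the signs have to be
    learnt from the large sample. *)
Definition signal : R := c * Num.max x y.

Let x0 : 0 < x. Proof. by rewrite divr_gt0// mulr_gt0. Qed.
Let y0 : 0 < y. Proof. by rewrite sqrtr_gt0 divr_gt0// !mulr_gt0. Qed.
Let y2 : y ^+ 2 = L / (D * K * N).
Proof. by rewrite sqr_sqrtr// divr_ge0// ltW// !mulr_gt0. Qed.
Let Dx : D * x = L / K. Proof. by rewrite /x; field; rewrite !gt_eqF. Qed.
Let D2y2 : (D * y) ^+ 2 = D / N * (L / K).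
Proof. by rewrite exprMn y2; field; rewrite !gt_eqF. Qed.
Let lk1 : 0 < L / K <= 1. Proof. by rewrite divr_gt0//= ler_pdivrMr// mul1r. Qed.
Let dn1 : 0 < D / N <= 1. Proof. by rewrite divr_gt0//= ler_pdivrMr// mul1r. Qed.

Lemma signal_gt0 : 0 < signal.
Proof. by rewrite mulr_gt0// lt_max x0. Qed.

Lemma signal_le : D * signal <= c.
Proof.
have /andP[_ lk] := lk1; have /andP[dn0 dn] := dn1; have /andP[lk0 _] := lk1.
have Dy1 : D * y <= 1.
  rewrite -(@ler_pXn2r _ 2)// ?nnegrE ?mulr_ge0 ?(ltW D0) ?(ltW y0)// expr1n D2y2.
  nra.
rewrite /signal mulrCA -[leRHS]mulr1 ler_pM2l//.
by case: (leP x y) => _; rewrite ?Dx.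
Qed.

Lemma signal_ge : c / 2 * (D * L / K + Num.sqrt (D ^+ 3 * L / (K * N))) <= D ^+ 2 * signal.
Proof.
have -> : Num.sqrt (D ^+ 3 * L / (K * N)) = D ^+ 2 * y.
  have Dy0 : 0 <= D ^+ 2 * y by rewrite mulr_ge0 ?sqr_ge0 ?(ltW y0).
  rewrite -[RHS](ger0_norm Dy0) -sqrtr_sqr exprMn y2; congr Num.sqrt.
  by field; rewrite !gt_eqF.
have -> : D * L / K = D ^+ 2 * x by rewrite /x; field; rewrite !gt_eqF.
have h1 : x <= Num.max x y by rewrite le_max lexx.
have h2 : y <= Num.max x y by rewrite le_max lexx orbT.
rewrite -mulrDr mulrCA /signal ler_pM2l ?exprn_gt0// -mulrA ler_pM2l//; lra.
Qed.

(** When the first term of the maximum dominates, the trivial bound on the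
    posterior mean is the better one, and when the second term dominates, the
    Hellinger bound is. *)
Lemma signal_information : let e := if y <= x then 1 else 16 * N * signal in
  K * (D * (8 * D * signal * e + 512 * (D * signal) ^+ 2)) <= D * L / 512.
Proof.
have w0 : 0 <= c ^+ 2 by exact: sqr_ge0.
have cc : c ^+ 2 <= c / (80 * 80).
  rewrite ler_pdivlMr ?mulr_gt0//.
  have := ler_wpM2l (ltW c0) c1; rewrite mulr1; apply: le_trans.
  by have -> : c ^+ 2 * (80 * 80) = c * (80 * 80 * c) by ring.
have /andP[_ lk] := lk1; have /andP[_ dn] := dn1; have /andP[lk0 _] := lk1; have /andP[dn0 _] := dn1.
have h0 := c0; have h1 := c1; rewrite /signal /=; case: (leP y x) => yx.
- have -> : K * (D * (8 * D * (c * x) * 1 + 512 * (D * (c * x)) ^+ 2)) =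
      D * L * (8 * c + 512 * c ^+ 2 * (L / K)).
    by rewrite /x; field; rewrite !gt_eqF.
  rewrite ler_pM2l ?mulr_gt0//.
  have : c ^+ 2 * (L / K) <= c ^+ 2 by rewrite ler_piMr.
  lra.
- have -> : K * (D * (8 * D * (c * y) * (16 * N * (c * y)) + 512 * (D * (c * y)) ^+ 2)) =
      D * L * (c ^+ 2 * (128 + 512 * (D / N))).
    rewrite mulrDr [8 * D * _ * _](_ : _ = 128 * c ^+ 2 * (N / D) * (D * y) ^+ 2); last first.
      by field; rewrite gt_eqF.
    rewrite [D * (c * y)]mulrCA [(c * (D * y)) ^+ 2]exprMn D2y2; field.
    by rewrite !gt_eqF.
  rewrite ler_pM2l ?mulr_gt0//.
  have : c ^+ 2 * (D / N) <= c ^+ 2 by rewrite ler_piMr.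
  lra.
Qed.

End signal_strength.

Section large_dimension_bound.
Context {R : realType} (p q m n : nat).
Let d := (p + q)%N.
Hypothesis pE : p = (d %/ 2)%N.

Let rate_mono (A B x y z v e : R) : 0 <= A -> 0 <= B -> 0 <= v -> 0 <= e ->
  0 <= x -> 0 <= y -> x <= z -> y <= z ->
  y * (A * x * v * e + B * (x * v) ^+ 2) <= z * (A * z * v * e + B * (z * v) ^+ 2).
Proof.
move=> A0 B0 v0 e0 x0 y0 xz yz.
have xv0 : 0 <= x * v by exact: mulr_ge0.
apply: ler_pM => //.
  by apply: addr_ge0; apply: mulr_ge0; rewrite ?sqr_ge0// mulr_ge0// mulr_ge0.
apply: lerD.
  by rewrite !ler_wpM2r// ler_wpM2l.
by rewrite ler_wpM2l// lerXn2r ?nnegrE ?ler_wpM2r// mulr_ge0// (le_trans x0).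
Qed.

Let half_le (a b e i : R) : 1 <= a + (16^-1 + b) + e + i ->
  b <= 16^-1 -> e <= 8^-1 -> i <= 8^-1 -> 2^-1 <= a.
Proof. lra. Qed.

Let double_le (a r : R) : 0 < a -> 2^-1 <= r / a -> a <= 2 * r.
Proof. by move=> a0; rewrite ler_pdivlMr//; lra. Qed.

Let pq : (p <= q)%N.
Proof. by move: pE; rewrite /d; lia. Qed.

Let pq2 : (16 <= d)%N -> (0 < p)%N /\ (2 <= q)%N.
Proof. by move: pE; rewrite /d => h1 h2; split; lia. Qed.

Let qE : q = (d - d %/ 2)%N.
Proof. by rewrite -pE /d addKn. Qed.

Let gp : (2 * (d %/ 4) <= p)%N.
Proof. by move: pE; rewrite /d; lia. Qed.

Hypothesis d_large : 64 * 64 <= Num.sqrt d%:R :> R.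
Hypotheses (m0 : (0 < m)%N) (n0 : (0 < n)%N).
Let k := minn m n.
Let N := maxn m n.
Hypotheses (Lk : ln d%:R <= k%:R :> R) (dN : (d <= N)%N).

Variable c : R.
Hypotheses (c0 : 0 < c) (c_small : 6400 * c <= 384^-1).

Let c1 : 80 * 80 * c <= 1.
Proof.
have -> : 80 * 80 = 6400 :> R by rewrite -natrM.
apply: (le_trans c_small); lra.
Qed.

Lemma large_dimension_bound (pihat : samples R m n (p + q) -> 'S_(p + q)) (r : R) :
  estimator pihat -> 0 <= r ->
  (forall s S, parameters (s, S) -> (risk pihat S s <= r%:E)%E) ->
  c / 2 * (d%:R * ln d%:R / k%:R + Num.sqrt (d%:R ^+ 3 * ln d%:R / (m%:R * n%:R))) <=
    8 * (6144 * 2) * r.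
Proof.
move=> mpi r0 hr.
have [dL d16] := large_dimension_ge d_large.
set D : R := d%:R in dL *; set L : R := ln D in dL *; set K : R := k%:R in dL *.
have D0 : 0 < D by rewrite ltr0n; exact: leq_trans d16.
have k0 : (0 < k)%N by rewrite /k leq_min m0.
have K0 : 0 < K by rewrite ltr0n.
have kN : (k <= N)%N by rewrite /k /N geq_min leq_max leqnn.
have N0 : 0 < N%:R :> R by rewrite ltr0n (leq_trans k0).
have L0 : 0 < L by rewrite -(pmulr_rgt0 _ D0); lra.
have DN : D <= N%:R by rewrite ler_nat.
pose v := signal c D K N%:R L.
have v0 : 0 < v by exact: signal_gt0.
pose tau := Num.sqrt v.
have tau2 : tau ^+ 2 = v by rewrite sqr_sqrtr// ltW.
have tau0 : 0 < tau by rewrite sqrtr_gt0.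
have Dv : D * v <= c by exact: signal_le.
have pD : p%:R <= D by rewrite ler_nat leq_addr.
have qD : q%:R <= D by rewrite ler_nat leq_addl.
have pv : p%:R * v <= D * v by rewrite ler_wpM2r// ltW.
have qv : q%:R * v <= D * v by rewrite ler_wpM2r// ltW.
have [p0 q2] := pq2 d16.
have tau1 : p%:R * tau ^+ 2 <= 8^-1 by rewrite tau2; have := c1; lra.
have small : 6400 * q%:R * tau ^+ 2 <= 384^-1.
  rewrite tau2 -mulrA; apply: le_trans c_small.
  by apply: ler_wpM2l; [exact: ler0n|exact: le_trans qv Dv].
pose y := L / (D * K) >= Num.sqrt (L / (D * K * N%:R)).
have t1 : 1 < 1 + D * L / 64 by rewrite ltrDl divr_gt0// mulr_gt0.
(* [t1] chooses the threshold of the Fano inequality: [expR (D * L / 64)] is small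
   before the factorial and [D * L / 64] is large before the information *)
have := sign_minimax tau0 tau1 small p0 q2 pq y mpi t1 r0 gp hr.
rewrite -/k -/N -/K tau2 -/d.
have bad : d`!%:R * expR (- ((p * q)%:R / 96)) <= 16^-1 :> R.
  by rewrite {1}pE qE; exact: fact_mul_expRN_le.
have near := fact_quarter_ge d_large; rewrite -/D -/L in near.
have info : K * information_rate p q tau N y / (1 + D * L / 64 - 1) <= 8^-1.
  have DL64 : 0 < D * L / 64 by rewrite divr_gt0// mulr_gt0.
  have -> : 1 + D * L / 64 - 1 = D * L / 64 by ring.
  rewrite ler_pdivrMr//.
  have h := signal_information c0 c1 D0 K0 N0 L0 Lk DN.
  apply: (@le_trans _ _ (D * L / 512)); last by rewrite le_eqVlt; apply/orP; left; apply/eqP; field.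
  apply: le_trans h; rewrite ler_pM2l// /information_rate tau2 -/y -/v.
  have e0 : 0 <= (if y then 1 else 16 * N%:R * v) by case: y => //; rewrite mulr_ge0 ?ltW// mulr_gt0.
  have v0' := ltW v0.
  exact: (rate_mono (ler0n R 8) (ler0n R 512)).
have pq8 : D ^+ 2 / 8 <= (p * q)%:R.
  by rewrite {1}pE qE; exact: sqr_le_halves.
have pq0 : 0 < (p * q)%:R :> R by rewrite ltr0n muln_gt0 p0 ltnW.
move=> H.
have thr0 : 0 < v * (p * q)%:R / 6144 by rewrite divr_gt0 ?ltr0n// mulr_gt0.
have := double_le thr0 (half_le H bad near info).
rewrite ler_pdivrMr ?ltr0n// => H3.
have H4 : v * (D ^+ 2 / 8) <= v * (p * q)%:R by rewrite ler_pM2l.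
have mn : m%:R * n%:R = K * N%:R :> R.
  by rewrite -!natrM /k /N; congr _%:R; case: leqP => _ //; rewrite mulnC.
have H5 := signal_ge c0 D0 K0 N0 L0.
rewrite mn -/D -/L; apply: (le_trans H5).
rewrite -/v [leLHS](_ : _ = 8 * (v * (D ^+ 2 / 8))); last by field.
apply: (@le_trans _ _ (8 * (2 * r * 6144))); first by rewrite ler_pM2l//; exact: le_trans H4 H3.
by rewrite le_eqVlt; apply/orP; left; apply/eqP; ring.
Qed.

End large_dimension_bound.

(** * Lower bound from two hypotheses, for bounded dimension *)

Section two_points.
Context {R : realType} (d : nat).
Local Notation Rm := (measurableTypeR R).
Let T := d.-tuple Rm.
Let Gx : probability T R := tuple_power (gauss1 R) d.
Let Pw n : probability (n.-tuple T) R := tuple_power Gx n.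

Lemma integral_lik2 m n (f g : T -> R) (a b : R) :
  measurable_fun setT f -> measurable_fun setT g ->
  (forall x, 0 <= f x) -> (forall x, 0 <= g x) ->
  (\int[Gx]_x (f x)%:E = a%:E)%E -> (\int[Gx]_x (g x)%:E = b%:E)%E ->
  (\int[Pw m \x Pw n]_z (lik2 f g z)%:E = (a ^+ m * b ^+ n)%:E)%E.
Proof.
move=> mf mg f0 g0 fa gb.
have mF : measurable_fun setT (fun X : m.-tuple T => \prod_i f (tnth X i)).
  by apply: (measurable_tuple_prod (h := fun=> f)) => i; exact: mf.
have mG : measurable_fun setT (fun Y : n.-tuple T => \prod_i g (tnth Y i)).
  by apply: (measurable_tuple_prod (h := fun=> g)) => i; exact: mg.
have iF : (\int[Pw m]_X (\prod_i f (tnth X i))%:E = (a ^+ m)%:E)%E.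
  rewrite (@integral_tuple_power_prod _ _ _ Gx m (fun=> f) (fun=> a))//.
  by rewrite prodr_const card_ord.
have iG : (\int[Pw n]_Y (\prod_i g (tnth Y i))%:E = (b ^+ n)%:E)%E.
  rewrite (@integral_tuple_power_prod _ _ _ Gx n (fun=> g) (fun=> b))//.
  by rewrite prodr_const card_ord.
by apply: (integral_fst_snd mF mG _ _ iF iG) => X; exact: prodr_ge0.
Qed.

(** For [a <= b], with [u] and [v] the square roots, this is [(v - 2 * u) ^+ 2 >= 0]. *)
Lemma sqrt_le_min (a b : R) : 0 <= a -> 0 <= b ->
  Num.sqrt (a * b) <= Num.min a b + 4^-1 * (a + b).
Proof.
wlog ab : a b / a <= b => [H a0 b0|a0 b0].
  have [ab|/ltW ba] := leP a b.
    by have := H a b ab a0 b0; rewrite (min_l ab).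
  by have := H b a ba b0 a0; rewrite (min_l ba) mulrC [b + a]addrC.
rewrite (min_l ab) sqrtrM//.
have := sqr_sqrtr a0; have := sqr_sqrtr b0; have := sqrtr_ge0 a; have := sqrtr_ge0 b.
move: (Num.sqrt a) (Num.sqrt b) => u v v0 u0 <- <-.
have := sqr_ge0 (v - 2 * u); nra.
Qed.

(** Every decision has a large loss for one of the two parameters, so the sum of
    the two risks is at least the overlap of the two laws of the data, which is
    bounded from below by their affinity. *)
Lemma two_point_bound m n (S1 S2 : 'M[R]_d) (s1 s2 : 'S_d) (f1 f2 g1 g2 : T -> R)
    (pihat : samples R m n d -> 'S_d) (thr a b r : R) :
  gaussian_density S1 f1 -> gaussian_density (conj_perm S1 s1) g1 ->
  gaussian_density S2 f2 -> gaussian_density (conj_perm S2 s2) g2 ->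
  estimator pihat -> 0 < thr ->
  (forall s, (thr <= frobenius_norm (conj_perm S1 s - conj_perm S1 s1) ^+ 2) ||
    (thr <= frobenius_norm (conj_perm S2 s - conj_perm S2 s2) ^+ 2)) ->
  (\int[Gx]_x (Num.sqrt (f1 x * f2 x))%:E = a%:E)%E ->
  (\int[Gx]_x (Num.sqrt (g1 x * g2 x))%:E = b%:E)%E ->
  (risk pihat S1 s1 <= r%:E)%E -> (risk pihat S2 s2 <= r%:E)%E ->
  a ^+ m * b ^+ n <= 2 * (r / thr) + 2^-1.
Proof.
move=> d1 e1 d2 e2 mpi thr0 loss ia ib r1 r2.
have [mf1 f10 if1 _] := d1; have [mg1 g10 ig1 _] := e1.
have [mf2 f20 if2 _] := d2; have [mg2 g20 ig2 _] := e2.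
pose A1 s := thr <= frobenius_norm (conj_perm S1 s - conj_perm S1 s1) ^+ 2.
pose A2 s := thr <= frobenius_norm (conj_perm S2 s - conj_perm S2 s2) ^+ 2.
have div_thr (x : \bar R) : (thr%:E * x <= r%:E)%E -> (x <= (r / thr)%:E)%E.
  by rewrite -lee_pdivlMl// -EFinM mulrC.
have h1 := div_thr _ (le_trans (risk_ge d1 e1 mpi (ltW thr0) (A := A1) (fun s h => h)) r1).
have h2 := div_thr _ (le_trans (risk_ge d2 e2 mpi (ltW thr0) (A := A2) (fun s h => h)) r2).
pose l1 (z : m.-tuple T * n.-tuple T) : R := lik2 f1 g1 z.
pose l2 (z : m.-tuple T * n.-tuple T) : R := lik2 f2 g2 z.
pose w1 z : R := (A1 (pihat z))%:R * l1 z.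
pose w2 z : R := (A2 (pihat z))%:R * l2 z.
have ml1 : measurable_fun setT l1 by exact: measurable_lik2.
have ml2 : measurable_fun setT l2 by exact: measurable_lik2.
have l10 z : 0 <= l1 z by exact: lik2_ge0.
have l20 z : 0 <= l2 z by exact: lik2_ge0.
have mw1 : measurable_fun setT w1.
  by apply: measurable_funM => //; exact: (measurable_fun_selection (fun s => (A1 s)%:R) mpi).
have mw2 : measurable_fun setT w2.
  by apply: measurable_funM => //; exact: (measurable_fun_selection (fun s => (A2 s)%:R) mpi).
have w10 z : 0 <= w1 z by exact: mulr_ge0.
have w20 z : 0 <= w2 z by exact: mulr_ge0.
have q4 : 0 <= 4^-1 :> R by rewrite invr_ge0.
have i1 : (\int[Pw m \x Pw n]_z (l1 z)%:E = 1%:E)%E.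
  rewrite (@integral_lik2 m n f1 g1 1 1)//; first by rewrite !expr1n mulr1.
  - by move=> x; exact: ltW.
  - by move=> x; exact: ltW.
have i2 : (\int[Pw m \x Pw n]_z (l2 z)%:E = 1%:E)%E.
  rewrite (@integral_lik2 m n f2 g2 1 1)//; first by rewrite !expr1n mulr1.
  - by move=> x; exact: ltW.
  - by move=> x; exact: ltW.
pose sf x := Num.sqrt (f1 x * f2 x); pose sg x := Num.sqrt (g1 x * g2 x).
have msf : measurable_fun setT sf.
  by apply: measurable_fun_sqrt; [move=> x; exact: mulr_gt0|exact: measurable_funM].
have msg : measurable_fun setT sg.
  by apply: measurable_fun_sqrt; [move=> x; exact: mulr_gt0|exact: measurable_funM].
have sqE z : lik2 sf sg z = Num.sqrt (l1 z * l2 z).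
  rewrite /l1 /l2 /lik2 mulrACA -!big_split/= sqrtrM; last first.
    by apply: prodr_ge0 => i _; exact/ltW/mulr_gt0.
  by rewrite !sqrtr_prod// => i; exact/ltW/mulr_gt0.
have isq : (\int[Pw m \x Pw n]_z (lik2 sf sg z)%:E = (a ^+ m * b ^+ n)%:E)%E.
  by apply: integral_lik2 => // x; exact: sqrtr_ge0.
rewrite -lee_fin -isq.
have m12 : measurable_fun setT (fun z => 4^-1 * (l1 z + l2 z)).
  by apply: measurable_funM => //; exact: measurable_funD.
have mw : measurable_fun setT (fun z => w1 z + w2 z) by exact: measurable_funD.
have l120 z : 0 <= l1 z + l2 z by exact: addr_ge0.
apply: (@le_trans _ _ (\int[Pw m \x Pw n]_z (w1 z + w2 z + 4^-1 * (l1 z + l2 z))%:E)%E).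
  apply: le_integral_real.
  - exact: measurable_lik2.
  - exact: measurable_funD.
  - by move=> z; rewrite sqE; exact: sqrtr_ge0.
  - move=> z; rewrite sqE; apply: le_trans (sqrt_le_min (l10 z) (l20 z)) _.
    rewrite lerD2r; have := loss (pihat z); rewrite -/(A1 _) -/(A2 _) /w1 /w2.
    case: (A1 _) => /= [_|->]; rewrite ?mul1r ?mul0r ?add0r ?ge_min ?lexx ?orbT//.
    rewrite (le_trans (y := l1 z))// ?ge_min ?lexx// lerDl mulr_ge0//.
rewrite integralD_real//; last 2 first.
- by move=> z; exact: addr_ge0.
- by move=> z; exact: mulr_ge0.
rewrite integralZ_real//; last exact: measurable_funD.
rewrite !integralD_real// i1 i2 -EFinD -EFinM EFinD.
apply: leeD; last by rewrite lee_fin; lra.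
have -> : 2 * (r / thr) = r / thr + r / thr by ring.
by rewrite EFinD; apply: leeD.
Qed.

End two_points.

Section variance_tilt.
Context {R : realType}.
Local Notation Rm := (measurableTypeR R).

(** Density of the centred Gaussian law of variance [a / 4], relative to variance
    [1/4]. *)
Definition tilt (a : R) (v : R) : R := (Num.sqrt a)^-1 * expR (2 * (1 - a^-1) * v ^+ 2).

Lemma tilt_gt0 a v : 0 < a -> 0 < tilt a v.
Proof. by move=> a0; rewrite mulr_gt0 ?expR_gt0// invr_gt0 sqrtr_gt0. Qed.

Lemma measurable_tilt a : measurable_fun setT (tilt a : Rm -> R).
Proof.
apply: measurable_funM => //; apply: measurable_fun_expR.
by apply: measurable_funM => //; exact: measurable_funX.
Qed.

Definition tilt_affinity (a b : R) : R :=
  (Num.sqrt (Num.sqrt a * Num.sqrt b))^-1 * (Num.sqrt ((a^-1 + b^-1) / 2))^-1.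

Lemma integral_sqrt_tilt a b : 0 < a -> 0 < b ->
  (\int[gauss1 R]_v (Num.sqrt (tilt a v * tilt b v))%:E = (tilt_affinity a b)%:E)%E.
Proof.
move=> a0 b0; pose c : R := 2 - a^-1 - b^-1.
have av : 0 < a^-1 by rewrite invr_gt0.
have bv : 0 < b^-1 by rewrite invr_gt0.
have s0 : 0 <= (Num.sqrt (Num.sqrt a * Num.sqrt b))^-1 by rewrite invr_ge0 sqrtr_ge0.
have me : measurable_fun setT (fun v : Rm => expR (c * v ^+ 2)).
  by apply: measurable_fun_expR; apply: measurable_funM => //; exact: measurable_funX.
transitivity (\int[gauss1 R]_v
    ((Num.sqrt (Num.sqrt a * Num.sqrt b))^-1 * expR (c * v ^+ 2))%:E)%E.
  apply: eq_integral => v _; congr _%:E.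
  rewrite /tilt mulrACA -invfM -expRD.
  have -> : 2 * (1 - a^-1) * v ^+ 2 + 2 * (1 - b^-1) * v ^+ 2 =
     c * v ^+ 2 + c * v ^+ 2 by rewrite /c; ring.
  rewrite expRD -expr2 sqrtrM ?invr_ge0 ?mulr_ge0 ?sqrtr_ge0// sqrtr_sqr gtr0_norm ?expR_gt0//.
  by rewrite sqrtrV// mulr_ge0 ?sqrtr_ge0.
rewrite integralZ_real//.
rewrite gauss1_expsq; last by rewrite /c; lra.
rewrite -EFinM /tilt_affinity; congr (_ * (Num.sqrt _)^-1)%:E.
by rewrite /c; field; rewrite !gt_eqF.
Qed.

Lemma tilt_affinity_diag a : 0 < a -> tilt_affinity a a = 1.
Proof.
move=> a0; rewrite /tilt_affinity -expr2 sqr_sqrtr ?ltW//.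
have -> : (a^-1 + a^-1) / 2 = a^-1 by field; rewrite gt_eqF.
by rewrite sqrtrV ?ltW// invrK mulVf// gt_eqF// sqrtr_gt0.
Qed.

Lemma tilt_affinityC a b : tilt_affinity a b = tilt_affinity b a.
Proof. by rewrite /tilt_affinity (mulrC (Num.sqrt a)) (addrC a^-1). Qed.

Lemma tilt_affinity_sqr_ge e : 0 <= e -> 1 - e ^+ 2 / 4 <= tilt_affinity (1 + e) 1 ^+ 2.
Proof.
move=> e0; have u0 : 0 < 1 + e by lra.
pose u := Num.sqrt (1 + e); have u2 : u ^+ 2 = 1 + e by rewrite sqr_sqrtr// ltW.
have up : 0 < u by rewrite sqrtr_gt0.
have h0 : 0 <= ((1 + e)^-1 + 1^-1) / 2.
  by rewrite divr_ge0// addr_ge0// invr_ge0 ltW.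
rewrite /tilt_affinity exprMn !exprVn sqrtr1 mulr1 !sqr_sqrtr ?sqrtr_ge0// -/u -u2 invr1.
have -> : u^-1 * ((u ^- 2 + 1) / 2)^-1 = 2 * u / (1 + u ^+ 2).
  by field; rewrite !gt_eqF//= ?addr_gt0// exprn_gt0.
rewrite ler_pdivlMr ?ltr_wpDr ?exprn_gt0//; last by nra.
have e2 : e = u ^+ 2 - 1 by rewrite u2; ring.
rewrite e2.
have u1 : 1 <= u by nra.
have h : 4 * (u - 1) ^+ 2 <= (u ^+ 2 - 1) ^+ 2.
  have -> : (u ^+ 2 - 1) ^+ 2 = (u + 1) ^+ 2 * (u - 1) ^+ 2 by ring.
  by rewrite ler_wpM2r ?sqr_ge0//; nra.
have h2 : (u ^+ 2 - 1) ^+ 2 <= (u ^+ 2 - 1) ^+ 2 * (1 + u ^+ 2).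
  by rewrite ler_peMr ?sqr_ge0// lerDl sqr_ge0.
nra.
Qed.

End variance_tilt.

Section diagonal_model.
Context {R : realType} (d : nat).
Local Notation Rm := (measurableTypeR R).
Let T := d.-tuple Rm.
Let Gx : probability T R := tuple_power (gauss1 R) d.
Implicit Types (w : 'I_d -> R).

Definition diagonal_mx w : 'M[R]_d := diag_mx (\row_i (w i / 4)).

Definition diagonal_density w (x : T) : R := \prod_i tilt (w i) (tnth x i).

Lemma conj_diagonal_mx w (s : 'S_d) :
  conj_perm (diagonal_mx w) s = diagonal_mx (fun i => w (s i)).
Proof. by apply/matrixP => i j; rewrite !mxE (inj_eq perm_inj). Qed.

Lemma integral_sqrt_diagonal_density w w' :
  (forall i, 0 < w i) -> (forall i, 0 < w' i) ->
  (\int[Gx]_x (Num.sqrt (diagonal_density w x * diagonal_density w' x))%:E =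
    (\prod_i tilt_affinity (w i) (w' i))%:E)%E.
Proof.
move=> w0 w'0.
under eq_integral => x _.
  have -> : Num.sqrt (diagonal_density w x * diagonal_density w' x) =
      \prod_i Num.sqrt (tilt (w i) (tnth x i) * tilt (w' i) (tnth x i)).
    by rewrite /diagonal_density -big_split/= sqrtr_prod// => i; rewrite ltW// mulr_gt0// tilt_gt0.
  over.
apply: (@integral_tuple_power_prod _ _ _ (gauss1 R) d
  (fun i v => Num.sqrt (tilt (w i) v * tilt (w' i) v))).
- move=> i; apply: measurable_fun_sqrt; first by move=> v; rewrite mulr_gt0// tilt_gt0.
  by apply: measurable_funM; exact: measurable_tilt.
- by move=> i v; exact: sqrtr_ge0.
- by move=> i; exact: integral_sqrt_tilt.
Qed.

Lemma gaussian_density_diagonal w : (forall i, 0 < w i) ->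
  gaussian_density (diagonal_mx w) (diagonal_density w).
Proof.
move=> w0; have f0 x : 0 < diagonal_density w x by apply: prodr_gt0 => i _; exact: tilt_gt0.
split=> //.
- by apply: (measurable_tuple_prod (h := fun i => tilt (w i))) => i; exact: measurable_tilt.
- have := integral_sqrt_diagonal_density w0 w0.
  rewrite big1 => [<-|i _]; last exact: tilt_affinity_diag.
  by apply: eq_integral => x _; rewrite -expr2 sqrtr_sqr gtr0_norm.
move=> x.
pose v : 'rV[R]_d := \row_i (4 / w i).
have inv : diag_mx v *m diagonal_mx w = 1%:M.
  rewrite /diagonal_mx mulmx_diag -diag_const_mx; congr diag_mx.
  by apply/rowP => i; rewrite !mxE; field; rewrite gt_eqF.
have invE : invmx (diagonal_mx w) = diag_mx v.
  have [_ U] := mulmx1_unit inv.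
  by rewrite -[LHS]mul1mx -inv -mulmxA mulmxV// mulmx1.
rewrite /gaussian_pdf invE det_diag.
have -> : (2 * pi) ^+ d * \prod_i (\row_i (w i / 4)) 0 i = \prod_i (2 * pi * (w i / 4)) :> R.
  rewrite big_split/= prodr_const card_ord; congr (_ * _).
  by apply: eq_bigr => i _; rewrite mxE.
have pi0 := @pi_gt0 R.
rewrite sqrtr_prod; last by move=> i; rewrite !mulr_ge0 ?invr_ge0 ?(ltW pi0)// ltW.
rewrite -prodfV.
have -> : (\col_i tnth x i)^T *m diag_mx v *m (\col_i tnth x i) =
    const_mx (\sum_i 4 / w i * tnth x i ^+ 2).
  apply/matrixP => i j; rewrite !mxE; apply: eq_bigr => k _.
  rewrite !mxE (bigD1 k)//= !mxE eqxx mulr1n big1 ?addr0; last first.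
    by move=> l lk; rewrite !mxE (negbTE lk) mulr0.
  by ring.
rewrite mxE -sumrN mulr_suml expR_sum -!big_split/=; apply: eq_bigr => i _.
rewrite normal_pdfE// /normal_fun subr0 /tilt.
rewrite [RHS]mulrACA -expRD; congr (_ * expR _); last by field; rewrite gt_eqF.
rewrite -invfM; congr (_^-1); rewrite -sqrtrM; last first.
  by rewrite mulrn_wge0// mulr_ge0 ?sqr_ge0// ltW.
by congr Num.sqrt; rewrite -[_ *+ 2]mulr_natl; field.
Qed.

Lemma diagonal_parameters w (s : 'S_d) : (forall i, 0 < w i <= 2) ->
  parameters (s, diagonal_mx w).
Proof.
move=> hw; have w0 i : 0 < w i by case/andP: (hw i).
have mulE (x : 'cV[R]_d) i : (diagonal_mx w *m x) i 0 = w i / 4 * x i 0.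
  by rewrite /diagonal_mx mul_diag_mx mxE mxE.
split=> /=.
  split; first by rewrite /diagonal_mx tr_diag_mx.
  move=> x x0; rewrite -mulmxA mxE.
  have [i xi] : exists i, x i 0 != 0.
    apply: contrapT => hn; case/eqP: x0; apply/matrixP => i j.
    rewrite ord1 [RHS]mxE; apply/eqP/negPn/negP => h; apply: hn.
    by exists i.
  have t0 j : 0 <= x^T 0 j * (diagonal_mx w *m x) j 0.
    rewrite mulE mxE mulrCA mulr_ge0 ?divr_ge0 ?(ltW (w0 j))//.
    by rewrite -expr2 sqr_ge0.
  rewrite (bigD1 i)//= ltr_wpDr//; first by apply: sumr_ge0.
  by rewrite mulE mxE mulrCA mulr_gt0 ?divr_gt0// -expr2 exprn_even_gt0.
apply: operator_norm_le1 => x; apply: ler_sum => i _.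
rewrite mulE exprMn ler_piMl ?sqr_ge0//; have /andP[h1 h2] := hw i.
by rewrite expr_le1// ?divr_ge0 ?(ltW h1)//; lra.
Qed.

Lemma diagonal_loss_ge w w' i :
  (w i - w' i) ^+ 2 / 16 <= frobenius_norm (diagonal_mx w - diagonal_mx w') ^+ 2.
Proof.
rewrite frobenius_sqr (bigD1 i)//= (bigD1 i)//= !mxE eqxx -!addrA ler_wpDr//.
  rewrite addr_ge0// ?sumr_ge0// => j _; rewrite ?sqr_ge0// sumr_ge0// => k _.
  exact: sqr_ge0.
by rewrite !mulr1n le_eqVlt; apply/orP; left; apply/eqP; field.
Qed.

End diagonal_model.

Section small_dimension.
Context {R : realType} (d : nat).
Local Notation Rm := (measurableTypeR R).
Let T := d.-tuple Rm.
Let Gx : probability T R := tuple_power (gauss1 R) d.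

Definition spike (e : R) (i j : 'I_d) : R := if j == i then 1 + e else 1.

Lemma spike_bounds e i j : 0 <= e <= 1 -> 0 < spike e i j <= 2.
Proof. by move=> /andP[e0 e1]; rewrite /spike; case: eqP => _; lra. Qed.

Lemma affinity_spikes e (i0 i1 : 'I_d) : i0 != i1 -> 0 <= e ->
  \prod_i tilt_affinity (spike e i0 i) (spike e i1 i) = tilt_affinity (1 + e) 1 ^+ 2.
Proof.
move=> i01 e0; pose a := tilt_affinity (1 + e) 1.
rewrite (eq_bigr (fun i => (if i == i0 then a else 1) * (if i == i1 then a else 1))).
  by rewrite big_split/= -!big_mkcond/= !big_pred1_eq.
move=> i _; rewrite /spike; case: (eqVneq i i0) => [->|_].
  by rewrite (negbTE i01) mulr1.
case: (eqVneq i i1) => _; first by rewrite mul1r tilt_affinityC.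
by rewrite mulr1 tilt_affinity_diag.
Qed.

(** One variance is raised by [e], with [e ^+ 2 = k^-1] for the smaller sample
    size [k]. The two hypotheses place this spike at different coordinates in the
    smaller sample and agree on the larger one, so the affinity of the data is
    at least [3/4]. *)
Lemma small_dimension_bound m n (pihat : samples R m n d -> 'S_d) (r : R) :
  (1 < d)%N -> (0 < m)%N -> (0 < n)%N -> estimator pihat ->
  (forall s S, parameters (s, S) -> (risk pihat S s <= r%:E)%E) ->
  1 <= 128 * (minn m n)%:R * r.
Proof.
move=> d1 m0 n0 mpi hr.
pose i0 : 'I_d := Ordinal (ltnW d1); pose i1 : 'I_d := Ordinal d1.
have i01 : i0 != i1 by [].
set k := minn m n; have k0 : (0 < k)%N by rewrite leq_min m0.
have K0 : 0 < k%:R :> R by rewrite ltr0n.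
have K1 : 1 <= k%:R :> R by rewrite ler1n.
pose e : R := Num.sqrt k%:R^-1.
have e2 : e ^+ 2 = k%:R^-1 by rewrite sqr_sqrtr// invr_ge0 ltW.
have e0 : 0 < e by rewrite sqrtr_gt0 invr_gt0.
have e1 : e <= 1.
  by rewrite -(@ler_pXn2r _ 2)// ?nnegrE ?(ltW e0)// e2 expr1n invf_le1.
have e01 : 0 <= e <= 1 by rewrite (ltW e0).
pose w := spike e i0; pose w' := spike e i1.
have sb i j := spike_bounds i j e01.
have sp i j : 0 < spike e i j by case/andP: (sb i j).
have dw : gaussian_density (diagonal_mx w) (diagonal_density w).
  by apply: gaussian_density_diagonal => i; exact: sp.
have dw' : gaussian_density (diagonal_mx w') (diagonal_density w').
  by apply: gaussian_density_diagonal => i; exact: sp.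
pose t : 'S_d := tperm i0 i1.
have wt : conj_perm (diagonal_mx w) t = diagonal_mx w'.
  rewrite conj_diagonal_mx; congr diagonal_mx; apply/funext => i.
  rewrite /w /w' /spike; congr (if _ then _ else _).
  by rewrite -(inj_eq (@perm_inj _ t)) tpermK tpermL.
have c1 v : conj_perm (diagonal_mx v) 1%g = diagonal_mx v.
  by rewrite conj_diagonal_mx; congr diagonal_mx; apply/funext => i; rewrite perm1.
have same v : gaussian_density (diagonal_mx v) (diagonal_density v) ->
    (\int[Gx]_x (Num.sqrt (diagonal_density v x * diagonal_density v x))%:E = 1%:E)%E.
  move=> [_ v0 <- _]; apply: eq_integral => x _.
  by rewrite -expr2 sqrtr_sqr gtr0_norm.
pose rho := tilt_affinity (1 + e) 1 ^+ 2.
have diff : (\int[Gx]_x (Num.sqrt (diagonal_density w x * diagonal_density w' x))%:E = rho%:E)%E.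
  rewrite integral_sqrt_diagonal_density; last 2 first.
  - by move=> i; exact: sp.
  - by move=> i; exact: sp.
  by rewrite affinity_spikes// ltW.
have thr0 : 0 < e ^+ 2 / 16 by rewrite divr_gt0// exprn_gt0.
(* the permuted covariance has its spike at the preimage of the spike *)
have far (j i : 'I_d) (s : 'S_d) : s j != i ->
    e ^+ 2 / 16 <= frobenius_norm (conj_perm (diagonal_mx (spike e i)) s -
      diagonal_mx (spike e j)) ^+ 2.
  move=> sji; rewrite conj_diagonal_mx; apply: le_trans (diagonal_loss_ge _ _ j).
  by rewrite /spike (negbTE sji) eqxx opprD addNKr sqrrN.
have key (a b : R) : a ^+ m * b ^+ n = rho ^+ k ->
    a ^+ m * b ^+ n <= 2 * (r / (e ^+ 2 / 16)) + 2^-1 -> 1 <= 128 * k%:R * r.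
  move=> -> h.
  have q1 : 1 - e ^+ 2 / 4 <= rho by exact: tilt_affinity_sqr_ge (ltW e0).
  have q0 : 0 <= e ^+ 2 / 4 <= 1.
    have : e ^+ 2 <= 1 by rewrite e2 invf_le1.
    by rewrite divr_ge0 ?sqr_ge0//=; lra.
  have q2 : 1 - k%:R * (e ^+ 2 / 4) <= rho ^+ k.
    apply: le_trans (bernoulli_le k q0) _.
    by rewrite lerXn2r ?nnegrE//; case/andP: q0 => ? ?; lra.
  have q3 : k%:R * (e ^+ 2 / 4) = 4^-1 by rewrite e2; field; rewrite gt_eqF.
  have q4 : r / (e ^+ 2 / 16) = 16 * k%:R * r.
    by rewrite e2; field; rewrite gt_eqF.
  rewrite q3 in q2; rewrite q4 in h; lra.
have [nm|mn] := leqP n m.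
- apply: (@key 1 rho); first by rewrite expr1n mul1r /k (minn_idPr nm).
  apply: (@two_point_bound R d m n (diagonal_mx w) (diagonal_mx w) 1%g t
    (diagonal_density w) (diagonal_density w) (diagonal_density w) (diagonal_density w')
    pihat) => //; rewrite ?c1 ?wt//.
  + move=> s; case: (eqVneq (s i0) i0) => [h|h]; apply/orP; [right|left]; apply: far => //.
    by rewrite -h (inj_eq perm_inj).
  + exact: same dw.
  + by apply: hr; apply: diagonal_parameters => i; exact: sb.
  + by apply: hr; apply: diagonal_parameters => i; exact: sb.
- apply: (@key rho 1); first by rewrite expr1n mulr1 /k (minn_idPl (ltnW mn)).
  apply: (@two_point_bound R d m n (diagonal_mx w) (diagonal_mx w') t 1%g
    (diagonal_density w) (diagonal_density w') (diagonal_density w') (diagonal_density w')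
    pihat) => //; rewrite ?c1 ?wt//.
  + move=> s; case: (eqVneq (s i1) i0) => [h|h]; apply/orP; [right|left]; apply: far => //.
    by rewrite h.
  + exact: same dw'.
  + by apply: hr; apply: diagonal_parameters => i; exact: sb.
  + by apply: hr; apply: diagonal_parameters => i; exact: sb.
Qed.

End small_dimension.

(** * The minimax bound *)

Section assembly.
Context {R : realType}.

Lemma large_dimension_minimax m n d (pihat : samples R m n d -> 'S_d) (r c : R) :
  64 * 64 <= Num.sqrt d%:R :> R -> (0 < m)%N -> (0 < n)%N ->
  ln d%:R <= (minn m n)%:R :> R -> (d <= maxn m n)%N ->
  0 < c -> 6400 * c <= 384^-1 ->
  estimator pihat -> 0 <= r ->
  (forall s S, parameters (s, S) -> (risk pihat S s <= r%:E)%E) ->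
  c / 2 * (d%:R * ln d%:R / (minn m n)%:R +
      Num.sqrt (d%:R ^+ 3 * ln d%:R / (m%:R * n%:R))) <= 8 * (6144 * 2) * r.
Proof.
have [p [q [pqd]]] : exists p q, (p + q = d)%N /\ p = (d %/ 2)%N.
  by exists (d %/ 2)%N, (d - d %/ 2)%N; split=> //; lia.
case: _ / pqd pihat => pihat pE *.
exact: (large_dimension_bound pE).
Qed.

(** In bounded dimension both terms of the rate are of the order of the inverse
    of the smaller sample size. *)
Lemma rate_le_sqr m n d : (0 < m)%N -> (0 < n)%N -> (0 < d)%N ->
  d%:R * ln d%:R / (minn m n)%:R + Num.sqrt (d%:R ^+ 3 * ln d%:R / (m%:R * n%:R)) <=
    2 * d%:R ^+ 2 / (minn m n)%:R :> R.
Proof.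
move=> m0 n0 d0; set D : R := d%:R; set K : R := (minn m n)%:R.
have D0 : 0 < D by rewrite ltr0n.
have K0 : 0 < K by rewrite ltr0n leq_min m0.
have LD : ln D <= D by have := ln_le_sub1 D0; lra.
have mn0 : 0 < m%:R * n%:R :> R by rewrite mulr_gt0 ?ltr0n.
have mn : K ^+ 2 <= m%:R * n%:R.
  by rewrite expr2 ler_pM ?ler0n// ler_nat ?geq_minl ?geq_minr.
have -> : 2 * D ^+ 2 / K = D * D / K + D ^+ 2 / K by field; rewrite gt_eqF.
apply: lerD.
  by rewrite ler_pM2r ?invr_gt0// ler_pM2l.
have h0 : 0 <= D ^+ 2 / K by rewrite divr_ge0 ?sqr_ge0// ltW.
rewrite -[leRHS](ger0_norm h0) -sqrtr_sqr; apply: ler_wsqrtr.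
rewrite exprMn exprVn -exprM.
apply: (@le_trans _ _ (D ^+ 4 / (m%:R * n%:R))).
  by rewrite ler_pM2r ?invr_gt0// [leRHS]exprSr ler_pM2l ?exprn_gt0.
by rewrite ler_pM2l ?exprn_gt0// lef_pV2 ?posrE// exprn_gt0.
Qed.

Lemma minimax_risk_ge m n d (x : R) :
  (forall (pihat : samples R m n d -> 'S_d) (r : R), estimator pihat -> 0 <= r ->
    (forall s S, parameters (s, S) -> (risk pihat S s <= r%:E)%E) -> x <= r) ->
  (x%:E <= minimax_risk R m n d)%E.
Proof.
move=> h; apply: le_ereal_inf_tmp => _ [pihat mpi <-].
set M := ereal_sup _.
have hM s S : parameters (s, S) -> (risk pihat S s <= M)%E.
  by move=> sS; apply: ereal_sup_ubound; exists (s, S).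
have M0 : (0 <= M)%E.
  pose S0 : 'M[R]_d := diagonal_mx (fun=> 1).
  have p1 : parameters (1%g : 'S_d, S0).
    by apply: diagonal_parameters => i; rewrite ltr01/= ler1n.
  have h0 : (0 <= risk pihat S0 1%g)%E.
    have dS : gaussian_density S0 (diagonal_density (fun=> 1)).
      by apply: gaussian_density_diagonal.
    have dS' : gaussian_density (conj_perm S0 1%g) (diagonal_density (fun=> 1)).
      by rewrite /S0 conj_diagonal_mx.
    have := risk_ge dS dS' mpi (lexx 0) (A := pred0).
    by rewrite mul0e; apply.
  have h1 := hM _ _ p1.
  exact: (le_trans h0 h1).
move: M M0 hM => [r| |] // r0 hr; last by rewrite leey.
by rewrite lee_fin; exact: (h pihat r mpi).
Qed.

End assembly.

Theorem theorem4 (R : realType) :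
  exists c0 : R, 0 < c0 /\
    forall m n d : nat, (0 < m)%N -> (0 < n)%N -> (0 < d)%N ->
      ln d%:R <= (minn m n)%:R :> R ->
      (d <= maxn m n)%N ->
      ((c0 * (d%:R * ln d%:R / (minn m n)%:R +
              Num.sqrt (d%:R ^+ 3 * ln d%:R / (m%:R * n%:R))))%:E
         <= minimax_risk R m n d)%E.
Proof.
pose c : R := (6400 * 384)^-1.
pose cl : R := c / 2 / (8 * (6144 * 2)).
pose B : R := (64 * 64) ^+ 2.
pose cs : R := (256 * B ^+ 2)^-1.
have p6400 : 0 < 6400 :> R by rewrite ltr0n.
have p384 : 0 < 384 :> R by rewrite ltr0n.
have p6144 : 0 < 6144 :> R by rewrite ltr0n.
have p2 : 0 < 2 :> R by rewrite ltr0n.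
have p64 : 0 < 64 :> R by rewrite ltr0n.
have p8 : 0 < 8 * (6144 * 2) :> R.
  by apply: mulr_gt0; [rewrite ltr0n|exact: (mulr_gt0 p6144 p2)].
have p256 : 0 < 256 :> R by rewrite ltr0n.
have B0 : 0 < B by apply: exprn_gt0; exact: (mulr_gt0 p64 p64).
have B2 : 0 < B ^+ 2 by exact: exprn_gt0.
have c0 : 0 < c by rewrite invr_gt0; exact: (mulr_gt0 p6400 p384).
have c_small : 6400 * c <= 384^-1.
  by rewrite /c invfM mulrA (mulfV (lt0r_neq0 p6400)) mul1r; exact: lexx.
have cl0 : 0 < cl by exact: (divr_gt0 (divr_gt0 c0 p2) p8).
have cs0 : 0 < cs by rewrite invr_gt0; exact: (mulr_gt0 p256 B2).
exists (Num.min cl cs); split; first by rewrite lt_min cl0.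
move=> m n d m0 n0 d0 Lk dN; apply: minimax_risk_ge => pihat r mpi r0 hr.
set X := _ + _.
have L0 : 0 <= ln d%:R :> R by rewrite ln_ge0// ler1n.
have X0 : 0 <= X.
  by rewrite addr_ge0 ?sqrtr_ge0// divr_ge0// mulr_ge0.
have [large|small] := leP (64 * 64) (Num.sqrt d%:R : R).
  have := large_dimension_minimax large m0 n0 Lk dN c0 c_small mpi r0 hr.
  rewrite -/X => h; apply: (@le_trans _ _ (cl * X)).
    by rewrite ler_wpM2r// ge_min lexx.
  rewrite /cl mulrAC (ler_pdivrMr _ _ p8); apply: (le_trans h).
  by rewrite mulrC; exact: lexx.
have [d1|d1] := leqP d 1.
  have dE : d = 1%N by apply/eqP; rewrite eqn_leq d1.
  by rewrite /X dE ln1 !mulr0 !mul0r sqrtr0 addr0 mulr0.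
have h := small_dimension_bound d1 m0 n0 mpi hr.
have hX := @rate_le_sqr R m n d m0 n0 d0; rewrite -/X in hX.
have K0 : 0 < (minn m n)%:R :> R by rewrite ltr0n leq_min m0.
have DB : d%:R <= B.
  rewrite -(sqr_sqrtr (ler0n R d)) /B; apply: lerXn2r.
  - by rewrite nnegrE sqrtr_ge0.
  - by rewrite nnegrE; exact: (ltW (mulr_gt0 p64 p64)).
  - exact: (ltW small).
have D2B2 : d%:R ^+ 2 <= B ^+ 2.
  by apply: lerXn2r; rewrite ?nnegrE ?ler0n ?(ltW B0).
apply: (@le_trans _ _ (cs * X)); first by rewrite ler_wpM2r// ge_min lexx orbT.
rewrite /cs mulrC (ler_pdivrMr _ _ (mulr_gt0 p256 B2)).
apply: (le_trans hX); rewrite (ler_pdivrMr _ _ K0).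
apply: (@le_trans _ _ (2 * B ^+ 2 * 1)); first by rewrite mulr1 ler_wpM2l// ltW.
apply: (@le_trans _ _ (2 * B ^+ 2 * (128 * (minn m n)%:R * r))).
  by rewrite ler_wpM2l// mulr_ge0// ltW.
move: (B ^+ 2) => b; rewrite le_eqVlt; apply/orP; left; apply/eqP; ring.
Qed.
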